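(* Let $\kappa>0$. Let $\nu_N=\mathcal N(\vec 0,(\kappa L_N)^{-1})$ be the centered Gaussian measure on $\mathbb{R}^N$ with covariance matrix $(\kappa L_N)^{-1}$, and let $\nu=\mathcal N(\vec 0,(\kappa\mathcal L)^{-1})$ be the centered Gaussian measure on $L^2(S^1)$ with covariance operator $(\kappa\mathcal L)^{-1}$, $\mathcal L=-\partial_t^2+\mathrm{Id}$. Then $(\mathcal I_N)_\#\nu_N\Rightarrow\nu$ weakly as probability measures on $L^2(S^1)$ as $N\to\infty$.
   Context: $S^1$ is the interval $[0,1]$ with endpoints glued; $L^2(S^1)$ is the real $L^2$ space; $\mathcal L=-\partial_t^2+\mathrm{Id}$ is taken with periodic boundary conditions (domain $H^2(S^1)$). Vectors in $\mathbb{R}^N$ are $\vec f=(f_0,\dots,f_{N-1})$ with indices understood modulo $N$. The reconstruction map $\mathcal I_N:\mathbb{R}^N\to L^2(S^1)$ is $(\mathcal I_N\vec f)(t)=f_m$ for $t\in[m/N,(m+1)/N)$, $0\le m\le N-1$, and $(\mathcal I_N)_\#$ denotes pushforward of measures. The symmetric positive definite matrix $L_N$ is defined by $$\langle\vec f,L_N\vec f\rangle_{\ell^2}=\frac1N\sum_{i=0}^{N-1}\big[f_i^2+N^2(f_{i+1}-f_i)^2\big],$$ i.e. $(L_N\vec f)_i=\frac1N\big[f_i-N^2(f_{i+1}-2f_i+f_{i-1})\big]$. *)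

(* Defs.v *)
From HB Require Import structures.
From mathcomp Require Import all_boot all_order all_algebra.
From mathcomp Require Import all_classical all_reals all_analysis.
From mathcomp Require Import measurable_realfun ring.

Set Implicit Arguments.
Unset Strict Implicit.
Unset Printing Implicit Defensive.

Import Order.TTheory GRing.Theory Num.Theory.
Import numFieldNormedType.Exports.

Local Open Scope classical_set_scope.
Local Open Scope ring_scope.

Notation borel T := (g_sigma_algebraType (@open T)).

Lemma continuous_borel_measurable (T U : ptopologicalType) (f : T -> U) :
  continuous f -> measurable_fun [set: borel T] (f : borel T -> borel U).
Proof.
move=> cf.
apply: (@measurability _ _ (borel T) (borel U) setT f (@open U)) => //.
move=> _ [B oB <-].
by rewrite setTI; apply: sub_sigma_algebra; exact: (continuousP _).1.
Qed.

Section weak_convergence.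
Context {R : realType} {T : ptopologicalType}.

Definition weakly_converges (P : nat -> probability (borel T) R)
    (Q : probability (borel T) R) :=
  forall phi : T -> R, continuous phi -> bounded_fun phi ->
    \int[P n]_x phi x @[n --> \oo] --> \int[Q]_x phi x.

End weak_convergence.

Section gaussian.
Context {R : realType}.

(* [normal_prob m 0] is a junk value; the Gaussian law of variance 0 is the
   Dirac mass. *)
Definition gaussian_law (m s : R) : set (measurableTypeR R) -> \bar R :=
  if s == 0 then \d_m else normal_prob m s.

Context {T : ptopologicalType} (dot : T -> T -> R).

Definition gaussian_measure (P : probability (borel T) R) :=
  forall h : T, exists m s : R, forall A : set (measurableTypeR R),
    measurable A -> pushforward P (dot h) A = gaussian_law m s A.

Definition centered (P : probability (borel T) R) :=
  forall h : T, ('E_P[dot h] = 0)%E.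

Definition covariance_operator (P : probability (borel T) R) (C : T -> T) :=
  forall h k : T, covariance P (dot h) (dot k) = (dot h (C k))%:E.

Definition centered_gaussian (C : T -> T) (P : probability (borel T) R) :=
  [/\ gaussian_measure P, centered P & covariance_operator P C].

End gaussian.

Section circle.
Context (R : realType).

(* Lebesgue measure on [0, 1[, the circle being [0, 1] with glued endpoints *)
Definition circle_measure : {measure set (measurableTypeR R) -> \bar R} :=
  mrestr (@lebesgue_measure R) (measurable_itv `[0%R, 1%R[).

Local Notation mu := circle_measure.

Definition L2circle : Type := LspaceType2 mu.

Definition L2fun (f : L2circle) : measurableTypeR R -> R :=
  (f : {mfun_ mu, _ >-> _}).
Coercion L2fun : L2circle >-> Funclass.

HB.instance Definition _ := gen_eqMixin L2circle.
HB.instance Definition _ := gen_choiceMixin L2circle.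

Lemma measurable_L2fun (f : L2circle) : measurable_fun setT f.
Proof. exact: (measurable_funPT (repr (LebesgueSpace.sort f))). Qed.

Lemma L2fun_fin (f : L2circle) : finite_norm mu 2%:E f.
Proof. by case: f => f [[]]. Qed.

Lemma Lnorm2E (f : measurableTypeR R -> R) :
  ('N[mu]_2%:E[EFin \o f] = (\int[mu]_x (f x ^+ 2)%:E) `^ 2^-1)%E.
Proof.
rewrite unlock; congr poweR; apply: eq_integral => x _ /=.
by rewrite powR_mulrn ?normr_ge0// real_normK ?num_real.
Qed.

Lemma Lnorm2_ae (f g : measurableTypeR R -> R) :
  measurable_fun setT f -> measurable_fun setT g ->
  {ae mu, forall x, f x = g x} ->
  ('N[mu]_2%:E[EFin \o f] = 'N[mu]_2%:E[EFin \o g])%E.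
Proof.
move=> mf mg fg; rewrite !Lnorm2E; congr poweR.
apply: ae_eq_integral => //.
- by apply/measurable_EFinP; exact: measurable_funX.
- by apply/measurable_EFinP; exact: measurable_funX.
- by apply: filterS fg => x /= -> _.
Qed.

Lemma L2fun_eq (f g : L2circle) : {ae mu, forall x, f x = g x} -> f = g.
Proof.
case: f g => [f [[fF]]] [g [[gF]]]; rewrite /L2fun /= => fg.
have e : f = g.
  rewrite -[f]reprK -[g]reprK; apply/eqP; rewrite eqmodE; apply/asboolP.
  by apply: filterS fg => x e _; exact: e.
by subst g; rewrite (bool_irrelevance gF fF).
Qed.

Section L2_of.
Variable f : {mfun measurableTypeR R >-> measurableTypeR R}.
Let q : {mfun_ mu, measurableTypeR R >-> measurableTypeR R} := \pi%qT f.

Let repr_ae : {ae mu, forall x, q x = f x}.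
Proof.
have : (\pi_({mfun_ mu, measurableTypeR R >-> measurableTypeR R}) (repr q) ==
  \pi_({mfun_ mu, measurableTypeR R >-> measurableTypeR R}) f)%qT.
  by rewrite reprK.
by rewrite eqmodE => /asboolP; apply: filterS => x /(_ Logic.I).
Qed.

Hypothesis fF : finite_norm mu 2%:E f.

Let qF : finite_norm mu 2%:E q.
Proof.
rewrite /finite_norm (Lnorm2_ae _ _ repr_ae)//.
  exact: (measurable_funPT (repr q)).
exact: (measurable_funPT f).
Qed.

(* the class of [f] modulo almost everywhere equality *)
Definition L2_of : L2circle :=
  LebesgueSpace.Pack (LebesgueSpace.Class
    (isFinLebesgue.Build _ _ _ mu 2%:E (lee1n 2) q qF)).

Lemma L2_ofE : {ae mu, forall x, L2_of x = f x}.
Proof. exact: repr_ae. Qed.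

End L2_of.

Definition L2dist (f g : L2circle) : R := fine 'N[mu]_2%:E[EFin \o (f \- g)].

Let L2B_lty (f g : L2circle) : ('N[mu]_2%:E[EFin \o (f \- g)%R] < +oo)%E.
Proof.
have mf := measurable_L2fun f; have mg := measurable_L2fun g.
have -> : (f \- g = f \+ (\- g))%R by [].
apply: (le_lt_trans (eminkowski _ _ _ _)) => //.
- exact: measurableT_comp.
- by rewrite lee1n.
- rewrite lte_add_pinfty//; first exact: L2fun_fin.
  rewrite (_ : EFin \o _ = \- (EFin \o g))%E// oppe_Lnorm; exact: L2fun_fin.
Qed.

Lemma L2distE f g : ((L2dist f g)%:E = 'N[mu]_2%:E[EFin \o (f \- g)%R])%E.
Proof. by rewrite /L2dist fineK// ge0_fin_numE ?Lnorm_ge0// L2B_lty. Qed.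

Lemma L2distxx f : L2dist f f = 0.
Proof.
apply/EFin_inj; rewrite L2distE -[RHS](@Lnorm0 _ _ _ mu 2%:E).
  by apply: eq_Lnorm => x /=; rewrite subrr.
by rewrite eqe pnatr_eq0.
Qed.

Lemma L2dist_positivity f g : L2dist f g = 0 -> f = g.
Proof.
move=> fg; apply: L2fun_eq.
have : ('N[mu]_2%:E[EFin \o (f \- g)%R] = 0)%E by rewrite -L2distE fg.
move/Lnorm_eq0_eq0.
have h : measurable_fun setT (EFin \o (f \- g)%R).
  apply/measurable_EFinP; apply: measurable_funB; exact: measurable_L2fun.
move=> /(_ h); rewrite lte_fin ltr0n => /(_ isT).
by apply: filterS => x /(_ Logic.I) /= [] /eqP; rewrite subr_eq0 => /eqP.
Qed.

Lemma L2dist_sym f g : L2dist f g = L2dist g f.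
Proof.
apply/EFin_inj; rewrite !L2distE -[LHS]oppe_Lnorm.
by apply: eq_Lnorm => x /=; rewrite opprB.
Qed.

Lemma L2dist_triangle g f h : L2dist f h <= L2dist f g + L2dist g h.
Proof.
rewrite -lee_fin EFinD !L2distE.
rewrite (@eq_Lnorm _ _ _ mu _ _ (EFin \o ((f \- g) \+ (g \- h)))%R); last first.
  by move=> x /=; rewrite addrA subrK.
apply: eminkowski; rewrite ?lee1n//; apply: measurable_funB;
  exact: measurable_L2fun.
Qed.

HB.instance Definition _ := isMetric.Build R L2circle
  L2distxx L2dist_positivity L2dist_sym L2dist_triangle.

Let cst0F :
  finite_norm mu 2%:E (cst 0 : measurableTypeR R -> measurableTypeR R).
Proof. by rewrite /finite_norm Lnorm0// eqe pnatr_eq0. Qed.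

HB.instance Definition _ := isPointed.Build L2circle (L2_of cst0F).

Definition L2dot (f g : L2circle) : R := \int[mu]_x (f x * g x).

(* smooth functions on the circle, as 1-periodic smooth functions on the line *)
Definition periodic_smooth (phi : R -> R) :=
  (forall n x, derivable (derive1n n phi) x 1) /\
  (forall x, phi (x + 1) = phi x).

(* no boundary terms, the test functions being periodic *)
Definition weak_derivative (u v : L2circle) :=
  forall phi : R -> R, periodic_smooth phi ->
    \int[mu]_x (u x * derive1 phi x) = - \int[mu]_x (v x * phi x).

(* the graph of - d^2/dt^2 + Id on its domain H^2, i.e., the functions with weak
   first and second derivatives in L^2 *)
Definition scrL_graph (u g : L2circle) :=
  exists v w : L2circle, [/\ weak_derivative u v, weak_derivative v w &
    {ae mu, forall x, g x = - w x + u x}].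

Definition scale_graph (kappa : R) (A : L2circle -> L2circle -> Prop)
    (u g : L2circle) :=
  exists2 h, A u h & {ae mu, forall x, g x = kappa * h x}.

(* the inverse of an injective and surjective operator given by its graph *)
Definition inverse_operator (A : L2circle -> L2circle -> Prop) (g : L2circle) :
  L2circle := get [set u | A u g].

Section reconstruction.
Variable n : nat.
Local Notation N := n.+1.

(* the values outside of [0, 1[ are irrelevant *)
Definition step_fun (f : 'cV[R]_N) (t : measurableTypeR R) :
  measurableTypeR R :=
  \sum_(m < N) f m 0 * \1_(`[m%:R / N%:R, m.+1%:R / N%:R[ : set R) t.

Lemma measurable_step_fun f : measurable_fun setT (step_fun f).
Proof.
by apply: measurable_sum => m; exact: measurable_funM.
Qed.

HB.instance Definition _ f :=
  @isMeasurableFun.Build _ _ _ _ (step_fun f) (measurable_step_fun f).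

Let Lnorm_bound (h : measurableTypeR R -> R) (c : R) : measurable_fun setT h ->
  (forall x, `|h x| <= c) -> ('N[mu]_2%:E[EFin \o h] <= c%:E)%E.
Proof.
move=> mh hc.
have c0 : 0 <= c by exact: le_trans (hc 0).
have -> : (c%:E = (\int[mu]_x (c ^+ 2)%:E) `^ 2^-1)%E.
  rewrite integral_cst//=.
  have -> : mu setT = 1%E.
    rewrite /mu/= /mrestr setTI lebesgue_measure_itv/= lte_fin ltr01.
    by rewrite oppr0 adde0.
  by rewrite mule1 poweR_EFin -powR_mulrn// -powRrM mulfV ?powRr1// pnatr_eq0.
rewrite Lnorm2E; apply: gt0_ler_poweR.
- by rewrite invr_ge0.
- by rewrite in_itv/= leey andbT integral_ge0// => x _; rewrite lee_fin sqr_ge0.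
- by rewrite in_itv/= leey andbT integral_ge0// => x _; rewrite lee_fin sqr_ge0.
apply: ge0_le_integral => //.
- by move=> x _; rewrite lee_fin sqr_ge0.
- by apply/measurable_EFinP; exact: measurable_funX.
- by move=> x _; rewrite lee_fin -(real_normK (num_real (h x))) lerXn2r ?nnegrE.
Qed.

Let step_fun_le f t : `|step_fun f t| <= N%:R * `|f|.
Proof.
apply: (le_trans (ler_norm_sum _ _ _)).
have -> : N%:R * `|f| = \sum_(m < N) `|f|.
  by rewrite sumr_const card_ord mulr_natl.
apply: ler_sum => m _.
rewrite normrM -[leRHS]mulr1; apply: ler_pM => //.
  rewrite [leRHS]mx_normrE.
  exact: (le_bigmax_cond _ (fun i : 'I_N * 'I_1 => `|f i.1 i.2|) (j := (m, 0))).
by rewrite indicE; case: (_ \in _); rewrite ?normr1 ?normr0.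
Qed.

Let step_fun_fin f : finite_norm mu 2%:E (step_fun f).
Proof.
apply: (@le_lt_trans _ _ (N%:R * `|f|)%:E); last exact: ltry.
by apply: Lnorm_bound; [exact: measurable_step_fun|exact: step_fun_le].
Qed.

Definition reconstruction (f : 'cV[R]_N) : L2circle :=
  L2_of (step_fun_fin f).

Let L2dist_reconstruction f g :
  L2dist (reconstruction f) (reconstruction g) <= N%:R * `|f - g|.
Proof.
rewrite -lee_fin L2distE (@Lnorm2_ae _ (step_fun (f - g))).
- by apply: Lnorm_bound; [exact: measurable_step_fun|exact: step_fun_le].
- apply: measurable_funB; exact: measurable_L2fun.
- exact: measurable_step_fun.
have := L2_ofE (step_fun_fin f); have := L2_ofE (step_fun_fin g).
apply: filterS2 => x /= -> ->; rewrite /step_fun -sumrB; apply: eq_bigr => m _.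
by rewrite !mxE mulrBl.
Qed.

Lemma continuous_reconstruction : continuous reconstruction.
Proof.
move=> f A /nbhs_ballP[e /= e0 eA].
have N0 : (0 : R) < N%:R by rewrite ltr0n.
suff h : nbhs f (reconstruction @^-1` A) by exact: h.
apply/nbhs_ballP; exists (e / N%:R) => /=; first by rewrite divr_gt0.
move=> g; rewrite -ball_normE /= => fg; apply: eA; rewrite ballEmdist/=.
by rewrite (le_lt_trans (L2dist_reconstruction f g))// mulrC -ltr_pdivlMr.
Qed.

Lemma measurable_reconstruction :
  measurable_fun [set: borel 'cV[R]_N] (reconstruction : _ -> borel L2circle).
Proof.
exact: (@continuous_borel_measurable 'cV[R]_N L2circle _
  continuous_reconstruction).
Qed.

Definition reconstruction_mfun : {mfun borel 'cV[R]_N >-> borel L2circle} :=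
  mfun_Sub (mem_set measurable_reconstruction).

End reconstruction.

End circle.

Section discrete_operator.
Context {R : realType} (n : nat).
Local Notation N := n.+1.

Definition vec_dot (f g : 'cV[R]_N) : R := \sum_(i < N) f i 0 * g i 0.

(* [ordS] and [ord_pred] are successor and predecessor modulo N; for N <= 2
   some of the indices i, i + 1, i - 1 coincide and their contributions add. *)
Definition discreteL : 'M[R]_N :=
  \matrix_(i, j) (N%:R^-1 * ((j == i)%:R - N%:R ^+ 2 *
    ((j == ordS i)%:R - 2 * (j == i)%:R + (j == ord_pred i)%:R))).

Lemma discreteLE (f : 'cV[R]_N) i : (discreteL *m f) i 0 = N%:R^-1 *
  (f i 0 - N%:R ^+ 2 * (f (ordS i) 0 - 2 * f i 0 + f (ord_pred i) 0)).
Proof.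
have S k : \sum_(j < N) (j == k)%:R * f j 0 = f k 0.
  rewrite (bigD1 k)//= eqxx mul1r big1 ?addr0// => j /negbTE ->.
  by rewrite mul0r.
rewrite mxE; under eq_bigr do rewrite mxE -mulrA.
rewrite -mulr_sumr; congr (_ * _).
rewrite -[in RHS](S i) -(S (ordS i)) -(S (ord_pred i)).
rewrite (mulr_sumr _ _ _ 2) -sumrB -big_split/= mulr_sumr -sumrB.
by apply: eq_bigr => j _; rewrite mulrBl -!mulrA mulrDl mulrBl -!mulrA.
Qed.

Lemma discreteL_form (f : 'cV[R]_N) : vec_dot f (discreteL *m f) = N%:R^-1 *
  \sum_(i < N) (f i 0 ^+ 2 + N%:R ^+ 2 * (f (ordS i) 0 - f i 0) ^+ 2).
Proof.
rewrite /vec_dot; under eq_bigr do rewrite discreteLE mulrCA.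
rewrite -mulr_sumr; congr (_ * _).
have E1 : \sum_(i < N) f (ordS i) 0 ^+ 2 = \sum_(i < N) f i 0 ^+ 2.
  by rewrite [RHS](reindex_inj (can_inj (@ordSK N))).
have E2 : \sum_(i < N) f i 0 * f (ord_pred i) 0 =
          \sum_(i < N) f i 0 * f (ordS i) 0.
  rewrite (reindex_inj (can_inj (@ordSK N))); apply: eq_bigr => i _ /=.
  by rewrite ordSK mulrC.
transitivity (\sum_(i < N) f i 0 ^+ 2 - N%:R ^+ 2 *
  (\sum_(i < N) f i 0 * f (ordS i) 0 - 2 * (\sum_(i < N) f i 0 ^+ 2)
   + \sum_(i < N) f i 0 * f (ord_pred i) 0)).
  rewrite (mulr_sumr _ _ _ 2) -sumrB -big_split/= mulr_sumr -sumrB.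
  by apply: eq_bigr => i _; ring.
rewrite E2 big_split/= -mulr_sumr.
have -> : \sum_(i < N) (f (ordS i) 0 - f i 0) ^+ 2 =
  \sum_(i < N) f (ordS i) 0 ^+ 2 - 2 * (\sum_(i < N) f i 0 * f (ordS i) 0)
  + \sum_(i < N) f i 0 ^+ 2.
  rewrite (mulr_sumr _ _ _ 2) -sumrB -big_split/=.
  by apply: eq_bigr => i _; ring.
by rewrite E1; ring.
Qed.

End discrete_operator.

(* Main.v *)
Require Import Defs.
From HB Require Import structures.
From mathcomp Require Import all_boot all_order all_algebra.
From mathcomp Require Import all_classical all_reals all_analysis.
From mathcomp Require Import measurable_realfun ring lra.

Set Implicit Arguments.
Unset Strict Implicit.
Unset Printing Implicit Defensive.

Import Order.TTheory GRing.Theory Num.Theory.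
Import numFieldNormedType.Exports.

Local Open Scope classical_set_scope.
Local Open Scope ring_scope.

(* By regularization with inf-convolutions it is enough to test against bounded
   Lipschitz functions [phi] of [x]. Under the laws of the reconstructions, [x] is
   close in mean square to its projection on the step functions of a fixed grid with
   [K] cells: the energy of [L_N] bounds the variance of an increment [f_i - f_j] by
   [|i - j| / (kappa N)], so that the mean square distance is at most
   [(1 / K + 1 / N) / kappa]. The value of [phi] at the projection is a bounded
   Lipschitz function of [K] linear functionals of [x]. Replacing each functional [X]
   in turn by a Bernstein polynomial in the sine of [X / l], for [l] large, reduces the
   claim to the convergence of the expectations of [cos (<h, x> + b)]. The variances
   of [<h, x>] being bounded by [|h|^2 / kappa], it is enough to take [h] in the dense
   set of trigonometric polynomials. There both variances are explicit: the cell
   integrals of the mode [cos (2 pi k t + b)] form an eigenvector of [L_N], the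
   eigenvalue of which, multiplied by [N], converges to [1 + (2 pi k)^2]. *)

Section limits.
Context {R : realType}.

Lemma cvg0_natV_mul (c : R) : c * n.+1%:R^-1 @[n --> \oo] --> (0 : R).
Proof. by rewrite -(mulr0 c); apply: cvgMl_tmp; exact: cvg_harmonic. Qed.

Lemma squeeze0_cvgr (u v : nat -> R) : (forall n, `|u n| <= v n) ->
  v n @[n --> \oo] --> (0 : R) -> u n @[n --> \oo] --> (0 : R).
Proof.
move=> uv /cvgrPdist_le v0; apply/cvgrPdist_le => e e0.
apply: filterS (v0 _ e0) => n; rewrite !sub0r !normrN; apply: le_trans.
exact: le_trans (uv n) (ler_norm _).
Qed.

Lemma cvg_of_approx (u : nat -> R) (l : R) (u_ : nat -> nat -> R)
    (l_ a b : nat -> R) :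
  (forall k, u_ k n @[n --> \oo] --> l_ k) -> l_ k @[k --> \oo] --> l ->
  a k @[k --> \oo] --> (0 : R) -> b n @[n --> \oo] --> (0 : R) ->
  (forall k n, `|u n - u_ k n| <= a k + b n) ->
  u n @[n --> \oo] --> l.
Proof.
move=> ul ll a0 b0 uab; apply/cvgrPdist_le => e e0.
have e40 : 0 < e / 4 by rewrite divr_gt0.
have [k [ak lk]] : exists k, `|a k| <= e / 4 /\ `|l - l_ k| <= e / 4.
  near \oo => k; exists k; split; near: k.
    by move/cvgr0_norm_le: a0; exact.
  by move/cvgrPdist_le: ll; exact.
near=> n.
have bn : `|b n| <= e / 4 by near: n; move/cvgr0_norm_le: b0; exact.
have ukn : `|l_ k - u_ k n| <= e / 4.
  by near: n; move/cvgrPdist_le: (ul k); exact.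
have := uab k n; move: ak lk bn ukn; rewrite !ler_norml.
move=> /andP[? ?] /andP[? ?] /andP[? ?] /andP[? ?] /andP[? ?].
by apply/andP; split; lra.
Unshelve. all: by end_near.
Qed.

End limits.

Lemma ler_sqrtD {R : rcfType} (x y : R) : 0 <= x -> 0 <= y ->
  Num.sqrt (x + y) <= Num.sqrt x + Num.sqrt y.
Proof.
move=> x0 y0; rewrite -(@ler_pXn2r _ 2) ?nnegrE ?addr_ge0 ?sqrtr_ge0//.
rewrite sqr_sqrtr ?addr_ge0// sqrrD !sqr_sqrtr// addrAC lerDl.
by rewrite mulrn_wge0// mulr_ge0 ?sqrtr_ge0.
Qed.

Section bernstein.
Context {R : realFieldType}.
Implicit Types (F G : nat -> R) (p c : R) (m y : nat).

(* The Bernstein operator as the expectation of [F] at time [m] of the random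
   walk on [nat] started at [y] that moves up with probability [p]; a degree [m]
   polynomial in [p]. *)
Fixpoint bernstein m F p y : R :=
  if m is m'.+1 then p * bernstein m' F p y.+1 + (1 - p) * bernstein m' F p y
  else F y.

Lemma le_bernstein m F G p y : 0 <= p <= 1 -> (forall j, F j <= G j) ->
  bernstein m F p y <= bernstein m G p y.
Proof.
move=> /andP[p0 p1] FG; elim: m y => [|m IH] y //=.
by apply: lerD; apply: ler_wpM2l => //; rewrite subr_ge0.
Qed.

Lemma ler_norm_bernstein m F p y : 0 <= p <= 1 ->
  `|bernstein m F p y| <= bernstein m (fun j => `|F j|) p y.
Proof.
move=> /andP[p0 p1]; elim: m y => [|m IH] y //=.
apply: le_trans (ler_normD _ _) _; rewrite !normrM.
have q0 : 0 <= 1 - p by rewrite subr_ge0.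
by rewrite (ger0_norm p0) (ger0_norm q0); apply: lerD; apply: ler_wpM2l.
Qed.

Lemma bernstein_cst m c p y : bernstein m (fun=> c) p y = c.
Proof. by elim: m y => [|m IH] y //=; rewrite !IH; ring. Qed.

Lemma bernsteinD m F G p y :
  bernstein m (fun j => F j + G j) p y = bernstein m F p y + bernstein m G p y.
Proof. by elim: m y => [|m IH] y //=; rewrite !IH; ring. Qed.

Lemma bernsteinZ m c F p y :
  bernstein m (fun j => c * F j) p y = c * bernstein m F p y.
Proof. by elim: m y => [|m IH] y //=; rewrite !IH; ring. Qed.

Lemma bernsteinB m F G p y :
  bernstein m (fun j => F j - G j) p y = bernstein m F p y - bernstein m G p y.
Proof. by elim: m y => [|m IH] y //=; rewrite !IH; ring. Qed.

Lemma ler_norm_bernsteinB m F p y c : 0 <= p <= 1 ->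
  `|c - bernstein m F p y| <= bernstein m (fun j => `|c - F j|) p y.
Proof.
move=> p01; rewrite -{1}(bernstein_cst m c p y) -bernsteinB.
exact: ler_norm_bernstein.
Qed.

Lemma bernstein_sqr m c p y : bernstein m (fun j => (j%:R - c) ^+ 2) p y =
  (y%:R + m%:R * p - c) ^+ 2 + m%:R * (p * (1 - p)).
Proof.
elim: m y => [|m IH] y /=; first by ring.
by rewrite !IH -!natr1; ring.
Qed.

Lemma bernstein_variance m p : (0 < m)%N -> 0 <= p <= 1 ->
  bernstein m (fun j => (j%:R / m%:R - p) ^+ 2) p 0 <= m%:R^-1.
Proof.
move=> m0 /andP[p0 p1]; have mR : (0 : R) < m%:R by rewrite ltr0n.
have -> : (fun j : nat => (j%:R / m%:R - p) ^+ 2) =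
          (fun j : nat => m%:R ^- 2 * (j%:R - m%:R * p) ^+ 2).
  by apply/funext => j; field; rewrite gt_eqF.
rewrite bernsteinZ bernstein_sqr add0r subrr expr0n/= add0r.
have -> : m%:R ^- 2 * (m%:R * (p * (1 - p))) = m%:R^-1 * (p * (1 - p)).
  by field; rewrite gt_eqF.
by apply: ler_piMr; [rewrite invr_ge0 ltW|nra].
Qed.

(* Cauchy-Schwarz, by AM-GM: [|x| <= (k x^2 + 1 / k) / 2]. *)
Lemma bernstein_mean_dist k p : (0 < k)%N -> 0 <= p <= 1 ->
  bernstein (k ^ 2) (fun j => `|j%:R / (k ^ 2)%:R - p|) p 0 <= k%:R^-1.
Proof.
move=> k0 p01; have kR : (0 : R) < k%:R by rewrite ltr0n.
pose G (j : nat) : R := k%:R / 2 * (j%:R / (k ^ 2)%:R - p) ^+ 2 + k%:R^-1 / 2.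
apply: (@le_trans _ _ (bernstein (k ^ 2) G p 0)).
  apply: le_bernstein => // j; rewrite /G -(real_normK (num_real (_ - p))).
  move: `|_ - p| => x; rewrite -subr_ge0.
  have -> : k%:R / 2 * x ^+ 2 + k%:R^-1 / 2 - x = (k%:R * x - 1) ^+ 2 / (2 * k%:R).
    by field; rewrite gt_eqF.
  by rewrite divr_ge0 ?sqr_ge0// mulr_ge0// ltW.
rewrite bernsteinD bernstein_cst bernsteinZ.
rewrite [leRHS](_ : _ = k%:R / 2 * (k ^ 2)%:R^-1 + k%:R^-1 / 2); last first.
  by rewrite natrX; field; rewrite gt_eqF.
rewrite lerD2r ler_wpM2l ?divr_ge0 ?(ltW kR)//.
by apply: bernstein_variance; rewrite // expn_gt0 k0.
Qed.

End bernstein.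

Section trigonometric_inequalities.
Context {R : realType}.
Implicit Types x y : R.

Lemma ler_norm_cosB x y : `|cos x - cos y| <= `|x - y|.
Proof.
wlog yx : x y / y <= x.
  move=> le_case; have [/le_case//|/ltW/le_case] := leP y x.
  by rewrite distrC [in leRHS]distrC.
have [c _ ->] : exists2 c, c \in `[y, x]%R & cos x - cos y = - sin c * (x - y).
  apply: (@MVT_segment R cos (fun x => - sin x)) => //.
  exact: continuous_subspaceT (@continuous_cos R).
by rewrite normrM normrN ler_piMl// sin_max.
Qed.

Lemma ler_norm_sin_sub x : `|sin x - x| <= x ^+ 2.
Proof.
wlog x0 : x / 0 <= x.
  move=> ge0_case; have [/ge0_case//|/ltW x0] := leP 0 x.
  by have := ge0_case (- x); rewrite oppr_ge0 sinN -opprD normrN sqrrN; exact.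
have [c cx] : exists2 c, c \in `[0, x]%R & sin x - sin 0 = cos c * (x - 0).
  apply: (@MVT_segment R sin cos) => //.
  exact: continuous_subspaceT (@continuous_sin R).
rewrite sin0 !subr0 => ->.
rewrite -[X in _ - X]mul1r -mulrBl normrM (ger0_norm x0) expr2 ler_wpM2r//.
move: cx; rewrite in_itv/= => /andP[c0 cx].
by rewrite -(@cos0 R) (le_trans (ler_norm_cosB _ _))// subr0 ger0_norm.
Qed.

Lemma continuous_affine (a b : R) : continuous (fun x => a * x + b).
Proof.
move=> x; apply: cvgD; last exact: cvg_cst.
by apply: cvgM; [exact: cvg_cst|exact: cvg_id].
Qed.

Lemma continuous_cos_affine (a b : R) : continuous (fun x => cos (a * x + b)).
Proof.
move=> x; apply: (@continuous_comp _ _ _ (fun x => a * x + b) cos).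
  exact: continuous_affine.
exact: continuous_cos.
Qed.

Lemma is_derive_affine (a b x : R) : is_derive x 1 (fun x => a * x + b) a.
Proof.
rewrite -[X in is_derive _ _ _ X]addr0 -[X in is_derive _ _ _ (X + _)]mulr1.
exact: is_deriveD.
Qed.

(* The nodes [l (2 j / m - 1)] are the values at [2 j / m - 1] of the inverse
   [l s] of [s = x / l], which [sin (x / l)] approximates for [l] large. *)
Definition sin_bernstein (g : R -> R) (l : nat) (s : R) : R :=
  bernstein ((l ^ 2) ^ 2)
    (fun j => g (l%:R * (2 * (j%:R / ((l ^ 2) ^ 2)%:R) - 1))) ((1 + s) / 2) 0.

Lemma sin_bernstein_dist (g : R -> R) (C x : R) (l : nat) : (0 < l)%N ->
  0 <= C -> (forall y z, `|g y - g z| <= C * `|y - z|) ->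
  `|g x - sin_bernstein g l (sin (x / l%:R))| <= C * (x ^+ 2 + 2) * l%:R^-1.
Proof.
move=> l0 C0 g_lip; have lR : (0 : R) < l%:R by rewrite ltr0n.
rewrite /sin_bernstein; set m := ((l ^ 2) ^ 2)%N; set p := (1 + _) / 2.
have p01 : 0 <= p <= 1.
  have := sin_geN1 (x / l%:R); have := sin_le1 (x / l%:R).
  by move=> ? ?; apply/andP; rewrite /p; split; lra.
apply: le_trans (ler_norm_bernsteinB _ _ _ _ p01) _.
apply: (@le_trans _ _ (bernstein m (fun j => C * x ^+ 2 / l%:R +
    C * (2 * l%:R) * `|j%:R / m%:R - p|) p 0)).
  apply: le_bernstein => // j; apply: le_trans (g_lip _ _) _.
  set q := j%:R / m%:R.
  rewrite [leRHS](_ : _ = C * (x ^+ 2 / l%:R + 2 * l%:R * `|q - p|)); last by ring.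
  rewrite ler_wpM2l//.
  have -> : x - l%:R * (2 * q - 1) =
      - (l%:R * (sin (x / l%:R) - x / l%:R)) - 2 * l%:R * (q - p).
    by rewrite /p; field; rewrite gt_eqF.
  apply: le_trans (ler_normB _ _) _; rewrite normrN !normrM.
  rewrite (ger0_norm (ltW lR)) (ger0_norm (ler0n _ 2)) lerD2r.
  rewrite (_ : x ^+ 2 / l%:R = l%:R * (x / l%:R) ^+ 2).
    by rewrite ler_wpM2l ?(ltW lR)// ler_norm_sin_sub.
  by field; rewrite gt_eqF.
rewrite bernsteinD bernstein_cst bernsteinZ.
rewrite [leRHS](_ : _ = C * x ^+ 2 / l%:R + C * (2 * l%:R) * (l ^ 2)%:R^-1).
  rewrite lerD2l ler_wpM2l ?mulr_ge0// ?(ltW lR)//.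
  by apply: bernstein_mean_dist; rewrite // expn_gt0 l0.
by rewrite natrX; field; rewrite gt_eqF.
Qed.

End trigonometric_inequalities.

Section bounded_measurable_functions.
Context d (T : measurableType d) (R : realType).
Implicit Types f g : T -> R.

Definition bounded_measurable f :=
  measurable_fun setT f /\ exists M, forall x, `|f x| <= M.

Lemma bounded_measurable_cst c : bounded_measurable (cst c).
Proof. by split => //; exists `|c|. Qed.

Lemma bounded_measurableD f g : bounded_measurable f -> bounded_measurable g ->
  bounded_measurable (f + g).
Proof.
move=> [mf [M fM]] [mg [N gN]]; split; first exact: measurable_funD.
by exists (M + N) => x; apply: le_trans (ler_normD _ _) (lerD _ _).
Qed.

Lemma bounded_measurableM f g : bounded_measurable f -> bounded_measurable g ->
  bounded_measurable (f * g).
Proof.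
move=> [mf [M fM]] [mg [N gN]]; split; first exact: measurable_funM.
by exists (M * N) => x; rewrite normrM ler_pM.
Qed.

Lemma bounded_measurableZ c f : bounded_measurable f ->
  bounded_measurable (c *: f).
Proof. exact: bounded_measurableM (bounded_measurable_cst c). Qed.

Lemma bounded_measurableB f g : bounded_measurable f -> bounded_measurable g ->
  bounded_measurable (f - g).
Proof.
move=> bf bg; rewrite -scaleN1r.
by apply: bounded_measurableD => //; exact: bounded_measurableZ.
Qed.

Lemma ler_norm_indic (A : set T) t : `|\1_A t| <= 1 :> R.
Proof. by rewrite indicE; case: (_ \in _); rewrite ?normr1 ?normr0. Qed.

Lemma bounded_measurable_indic (A : set T) : measurable A ->
  bounded_measurable \1_A.
Proof.
move=> mA; split; first exact: measurable_indic.
by exists 1 => t; exact: ler_norm_indic.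
Qed.

Lemma bounded_measurable_cos f b : measurable_fun setT f ->
  bounded_measurable (fun x => cos (f x + b)).
Proof.
move=> mf; split; last by exists 1 => x; exact: cos_max.
under eq_fun do rewrite -[f _]mul1r.
apply: (@measurableT_comp _ _ _ _ _ _ (fun z : R => cos (1 * z + b))) => //.
by apply: continuous_measurable_fun; exact: continuous_cos_affine.
Qed.

End bounded_measurable_functions.

Lemma probability_lty d (T : measurableType d) (R : realType)
  (P : probability T R) : (P setT < +oo)%E.
Proof. by rewrite [ltLHS]probability_setT ltry. Qed.

Section finite_measure_integrals.
Context d (T : measurableType d) (R : realType).
Variable mu : {measure set T -> \bar R}.
Hypothesis mu_lty : (mu setT < +oo)%E.
Implicit Types f g : T -> R.

Lemma bounded_measurable_integrable f : bounded_measurable f ->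
  mu.-integrable setT (EFin \o f).
Proof.
move=> [mf [M fM]]; apply: measurable_bounded_integrable => //.
exists M; split; first exact: num_real.
by move=> x Mx t _; apply: le_trans (fM t) (ltW Mx).
Qed.

Lemma le_dist_Rintegral f g (c : R) :
  bounded_measurable f -> bounded_measurable g ->
  (\int[mu]_x `|f x - g x|%:E <= c%:E)%E ->
  `|\int[mu]_x f x - \int[mu]_x g x| <= c.
Proof.
move=> bf bg fgc; have bfg := bounded_measurableB bf bg.
rewrite -RintegralB//; [|exact: bounded_measurable_integrable..].
apply: le_trans (le_normr_Rintegral _ _) _ => //.
  exact: bounded_measurable_integrable bfg.
rewrite -lee_fin /Rintegral fineK//; apply: integrable_fin_num => //.
exact: integrable_abse (bounded_measurable_integrable bfg).
Qed.

Lemma bounded_cvg_Rintegral (f_ : nat -> T -> R) f (M : R) :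
  (forall n, measurable_fun setT (f_ n)) -> measurable_fun setT f ->
  (forall n x, `|f_ n x| <= M) -> {ae mu, forall x, f_ n x @[n --> \oo] --> f x} ->
  \int[mu]_x f_ n x @[n --> \oo] --> \int[mu]_x f x.
Proof.
move=> mf_ mf fM f_f.
have [] := @dominated_convergence _ _ _ mu setT measurableT
  (fun n => EFin \o f_ n) (EFin \o f) (cst M%:E).
- by move=> n; apply/measurable_EFinP.
- exact/measurable_EFinP.
- by apply: filterS f_f => x h _; apply: cvg_EFin; [exact: nearW|exact: h].
- exact: bounded_measurable_integrable (bounded_measurable_cst _ M).
- by apply: aeW => x n _ /=; rewrite lee_fin.
move=> fi _ h; apply: fine_cvg; rewrite fineK//.
exact: integrable_fin_num.
Qed.

End finite_measure_integrals.

Section probability_moment_bounds.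
Context d (T : measurableType d) (R : realType) (P : probability T R).
Implicit Types f g : T -> R.

Lemma integral_norm_le_affine f g (a c V : R) :
  measurable_fun setT f -> measurable_fun setT g -> (forall x, 0 <= g x) ->
  0 <= a -> 0 <= c -> (forall x, `|f x| <= a * g x + c) ->
  (\int[P]_x (g x)%:E <= V%:E)%E ->
  (\int[P]_x `|f x|%:E <= (a * V + c)%:E)%E.
Proof.
move=> mf mg g0 a0 c0 fg gV.
have mgE : measurable_fun setT (EFin \o g) by exact/measurable_EFinP.
apply: (@le_trans _ _ (\int[P]_x (a%:E * (g x)%:E + c%:E))%E).
  apply: ge0_le_integral => //.
  - by apply/measurable_EFinP; exact: measurableT_comp.
  - by apply: emeasurable_funD => //; exact: emeasurable_funM.
  - by move=> x _; rewrite -EFinM -EFinD lee_fin.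
rewrite ge0_integralD//.
- rewrite integral_cst// [X in (_ + _ * X)%E]probability_setT mule1.
  rewrite ge0_integralZl_EFin//; last by move=> x _; rewrite lee_fin.
  by rewrite EFinD leeD2r// EFinM lee_wpmul2l// lee_fin.
- by move=> x _; rewrite -EFinM lee_fin mulr_ge0.
- exact: emeasurable_funM.
Qed.

Lemma integral_norm_le_sqrt f (V : R) : measurable_fun setT f ->
  (\int[P]_x (f x ^+ 2)%:E <= V%:E)%E ->
  (\int[P]_x `|f x|%:E <= (Num.sqrt V)%:E)%E.
Proof.
move=> mf fV; have int0 : (0 <= \int[P]_x (f x ^+ 2)%:E)%E.
  by apply: integral_ge0 => x _; rewrite lee_fin sqr_ge0.
have V0 : 0 <= V by rewrite -lee_fin (le_trans int0).
have N2 : ('N[P]_2%:E[EFin \o f] <= (Num.sqrt V)%:E)%E.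
  rewrite unlock -powR12_sqrt// -poweR_EFin; apply: gt0_ler_poweR => //.
  - by rewrite in_itv/= leey integral_ge0.
  - by rewrite in_itv/= leey lee_fin V0.
  apply: le_trans fV; rewrite le_eqVlt; apply/orP; left; apply/eqP.
  by apply: eq_integral => x _ /=; rewrite powR_mulrn ?real_normK ?num_real.
have half : 2^-1 + 2^-1 = 1 :> R by rewrite [RHS]splitr !div1r.
have := @hoelder _ _ _ P f (cst 1) 2 2 mf (measurable_cst _).
move=> /(_ (ltr0n _ 2) (ltr0n _ 2) half).
rewrite Lnorm1 Lnorm_cst1 [X in (_ * X `^ _)%E]probability_setT.
rewrite poweR1r mule1; under eq_integral do rewrite /= mulr1.
by move=> /le_trans; apply.
Qed.

End probability_moment_bounds.

(** * Gaussian laws on the line *)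

Section continuous_test_functions.
Context d1 d2 (T1 : measurableType d1) (T2 : measurableType d2) (R : realType).
Variables (mu1 : {measure set T1 -> \bar R}) (mu2 : {measure set T2 -> \bar R}).
Variables (X1 : T1 -> R) (X2 : T2 -> R).
Hypothesis ge0_integral_comp : forall G : R -> R, continuous G ->
  (forall x, 0 <= G x) ->
  (\int[mu1]_x (G (X1 x))%:E = \int[mu2]_x (G (X2 x))%:E)%E.

Lemma eq_integral_comp (G : R -> R) : continuous G ->
  (\int[mu1]_x (G (X1 x))%:E = \int[mu2]_x (G (X2 x))%:E)%E.
Proof.
move=> cG; rewrite integralE [RHS]integralE; congr (_ - _)%E.
- under eq_integral do rewrite funeposE -EFin_max.
  under [RHS]eq_integral do rewrite funeposE -EFin_max.
  apply: (ge0_integral_comp (G := G \max cst 0)).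
    by move=> x; apply: continuous_max; [exact: cG|exact: cvg_cst].
  by move=> x; rewrite le_max lexx orbT.
- under eq_integral do rewrite funenegE -EFin_max.
  under [RHS]eq_integral do rewrite funenegE -EFin_max.
  apply: (ge0_integral_comp (G := (\- G) \max cst 0)).
    by move=> x; apply: continuous_max; [by apply: cvgN; exact: cG|exact: cvg_cst].
  by move=> x; rewrite le_max lexx orbT.
Qed.

End continuous_test_functions.

Section normal_integrals.
Context {R : realType}.
Local Notation leb := (@lebesgue_measure R).
Implicit Types (m s a b : R) (G : R -> R).

Lemma integral_normal_prob m s (f : R -> \bar R) :
  (forall x, 0 <= f x)%E -> measurable_fun setT f ->
  (\int[normal_prob m s]_x f x = \int[leb]_x (f x * (normal_pdf m s x)%:E))%E.
Proof.
move=> f0 mf.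
have dom := normal_prob_dominates m s.
have mpdf : measurable_fun setT (EFin \o normal_pdf m s).
  by apply/measurable_EFinP; exact: measurable_normal_pdf.
rewrite -(Radon_Nikodym_SigmaFinite.change_of_variables dom)//.
have fi := Radon_Nikodym_SigmaFinite.f_integrable dom.
apply: ae_eq_integral => //.
- by apply: emeasurable_funM => //; exact: (measurable_int leb).
- exact: emeasurable_funM.
have : ae_eq leb setT (Radon_Nikodym_SigmaFinite.f (normal_prob m s) leb)
    (EFin \o normal_pdf m s).
  apply: integral_ae_eq => // E _ mE.
  by rewrite -Radon_Nikodym_SigmaFinite.f_integral.
by apply: filterS => x /= /(_ I) -> _.
Qed.

Lemma integral_normal_prob_continuous m s G : continuous G ->
  (forall x, 0 <= G x) ->
  (\int[normal_prob m s]_x (G x)%:E =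
   \int[leb]_x (G x * normal_pdf m s x)%:E)%E.
Proof.
move=> cG G0; rewrite (integral_normal_prob m s (f := EFin \o G)).
- by apply: eq_integral => x _; rewrite EFinM.
- by move=> x; rewrite lee_fin.
- by apply/measurable_EFinP; exact: continuous_measurable_fun.
Qed.

Lemma ge0_integral_affine a b G : 0 < a -> continuous G ->
  (forall x, 0 <= G x) ->
  (\int[leb]_x (G x)%:E = \int[leb]_x (G (a * x + b) * a)%:E)%E.
Proof.
move=> a0 cG G0; pose F (x : R) : R := a * x + b.
have F' : F^`()%classic = cst a.
  by apply/funext => x; rewrite derive1E; have [] := is_derive_affine a b x.
rewrite (@increasing_ge0_integration_by_substitutionT _ F G) ?F'//.
- by move=> x y xy; rewrite /F ltrD2r ltr_pM2l.
- by move=> x; exact: cvg_cst.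
- exact: is_cvg_cst.
- exact: is_cvg_cst.
- apply: (@cvg_comp _ _ _ (fun z => a * z) (fun z => z + b)).
    exact/gt0_cvgMrNy.
  exact: cvg_addrr_Ny.
- apply: (@cvg_comp _ _ _ (fun z => a * z) (fun z => z + b)).
    exact/gt0_cvgMry.
  exact: cvg_addrr.
Qed.

Lemma ge0_integral_oppr G : continuous G -> (forall x, 0 <= G x) ->
  (\int[leb]_x (G x)%:E = \int[leb]_x (G (- x))%:E)%E.
Proof.
have half (H : R -> R) : continuous H -> (forall x, 0 <= H x) ->
    (\int[leb]_(x in `]-oo, 0%R]) (H x)%:E =
     \int[leb]_(x in `[0%R, +oo[) (H (- x))%:E)%E.
  move=> cH H0; rewrite -{1}oppr0 ge0_integration_by_substitutionNy//.
  exact: continuous_subspaceT.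
have split0 (H : R -> R) : continuous H -> (forall x, 0 <= H x) ->
    (\int[leb]_x (H x)%:E = \int[leb]_(x in `]-oo, 0%R]) (H x)%:E +
                            \int[leb]_(x in `[0%R, +oo[) (H x)%:E)%E.
  move=> cH H0; have mH : measurable_fun setT H by exact: continuous_measurable_fun.
  rewrite -[in LHS](setUv `]-oo, 0%R]%classic) ge0_integral_setU//=.
  - rewrite setCitvl integral_itv_obnd_cbnd//.
    exact/measurable_EFinP/measurable_funTS.
  - exact: measurableC.
  - by rewrite setUv; exact/measurable_EFinP.
  - by move=> x _; rewrite lee_fin.
  - exact/disj_setPCl.
move=> cG G0; have cGN : continuous (G \o -%R).
  by move=> x; apply: continuous_comp; [exact: oppr_continuous|exact: cG].
have GN0 x : 0 <= (G \o -%R) x by exact: G0.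
rewrite (split0 G)// (split0 (G \o -%R))// (half G)// (half (G \o -%R))// addeC.
by congr (_ + _)%E; apply: eq_integral => x _; rewrite /= ?opprK.
Qed.

Lemma normal_pdf_affine m s z : s != 0 ->
  normal_pdf m s (`|s| * z + m) * `|s| = normal_pdf 0 1 z.
Proof.
move=> s0; have sp : 0 < `|s| by rewrite normr_gt0.
rewrite !normal_pdfE ?oner_neq0// /normal_peak /normal_fun addrK subr0 exprMn.
rewrite real_normK ?num_real// expr1n mul1r.
rewrite -(mulr_natr (_ * pi)) -(mulr_natr pi) -(mulr_natr (s ^+ 2)).
rewrite -mulrA (sqrtrM (pi * 2) (sqr_ge0 s)) sqrtr_sqr invfM.
have -> : - (s ^+ 2 * z ^+ 2) / (s ^+ 2 * 2) = - z ^+ 2 / 2 by field.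
by rewrite mulrC !mulrA divff ?gt_eqF// mul1r.
Qed.

Lemma integral_normal_prob_standardize m s G : s != 0 ->
  continuous G -> (forall x, 0 <= G x) ->
  (\int[normal_prob m s]_x (G x)%:E =
   \int[normal_prob 0 1]_z (G (`|s| * z + m))%:E)%E.
Proof.
move=> s0 cG G0; rewrite integral_normal_prob_continuous//.
rewrite (ge0_integral_affine m (a := `|s|)) ?normr_gt0//; last 2 first.
- by move=> x; apply: cvgM; [exact: cG|exact: continuous_normal_pdf].
- by move=> x; rewrite mulr_ge0// normal_pdf_ge0.
rewrite (integral_normal_prob_continuous _ _ (G := fun z => G (`|s| * z + m)))//.
  by apply: eq_integral => z _; rewrite -mulrA normal_pdf_affine.
by move=> x; apply: continuous_comp; [exact: continuous_affine|exact: cG].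
Qed.

End normal_integrals.

Section standard_normal.
Context {R : realType}.
Local Notation leb := (@lebesgue_measure R).
Local Notation gam := (normal_prob (0 : R) 1).

Lemma sqr_normal_pdf_le (x : R) : x ^+ 2 * normal_pdf 0 1 x <=
  8 / 3 * normal_peak 1 / normal_peak 2 * normal_pdf 0 2 x.
Proof.
rewrite !normal_pdfE ?oner_neq0//.
have p1 : 0 < normal_peak (1 : R) by rewrite normal_peak_gt0 ?oner_neq0.
have p2 : 0 < normal_peak (2 : R) by rewrite normal_peak_gt0.
rewrite mulrCA [leRHS](_ : _ = normal_peak 1 * (8 / 3 * normal_fun 0 2 x)).
  2: by field; rewrite gt_eqF.
rewrite ler_wpM2l ?(ltW p1)// /normal_fun subr0 expr1n.
have -> : - x ^+ 2 / (1 *+ 2) = - x ^+ 2 / (2 ^+ 2 *+ 2) - x ^+ 2 * (3 / 8).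
  by rewrite !mulr2n; field.
rewrite expRD mulrCA (mulrC (8 / 3)) ler_wpM2l ?expR_ge0//.
rewrite expRN ler_pdivrMr ?expR_gt0//.
by have := @expR_ge1Dx R (x ^+ 2 * (3 / 8)); lra.
Qed.

Lemma standard_normal_sqr_lty : (\int[gam]_z (z ^+ 2)%:E < +oo)%E.
Proof.
rewrite integral_normal_prob_continuous; last 2 first.
- exact: sqr_continuous.
- by move=> x; exact: sqr_ge0.
have mpdf (s : R) := measurable_normal_pdf 0 s.
set C : R := 8 / 3 * normal_peak 1 / normal_peak 2.
have C0 : 0 <= C.
  by rewrite divr_ge0 ?normal_peak_ge0// mulr_ge0 ?normal_peak_ge0// divr_ge0.
apply: (@le_lt_trans _ _ (\int[leb]_z (C%:E * (normal_pdf 0 2 z)%:E))%E).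
  apply: ge0_le_integral => //.
  - by move=> x _; rewrite lee_fin mulr_ge0 ?sqr_ge0 ?normal_pdf_ge0.
  - by apply/measurable_EFinP; apply: measurable_funM;
      [exact: measurable_funX|exact: mpdf].
  - by apply: emeasurable_funM => //; apply/measurable_EFinP; exact: mpdf.
  - by move=> x _; rewrite -EFinM lee_fin sqr_normal_pdf_le.
rewrite ge0_integralZl_EFin//.
- by rewrite integral_normal_pdf mule1 ltry.
- by move=> x _; rewrite lee_fin normal_pdf_ge0.
- by apply/measurable_EFinP; exact: mpdf.
Qed.

Definition standard_normal_sqr : R := fine (\int[gam]_z (z ^+ 2)%:E)%E.

Lemma standard_normal_sqrE :
  (\int[gam]_z (z ^+ 2)%:E = standard_normal_sqr%:E)%E.
Proof.
rewrite fineK// ge0_fin_numE ?standard_normal_sqr_lty//.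
by apply: integral_ge0 => x _; rewrite lee_fin sqr_ge0.
Qed.

Lemma standard_normal_integrable : gam.-integrable setT EFin.
Proof.
apply/integrableP; split; first exact/measurable_EFinP.
apply: le_lt_trans (ltry (Num.sqrt standard_normal_sqr)).
by apply: (@integral_norm_le_sqrt _ _ _ gam id) => //; rewrite standard_normal_sqrE.
Qed.

Lemma standard_normal_mean : (\int[gam]_z z%:E = 0)%E.
Proof.
have sym : (\int[gam]_z z%:E = \int[gam]_z (- z)%:E)%E.
  apply: (@eq_integral_comp _ _ _ _ _ gam gam id -%R _ id) => [G cG G0|x];
    last exact: cvg_id.
  have cGN : continuous (fun x => G (- x)).
    move=> x; apply: (@continuous_comp _ _ _ -%R G); last exact: cG.
    exact: oppr_continuous.
  rewrite integral_normal_prob_continuous// integral_normal_prob_continuous//.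
  rewrite ge0_integral_oppr.
  - apply: eq_integral => x _; rewrite !normal_pdfE ?oner_neq0//.
    by rewrite /normal_fun !subr0 sqrrN.
  - by move=> x; apply: cvgM; [exact: cG|exact/continuous_normal_pdf/oner_neq0].
  - by move=> x; rewrite mulr_ge0// normal_pdf_ge0.
have := integrable_fin_num measurableT standard_normal_integrable.
move: sym; under [X in _ = X]eq_integral do rewrite EFinN.
rewrite integralN/=; last first.
  have := integrable_add_def measurableT standard_normal_integrable.
  exact.
case: (\int[gam]_z _)%E => // r [] /eqP; rewrite -subr_eq0 opprK -mulr2n.
by rewrite mulrn_eq0/= => /eqP ->.
Qed.

Lemma standard_normal_sqr_gt0 : 0 < standard_normal_sqr.
Proof.
rewrite lt_neqAle; apply/andP; split; last first.
  by apply: fine_ge0; apply: integral_ge0 => x _; rewrite lee_fin sqr_ge0.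
apply/eqP => sqr0.
have : ae_eq gam setT (fun z : R => (z ^+ 2)%:E) (cst 0%E).
  apply/(ae_eq_integral_abs gam measurableT); last first.
    transitivity (\int[gam]_z (z ^+ 2)%:E)%E; last by rewrite standard_normal_sqrE -sqr0.
    by apply: eq_integral => x _; rewrite gee0_abs// lee_fin sqr_ge0.
  by apply/measurable_EFinP; exact: measurable_funX.
move=> [A [mA A0 sA]]; have : (gam setT <= gam (A `|` [set (0 : R)%R]))%E.
  apply: le_measure; rewrite ?inE//; first exact: measurableU.
  move=> x _; have [->|x0] := eqVneq x 0; first by right.
  by left; apply: sA => /= /(_ I) [] /eqP; rewrite sqrf_eq0 (negbTE x0).
apply/negP; rewrite -ltNge [ltRHS]probability_setT.
apply: (@le_lt_trans _ _ (gam A + gam [set (0 : R)%R])%E); first exact: measureU2.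
rewrite A0 add0e (_ : gam [set 0%R] = 0%E) ?lte01//.
by rewrite /normal_prob integral_set1.
Qed.

(* The law [N(0, s^2)] enters the proof only through this function of [s], of
   which continuity is all that is needed, not the closed form. *)
Definition gaussian_cos (b s : R) : R := \int[gam]_z cos (s * z + b).

Lemma cvg_gaussian_cos (b : R) (s_ : nat -> R) (s : R) :
  s_ n @[n --> \oo] --> s ->
  gaussian_cos b (s_ n) @[n --> \oo] --> gaussian_cos b s.
Proof.
move=> s_s; have mcos (t : R) : measurable_fun setT (fun z : R => cos (t * z + b)).
  by apply: continuous_measurable_fun; exact: continuous_cos_affine.
apply: (bounded_cvg_Rintegral (probability_lty gam) (M := 1)).
- by move=> n; exact: mcos.
- exact: mcos.
- by move=> n x; exact: cos_max.
- apply: aeW => z; apply: (@cvg_comp _ _ _ (fun n => s_ n * z + b) cos _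
    (nbhs (s * z + b))); last exact: continuous_cos.
  by apply: cvgD; [exact: cvgMr_tmp|exact: cvg_cst].
Qed.

End standard_normal.

Section gaussian_variables.
Context {R : realType} d (T : measurableType d) (P : probability T R).
Local Notation gam := (normal_prob (0 : R) 1).
Variables (X : T -> R) (m s : R).
Hypothesis mX : measurable_fun setT X.
Hypothesis X_law : forall A : set (measurableTypeR R), measurable A ->
  pushforward P X A = gaussian_law m s A.

Lemma integral_gaussian_law (G : R -> R) : continuous G ->
  (\int[P]_x (G (X x))%:E = \int[gam]_z (G (`|s| * z + m))%:E)%E.
Proof.
apply: eq_integral_comp => {}G cG G0.
have mG : measurable_fun setT (EFin \o G).
  by apply/measurable_EFinP; exact: continuous_measurable_fun.
pose Y : {mfun T >-> measurableTypeR R} :=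
  @mfun_Sub _ _ T (measurableTypeR R) X (mem_set mX).
transitivity (\int[distribution P Y]_y (G y)%:E)%E.
  by rewrite ge0_integral_distribution// => y; rewrite lee_fin.
move: X_law; rewrite /gaussian_law; have [->|s0] := eqVneq s 0 => XP.
  rewrite (@eq_measure_integral _ (measurableTypeR R) _ _
    (@dirac _ (measurableTypeR R) m R)); last by move=> A mA _; exact: XP.
  rewrite integral_dirac//= diracT mul1e.
  under eq_integral do rewrite normr0 mul0r add0r.
  by rewrite integral_cst//= [X in (_ * X)%E]probability_setT mule1.
rewrite -integral_normal_prob_standardize//.
by apply: eq_measure_integral => A mA _; exact: XP.
Qed.

Lemma gaussian_mean : (\int[P]_x (X x)%:E = m%:E)%E.
Proof.
rewrite (integral_gaussian_law (G := id)); last by move=> x; exact: cvg_id.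
have iZ : gam.-integrable setT (fun z => `|s|%:E * z%:E)%E.
  exact: integrableZl standard_normal_integrable.
have im : gam.-integrable setT (cst m%:E).
  exact: finite_measure_integrable_cst.
transitivity (\int[gam]_z (`|s|%:E * z%:E + m%:E))%E.
  by apply: eq_integral => z _; rewrite EFinD EFinM.
rewrite integralD//= integralZl//; last exact: standard_normal_integrable.
rewrite standard_normal_mean mule0 add0e integral_cst//.
by rewrite [X in (_ * X)%E]probability_setT mule1.
Qed.

Lemma gaussian_cosE b : \int[P]_x cos (X x + b) =
  gaussian_cos (m + b) `|s|.
Proof.
rewrite /gaussian_cos /Rintegral; congr fine.
rewrite (integral_gaussian_law (G := fun x => cos (x + b))).
  by apply: eq_integral => z _; rewrite addrA.
by move=> x; have := @continuous_cos_affine R 1 b x; under eq_fun do rewrite mul1r.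
Qed.

Lemma centered_gaussian_sqr : m = 0 ->
  (\int[P]_x (X x ^+ 2)%:E = (s ^+ 2 * standard_normal_sqr)%:E)%E.
Proof.
move=> m0; rewrite (integral_gaussian_law (G := fun x => x ^+ 2)); last first.
  exact: sqr_continuous.
rewrite EFinM -standard_normal_sqrE -ge0_integralZl_EFin ?sqr_ge0//.
- apply: eq_integral => z _.
  by rewrite m0 addr0 exprMn real_normK ?num_real// EFinM.
- by move=> x _; rewrite lee_fin sqr_ge0.
- by apply/measurable_EFinP; exact: measurable_funX.
Qed.

Lemma centered_gaussian_cos v b : (\int[P]_x (X x)%:E = 0)%E ->
  (\int[P]_x (X x ^+ 2)%:E = v%:E)%E ->
  \int[P]_x cos (X x + b) =
    gaussian_cos b (Num.sqrt (v / standard_normal_sqr)).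
Proof.
rewrite gaussian_mean => -[m0]; rewrite centered_gaussian_sqr// => -[<-].
rewrite gaussian_cosE m0 add0r mulfK ?sqrtr_sqr//.
by rewrite gt_eqF// standard_normal_sqr_gt0.
Qed.

End gaussian_variables.

(** * Square-integrable functions *)

Section square_integrable_functions.
Context d (T : measurableType d) (R : realType).
Variable mu : {measure set T -> \bar R}.
Implicit Types (f g h : T -> R) (a : R).

Definition Lfun2 : {pred T -> R} := Lfun mu 2%:E.
Local Notation L2 := Lfun2.

HB.instance Definition _ :=
  GRing.isSubmodClosed.Build R (T -> R) Lfun2 (Lfun_submod_closed mu (lee1n 2)).

Definition inner f g : R := \int[mu]_x (f x * g x).

Definition norm2 f : R := fine 'N[mu]_2%:E[EFin \o f]%E.

Lemma Lfun2_measurable f : f \in L2 -> measurable_fun setT f.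
Proof. by move=> /sub_Lfun_mfun /set_mem. Qed.

Lemma Lfun2_integrableM f g : f \in L2 -> g \in L2 ->
  mu.-integrable setT (EFin \o (f * g)).
Proof. by move=> fL gL; exact/Lfun1_integrable/Lfun2_mul_Lfun1. Qed.

Lemma LnormE2 f : ('N[mu]_2%:E[EFin \o f] =
  (\int[mu]_x (f x ^+ 2)%:E) `^ 2^-1)%E.
Proof.
rewrite unlock; congr poweR; apply: eq_integral => x _ /=.
by rewrite powR_mulrn ?normr_ge0// real_normK ?num_real.
Qed.

Lemma Lfun2_sqr_lty f : measurable_fun setT f ->
  (\int[mu]_x (f x ^+ 2)%:E < +oo)%E -> f \in L2.
Proof.
move=> mf f2; rewrite inE; apply/andP; split; rewrite inE//=.
by rewrite /finite_norm LnormE2 poweR_lty.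
Qed.

Lemma innerC f g : inner f g = inner g f.
Proof. by apply: eq_Rintegral => x _; rewrite mulrC. Qed.

Lemma innerDl f g h : f \in L2 -> g \in L2 -> h \in L2 ->
  inner (f + g) h = inner f h + inner g h.
Proof.
move=> fL gL hL; rewrite -RintegralD//; [|exact: Lfun2_integrableM..].
by apply: eq_Rintegral => x _; rewrite mulrDl.
Qed.

Lemma innerZl a f g : f \in L2 -> g \in L2 ->
  inner (a *: f) g = a * inner f g.
Proof.
move=> fL gL; rewrite -RintegralZl//; last exact: Lfun2_integrableM.
by apply: eq_Rintegral => x _; rewrite mulrA.
Qed.

Lemma innerNl f g : f \in L2 -> g \in L2 -> inner (- f) g = - inner f g.
Proof. by move=> fL gL; rewrite -scaleN1r innerZl// mulN1r. Qed.

Lemma inner0l g : inner 0 g = 0.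
Proof.
transitivity (\int[mu]_x (0 : R)); last by rewrite Rintegral_cst// mul0r.
by apply: eq_Rintegral => x _; rewrite mul0r.
Qed.

Lemma inner_indic (A B : set T) : measurable A -> measurable B ->
  inner \1_A \1_B = fine (mu (A `&` B)).
Proof.
move=> mA mB; rewrite -[A `&` B]setIT -integral_indic//; last exact: measurableI.
by congr fine; apply: eq_integral => x _; rewrite indicI.
Qed.

Lemma inner_ge0 f : 0 <= inner f f.
Proof. by apply: Rintegral_ge0 => x _; rewrite -expr2 sqr_ge0. Qed.

Lemma eq_inner_ae f f' g : f \in L2 -> f' \in L2 -> g \in L2 ->
  {ae mu, forall x, f x = f' x} -> inner f g = inner f' g.
Proof.
move=> fL fL' gL ff'; rewrite /inner /Rintegral; congr fine.
apply: ae_eq_integral => //.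
- by apply/measurable_EFinP; apply: measurable_funM; exact: Lfun2_measurable.
- by apply/measurable_EFinP; apply: measurable_funM; exact: Lfun2_measurable.
- by apply: filterS ff' => x /= -> _.
Qed.

Lemma norm2_ge0 f : 0 <= norm2 f. Proof. by rewrite fine_ge0// Lnorm_ge0. Qed.

Lemma norm2_sqrt f : f \in L2 -> norm2 f = Num.sqrt (inner f f).
Proof.
move=> fL; rewrite /norm2 LnormE2 -powR12_sqrt ?inner_ge0//.
rewrite (_ : (\int[mu]_x (f x ^+ 2)%:E = (inner f f)%:E)%E) ?poweR_EFin//.
rewrite /inner /Rintegral fineK//; apply: integrable_fin_num => //.
exact: Lfun2_integrableM.
Qed.

Lemma sqr_norm2 f : f \in L2 -> norm2 f ^+ 2 = inner f f.
Proof. by move=> fL; rewrite norm2_sqrt// sqr_sqrtr// inner_ge0. Qed.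

Lemma integral_sqr_norm2 f : f \in L2 ->
  (\int[mu]_x (f x ^+ 2)%:E = (norm2 f ^+ 2)%:E)%E.
Proof.
move=> fL; rewrite sqr_norm2// /inner /Rintegral fineK//.
by apply: integrable_fin_num => //; exact: Lfun2_integrableM.
Qed.

Lemma eq_norm2_ae f f' : f \in L2 -> f' \in L2 ->
  {ae mu, forall x, f x = f' x} -> norm2 f = norm2 f'.
Proof.
move=> fL fL' ff'; rewrite !norm2_sqrt// (eq_inner_ae fL fL' fL ff').
by rewrite innerC (eq_inner_ae fL fL' fL' ff').
Qed.

Lemma norm2_EFin f : f \in L2 -> ((norm2 f)%:E = 'N[mu]_2%:E[EFin \o f])%E.
Proof.
move=> /sub_Lfun_finLfun /set_mem fL.
by rewrite fineK// ge0_fin_numE ?Lnorm_ge0.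
Qed.

Lemma norm20 : norm2 0 = 0.
Proof. by rewrite /norm2 Lnorm0// eqe pnatr_eq0. Qed.

Lemma norm2Z a f : f \in L2 -> norm2 (a *: f) = `|a| * norm2 f.
Proof.
move=> fL; have := LnormZ (Lfun_Sub (lee1n 2) fL) a; rewrite /norm2 /= => ->.
by rewrite fineM// -norm2_EFin.
Qed.

Lemma norm2N f : f \in L2 -> norm2 (- f) = norm2 f.
Proof. by move=> fL; rewrite -scaleN1r norm2Z// normrN1 mul1r. Qed.

Lemma ler_norm2D f g : f \in L2 -> g \in L2 ->
  norm2 (f + g) <= norm2 f + norm2 g.
Proof.
by move=> fL gL; exact: (ler_LnormD (Lfun_Sub (lee1n 2) fL) (Lfun_Sub _ gL)).
Qed.

Lemma ler_norm_inner f g : f \in L2 -> g \in L2 ->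
  `|inner f g| <= norm2 f * norm2 g.
Proof.
move=> fL gL; have half : 2^-1 + 2^-1 = 1 :> R by rewrite [RHS]splitr !div1r.
have := hoelder mu (Lfun2_measurable fL) (Lfun2_measurable gL) (ltr0n _ 2)
  (ltr0n _ 2) half.
rewrite -!norm2_EFin// -EFinM Lnorm1 => fg.
have iM := Lfun2_integrableM fL gL.
apply: le_trans (le_normr_Rintegral measurableT iM) _.
rewrite -lee_fin /Rintegral fineK//; apply: integrable_fin_num => //.
exact: integrable_abse iM.
Qed.

Lemma sqr_norm2D f g : f \in L2 -> g \in L2 ->
  norm2 (f + g) ^+ 2 = norm2 f ^+ 2 + 2 * inner f g + norm2 g ^+ 2.
Proof.
move=> fL gL; have fgL : f + g \in L2 by exact: rpredD.
rewrite !sqr_norm2// innerDl// !(innerC _ (f + g)) !innerDl// (innerC g f).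
by ring.
Qed.

Lemma inner_suml (I : Type) (r : seq I) (f : I -> T -> R) g :
  (forall i, f i \in L2) -> g \in L2 ->
  inner (\sum_(i <- r) f i) g = \sum_(i <- r) inner (f i) g.
Proof.
move=> fL gL; elim: r => [|i r IH]; first by rewrite !big_nil inner0l.
by rewrite !big_cons innerDl ?IH//; exact: rpred_sum.
Qed.

Lemma ler_norm2_sum (I : Type) (r : seq I) (f : I -> T -> R) :
  (forall i, f i \in L2) ->
  norm2 (\sum_(i <- r) f i) <= \sum_(i <- r) norm2 (f i).
Proof.
move=> fL; elim: r => [|i r IH]; first by rewrite !big_nil norm20.
rewrite !big_cons; apply: le_trans (ler_norm2D _ _) _ => //; first exact: rpred_sum.
by rewrite lerD2l.
Qed.

Lemma cvg_norm2_integral0 (f_ : nat -> T -> R) : (forall n, f_ n \in L2) ->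
  (\int[mu]_x (f_ n x ^+ 2)%:E @[n --> \oo] --> 0)%E ->
  norm2 (f_ n) @[n --> \oo] --> (0 : R).
Proof.
move=> fL f0; rewrite -(@sqrtr0 R).
have -> : (fun n => norm2 (f_ n)) = Num.sqrt \o (fun n => norm2 (f_ n) ^+ 2).
  by apply/funext => n /=; rewrite sqrtr_sqr ger0_norm ?norm2_ge0.
apply: (@cvg_comp _ _ _ _ Num.sqrt _ (nbhs (0 : R))); last exact: sqrt_continuous.
by move: f0; under eq_fun do rewrite integral_sqr_norm2//; exact: fine_cvg.
Qed.

End square_integrable_functions.

Section bounded_square_integrable.
Context d (T : measurableType d) (R : realType).
Variable mu : {measure set T -> \bar R}.
Hypothesis mu_lty : (mu setT < +oo)%E.
Local Notation L2 := (Lfun2 mu).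

Lemma bounded_measurable_Lfun2 (f : T -> R) : bounded_measurable f -> f \in L2.
Proof.
move=> bf; apply: Lfun2_sqr_lty; first exact: bf.1.
have := bounded_measurable_integrable mu_lty (bounded_measurableM bf bf).
move=> /integrableP[_]; apply: le_lt_trans; rewrite le_eqVlt; apply/orP; left.
by apply/eqP/eq_integral => x _; rewrite /= ger0_norm// -expr2 sqr_ge0.
Qed.

Lemma bounded_cvg_norm2 (f_ : nat -> T -> R) (M : R) :
  (forall n, measurable_fun setT (f_ n)) -> (forall n x, `|f_ n x| <= M) ->
  {ae mu, forall x, f_ n x @[n --> \oo] --> (0 : R)} ->
  norm2 mu (f_ n) @[n --> \oo] --> (0 : R).
Proof.
move=> mf fM f0; have fL n : f_ n \in L2.
  by apply: bounded_measurable_Lfun2; split => //; exists M.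
apply: cvg_norm2_integral0 => //; apply/fine_cvgP; split.
  by apply: nearW => n; rewrite integral_sqr_norm2.
have := @bounded_cvg_Rintegral _ _ _ _ mu_lty (fun n x => f_ n x ^+ 2) (cst 0)
  (M ^+ 2).
rewrite Rintegral_cst// mul0r; apply => //.
- by move=> n; exact: measurable_funX.
- by move=> n x; rewrite normrX lerXn2r ?nnegrE// (le_trans _ (fM n x)).
- by apply: filterS f0 => x fx0; rewrite -(mulr0 (0 : R)); exact: cvgM.
Qed.

End bounded_square_integrable.

(** * The circle *)

Section restricted_measure.
Context d (T : measurableType d) (R : realType).
Variables (mu : {measure set T -> \bar R}) (D : set T) (mD : measurable D).

Lemma ge0_integral_mrestr (f : T -> \bar R) : (forall x, 0 <= f x)%E ->
  measurable_fun setT f ->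
  (\int[mrestr mu mD]_x f x = \int[mu]_(x in D) f x)%E.
Proof.
move=> f0 mf; pose muC := mrestr mu (measurableC mD).
have mfD : measurable_fun setT (f \_ D).
  exact/(measurable_restrictT _ mD)/measurable_funTS.
have fD0 x : (0 <= (f \_ D) x)%E by rewrite patchE; case: ifP.
rewrite [RHS]integral_mkcond.
have -> : (\int[mu]_x (f \_ D) x =
    \int[measure_add (mrestr mu mD) muC]_x (f \_ D) x)%E.
  apply: eq_measure_integral => A mA _.
  rewrite [RHS]measure_addE /= /mrestr -measureU; first by rewrite -setIUr setUv setIT.
  - exact: measurableI.
  - by apply: measurableI => //; exact: measurableC.
  - by rewrite setIACA setICr setI0.
rewrite ge0_integral_measure_add// [X in (_ + X)%E](_ : _ = 0%E) ?adde0.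
  apply: ae_eq_integral => //; exists (~` D); split.
  - exact: measurableC.
  - by rewrite /= /mrestr setICl measure0.
  - by move=> x /=; apply: contra_not => xD _; rewrite patchE mem_set.
rewrite -(integral0 muC setT); apply: ae_eq_integral => //.
exists D; split => //; first by rewrite /= /mrestr setICr measure0.
by move=> x /=; apply: contra_notP => xD _; rewrite patchE memNset.
Qed.

Lemma Rintegral_mrestr (f : T -> R) : measurable_fun setT f ->
  \int[mrestr mu mD]_x f x = \int[mu]_(x in D) f x.
Proof.
move=> /measurable_EFinP mf; rewrite /Rintegral; congr fine.
rewrite integralE [RHS]integralE; congr (_ - _)%E; apply: ge0_integral_mrestr => //.
- exact: measurable_funepos.
- exact: measurable_funeneg.
Qed.

End restricted_measure.

Section circle_measure.
Context {R : realType}.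
Local Notation mu := (circle_measure R).

Lemma circle_measureT : mu setT = 1%E.
Proof.
by rewrite /circle_measure/= /mrestr setTI lebesgue_measure_itv/= lte_fin ltr01
  oppr0 adde0.
Qed.

Lemma circle_measure_lty : (mu setT < +oo)%E.
Proof. by rewrite circle_measureT ltry. Qed.

#[export] Instance circle_ae_filter : Filter (almost_everywhere mu).
Proof. exact: ae_filter_ringOfSetsType. Qed.

Lemma circle_ae_neq (a : R) : {ae mu, forall x, x != a}.
Proof.
exists [set a]; split => //; last by move=> x /= /negP; rewrite negbK => /eqP.
rewrite /= /mrestr; apply/eqP; rewrite eq_le measure_ge0 andbT.
rewrite -(@lebesgue_measure_set1 R a); apply: le_measure; rewrite ?inE//.
by apply: measurableI => //; exact: measurable_itv.
Qed.

Lemma circle_ae (p : R -> Prop) : (forall x, 0 < x -> x < 1 -> p x) ->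
  {ae mu, forall x, p x}.
Proof.
move=> p01; have itv01 : {ae mu, forall x : R, 0 <= x < 1}.
  exists (~` `[0%R, 1%R[%classic); split.
  - by apply: measurableC; exact: measurable_itv.
  - by rewrite /= /mrestr setICl measure0.
  - by move=> x /=; apply: contra_not; rewrite in_itv.
apply: filterS2 itv01 (circle_ae_neq 0) => x /andP[x0 x1] xn0.
by apply: p01 => //; rewrite lt_neqAle eq_sym xn0.
Qed.

End circle_measure.

Section circle_L2.
Context {R : realType}.
Local Notation mu := (circle_measure R).
Implicit Types (f g : R -> R) (x y : L2circle R).

Definition circleL2 : {pred (R -> R)} := Lfun2 mu.

HB.instance Definition _ :=
  GRing.isSubmodClosed.Build R (R -> R) circleL2 (Lfun_submod_closed mu (lee1n 2)).

Lemma circleL2_measurable f : f \in circleL2 -> measurable_fun setT f.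
Proof. exact: Lfun2_measurable. Qed.

Lemma bounded_measurable_circleL2 f : bounded_measurable f -> f \in circleL2.
Proof. exact: (bounded_measurable_Lfun2 circle_measure_lty). Qed.

Lemma L2fun_circleL2 x : (x : R -> R) \in circleL2.
Proof.
rewrite inE; apply/andP; split; rewrite inE/=; first exact: measurable_L2fun.
exact: L2fun_fin.
Qed.

(* [f] is required to be square integrable; [mkL2 f] is junk otherwise *)
Definition mkL2 f : L2circle R :=
  match pselect (f \in circleL2) with
  | left fL => @L2_of R (@mfun_Sub _ _ (measurableTypeR R) (measurableTypeR R) f
      (mem_set (circleL2_measurable fL))) (set_mem (sub_Lfun_finLfun fL))
  | right _ => point
  end.

Lemma mkL2E f : f \in circleL2 -> {ae mu, forall t, mkL2 f t = f t}.
Proof. by rewrite /mkL2; case: pselect => // fL _; exact: L2_ofE. Qed.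

Lemma mkL2K x : mkL2 x = x.
Proof. by apply: L2fun_eq; apply: mkL2E; exact: L2fun_circleL2. Qed.

Lemma inner_mkL2l f g : f \in circleL2 -> g \in circleL2 ->
  inner mu (mkL2 f) g = inner mu f g.
Proof.
by move=> fL gL; apply: eq_inner_ae => //; [exact: L2fun_circleL2|exact: mkL2E].
Qed.

Lemma L2distE_norm2 x y : L2dist x y = norm2 mu ((x : R -> R) - (y : R -> R)).
Proof. by []. Qed.

Lemma L2dist_mkL2 f g : f \in circleL2 -> g \in circleL2 ->
  L2dist (mkL2 f) (mkL2 g) = norm2 mu (f - g).
Proof.
move=> fL gL; rewrite L2distE_norm2; apply: eq_norm2_ae.
- by apply: (rpredB (S := circleL2)); exact: L2fun_circleL2.
- by apply: (rpredB (S := circleL2)).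
- by have := mkL2E gL; apply: filterS2 (mkL2E fL) => t /=; rewrite !fctE => -> ->.
Qed.

End circle_L2.

Section step_functions.
Context {R : realType} (n : nat).
Local Notation mu := (circle_measure R).
Local Notation N := n.+1.
Implicit Types (f g : R -> R) (c : 'I_N -> R) (m : nat) (t : R).

Let N_gt0 : 0 < N%:R :> R. Proof. by rewrite ltr0n. Qed.

Definition cell m : set R := `[m%:R / N%:R, m.+1%:R / N%:R[%classic.

Definition cellf m : R -> R := \1_(cell m).

Definition stepf c : R -> R := \sum_(m < N) c m *: cellf m.

Lemma measurable_cell m : measurable (cell m : set (measurableTypeR R)).
Proof. exact: measurable_itv. Qed.

Lemma sub_cell (m : 'I_N) : cell m `<=` `[0%R, 1%R[%classic.
Proof.
apply: subset_itv; rewrite bnd_simp; first by rewrite divr_ge0// ler0n.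
by rewrite ler_pdivrMr// mul1r ler_nat.
Qed.

Lemma cell_truncn m t : 0 <= t -> cell m t <-> m = Num.truncn (t * N%:R).
Proof.
move=> t0; rewrite /cell/= in_itv/= ler_pdivrMr// ltr_pdivlMr//.
split=> [/truncn_def //|->]; exact/truncn_itv/mulr_ge0/ltW.
Qed.

Lemma cell_inj (m m' : 'I_N) t : cell m t -> cell m' t -> m = m'.
Proof.
move=> tm; have /andP[t0 _] : 0 <= t < 1 by have := sub_cell tm; rewrite /= in_itv.
move: tm => /(cell_truncn _ t0) mt /(cell_truncn _ t0) mt'.
by apply: val_inj; rewrite /= mt mt'.
Qed.

Lemma ex_cell t : 0 <= t -> t < 1 -> exists m : 'I_N, cell m t.
Proof.
move=> t0 t1; have lt : (Num.truncn (t * N%:R) < N)%N.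
  by rewrite truncn_lt_nat ?mulr_ge0 ?(ltW N_gt0)// gtr_pMl.
by exists (Ordinal lt); exact/cell_truncn.
Qed.

Lemma stepf_cell c (m : 'I_N) t : cell m t -> stepf c t = c m.
Proof.
move=> tm; rewrite /stepf fct_sumE (bigD1 m)//= big1 ?addr0 => [|i /eqP im].
  by rewrite scalrfctE /cellf indicE mem_set// [LHS]mulr1.
rewrite scalrfctE /cellf indicE memNset ?scaler0// => ti.
by apply: im; exact: cell_inj ti tm.
Qed.

Lemma cellf_circleL2 m : cellf m \in circleL2.
Proof.
apply: bounded_measurable_circleL2; apply: bounded_measurable_indic.
exact: measurable_cell.
Qed.

Lemma stepf_circleL2 c : stepf c \in circleL2.
Proof. by apply: rpred_sum => m _; rewrite rpredZ// cellf_circleL2. Qed.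

Lemma stepfB c c' : stepf (c - c') = stepf c - stepf c'.
Proof. by rewrite /stepf -sumrB; apply: eq_bigr => m _; rewrite -scalerBl. Qed.

Lemma ler_norm_stepf c M t : 0 <= M -> (forall m : 'I_N, `|c m| <= M) ->
  `|stepf c t| <= M.
Proof.
move=> M0 cM; have [[m tm]|nm] := pselect (exists m : 'I_N, cell m t).
  by rewrite (stepf_cell _ tm).
rewrite /stepf fct_sumE big1 ?normr0// => m _.
by rewrite scalrfctE /cellf indicE memNset ?scaler0// => tm; apply: nm; exists m.
Qed.

Lemma inner_cellf (m m' : 'I_N) :
  inner mu (cellf m) (cellf m') = (m == m')%:R / N%:R.
Proof.
rewrite inner_indic; [|exact: measurable_cell..]; have [<-|/eqP mm'] := eqVneq m m'.
  rewrite setIid /= /mrestr (setIidl (@sub_cell m)) lebesgue_measure_itv/= lte_fin.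
  rewrite ltr_pM2r ?invr_gt0// ltr_nat ltnSn/= -mulrBl -natrB// subSnn.
  by [].
rewrite (_ : cell m `&` cell m' = set0) ?measure0 ?mul0r//.
by rewrite -subset0 => t [tm tm']; apply: mm'; exact: cell_inj tm tm'.
Qed.

Lemma norm2_cellf_le1 (m : 'I_N) : norm2 mu (cellf m) <= 1.
Proof.
rewrite norm2_sqrt ?cellf_circleL2// inner_cellf eqxx -[leRHS]sqrtr1.
by rewrite ler_sqrt// mul1r invf_le1// ler1n.
Qed.

Lemma ler_norm2_stepf c : norm2 mu (stepf c) <= \sum_(m < N) `|c m|.
Proof.
apply: le_trans (ler_norm2_sum _ _) _ => [m|].
  by rewrite rpredZ ?cellf_circleL2.
apply: ler_sum => m _; rewrite norm2Z ?cellf_circleL2//.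
by rewrite ler_piMr// norm2_cellf_le1.
Qed.

Lemma inner_stepfl c g : g \in circleL2 ->
  inner mu (stepf c) g = \sum_(m < N) c m * inner mu (cellf m) g.
Proof.
move=> gL; rewrite inner_suml// => [|m]; last by rewrite rpredZ ?cellf_circleL2.
by apply: eq_bigr => m _; rewrite innerZl// cellf_circleL2.
Qed.

Lemma inner_stepf c c' :
  inner mu (stepf c) (stepf c') = N%:R^-1 * \sum_(m < N) c m * c' m.
Proof.
rewrite inner_stepfl ?stepf_circleL2// mulr_sumr; apply: eq_bigr => m _.
rewrite innerC inner_stepfl ?cellf_circleL2// (bigD1 m)//= big1 ?addr0.
  by rewrite inner_cellf eqxx mul1r; ring.
by move=> i im; rewrite inner_cellf (negbTE im) mul0r mulr0.
Qed.

Definition cell_avg f (m : 'I_N) : R := N%:R * inner mu f (cellf m).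

Definition cell_proj f : R -> R := stepf (cell_avg f).

Definition proj_error f : R := norm2 mu (f - cell_proj f).

Lemma cell_proj_circleL2 f : cell_proj f \in circleL2.
Proof. exact: stepf_circleL2. Qed.

Lemma cell_projB f g : f \in circleL2 -> g \in circleL2 ->
  cell_proj (f - g) = cell_proj f - cell_proj g.
Proof.
move=> fL gL; rewrite /cell_proj -stepfB; congr stepf; apply/funext => m.
rewrite [RHS]/= /cell_avg -mulrBr innerDl ?rpredN ?cellf_circleL2//.
by rewrite innerNl// cellf_circleL2.
Qed.

Lemma inner_cell_proj_stepf f c : f \in circleL2 ->
  inner mu (cell_proj f) (stepf c) = inner mu f (stepf c).
Proof.
move=> fL; rewrite inner_stepf [RHS]innerC inner_stepfl// mulr_sumr.
apply: eq_bigr => m _; rewrite /cell_avg (innerC mu _ f) !mulrA.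
by rewrite mulVf ?gt_eqF// mul1r mulrC.
Qed.

Lemma proj_error_best f c : f \in circleL2 ->
  proj_error f <= norm2 mu (f - stepf c).
Proof.
move=> fL; have pL := cell_proj_circleL2 f.
have dL : cell_proj f - stepf c \in circleL2 by rewrite rpredB// stepf_circleL2.
have fpL : f - cell_proj f \in circleL2 by rewrite rpredB.
rewrite -(ler_pXn2r (n := 2))// ?nnegrE ?norm2_ge0//.
rewrite -(subrKA (cell_proj f) f) [leRHS]sqr_norm2D//.
rewrite innerDl ?rpredN// innerNl// -stepfB inner_cell_proj_stepf// subrr.
by rewrite mulr0 addr0 lerDl sqr_ge0.
Qed.

Lemma inner_cell_proj_le f : f \in circleL2 ->
  inner mu f (cell_proj f) <= norm2 mu f ^+ 2.
Proof.
move=> fL; have pL := cell_proj_circleL2 f.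
have fpL : f - cell_proj f \in circleL2 by rewrite rpredB.
rewrite -[in leRHS](subrK (cell_proj f) f) sqr_norm2D//.
rewrite innerDl ?rpredN// innerNl// inner_cell_proj_stepf// subrr mulr0 addr0.
by rewrite -inner_cell_proj_stepf// -sqr_norm2// lerDr sqr_ge0.
Qed.

Lemma proj_error_le_norm2 f : f \in circleL2 -> proj_error f <= norm2 mu f.
Proof.
move=> fL; apply: le_trans (proj_error_best (fun=> 0) fL) _.
by rewrite /stepf big1 ?subr0// => m _; rewrite scale0r.
Qed.

Lemma ler_proj_errorD f g : f \in circleL2 -> g \in circleL2 ->
  proj_error f <= proj_error g + norm2 mu (f - g).
Proof.
move=> fL gL; have fgL : f - g \in circleL2 by rewrite rpredB.
apply: le_trans (_ : proj_error g + proj_error (f - g) <= _); last first.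
  by rewrite lerD2l proj_error_le_norm2.
rewrite /proj_error [f - cell_proj f](_ : _ =
  (g - cell_proj g) + (f - g - cell_proj (f - g))).
  by apply: ler_norm2D; rewrite rpredB// cell_proj_circleL2.
by rewrite cell_projB// addrACA -opprD !subrKC.
Qed.

End step_functions.

Section clamp.
Context {R : realType}.
Implicit Types M x y : R.

Definition clamp M x : R := Num.max (- M) (Num.min x M).

Lemma ler_norm_clamp M x : 0 <= M -> `|clamp M x| <= M.
Proof.
move=> M0; rewrite ler_norml /clamp le_max lexx/= ge_max ge_min lexx orbT andbT.
lra.
Qed.

Lemma clamp_id M x : `|x| <= M -> clamp M x = x.
Proof. by rewrite ler_norml => /andP[xM Mx]; rewrite /clamp min_l// max_r. Qed.

Lemma ler_dist_clamp M x y : `|clamp M x - clamp M y| <= `|x - y|.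
Proof.
have := ler_norm (x - y); have := ler_norm (- (x - y)); rewrite normrN => ? ?.
rewrite /clamp !minEle !maxEle; case: (leP x M) => ?; case: (leP y M) => ?;
  case: (leP (- M) x) => ?; case: (leP (- M) y) => ?; case: (leP (- M) M) => ?;
  rewrite ler_norml; apply/andP; split; lra.
Qed.

Lemma ler_norm_sub_clamp M x : 0 <= M -> `|x - clamp M x| <= `|x|.
Proof.
move=> M0; have := ler_norm x; have := ler_norm (- x); rewrite normrN => ? ?.
rewrite /clamp minEle maxEle; case: (leP x M) => ?;
  case: (leP (- M) x) => ?; case: (leP (- M) M) => ?;
  rewrite ler_norml; apply/andP; split; lra.
Qed.

Lemma bounded_measurable_clamp d (T : measurableType d) M (f : T -> R) : 0 <= M ->
  measurable_fun setT f -> bounded_measurable (fun t => clamp M (f t)).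
Proof.
move=> M0 mf; split; last by exists M => t; exact: ler_norm_clamp.
by apply: measurable_maxr => //; exact: measurable_minr.
Qed.

Lemma continuous_clamp (T : topologicalType) M (f : T -> R) : continuous f ->
  continuous (fun t => clamp M (f t)).
Proof.
move=> cf t; apply/cvgrPdist_le => e e0.
have /cvgrPdist_le/(_ _ e0) := cf t; apply: filterS => t'.
exact/le_trans/ler_dist_clamp.
Qed.

End clamp.

Section continuous_density.
Context {R : realType}.
Local Notation mu := (circle_measure R).
Implicit Types f g : R -> R.

Lemma cvg_norm2_clamp f : f \in circleL2 ->
  norm2 mu (fun x => f x - clamp n%:R (f x)) @[n --> \oo] --> (0 : R).
Proof.
move=> fL; have mf := circleL2_measurable fL.
have fcL n : (fun x => f x - clamp n%:R (f x)) \in circleL2.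
  apply: (rpredB (S := circleL2)) => //; apply: bounded_measurable_circleL2.
  exact: bounded_measurable_clamp.
apply: cvg_norm2_integral0 => //.
have [] := @dominated_convergence _ _ _ mu setT measurableT
  (fun n x => ((f x - clamp n%:R (f x)) ^+ 2)%:E) (cst 0%E)
  (fun x => (f x ^+ 2)%:E).
- move=> n; apply/measurable_EFinP; apply: measurable_funX.
  exact: circleL2_measurable (fcL n).
- by [].
- apply: aeW => x _; apply: cvg_near_cst; near=> n.
  rewrite clamp_id ?subrr ?expr0n//; near: n; exact: nbhs_infty_ger.
- exact: (Lfun2_integrableM fL fL).
- apply: aeW => x n _; rewrite /= lee_fin ger0_norm ?sqr_ge0//.
  rewrite -(real_normK (num_real (f x - _))) -(real_normK (num_real (f x))).
  by rewrite lerXn2r ?nnegrE// ler_norm_sub_clamp.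
by move=> _ _; rewrite integral0.
Unshelve. all: by end_near.
Qed.

Lemma circle_L1_continuous_dense f (e : R) : bounded_measurable f -> 0 < e ->
  exists2 g, continuous g & (\int[mu]_x `|f x - g x|%:E <= e%:E)%E.
Proof.
move=> bf e0; have mf := bf.1.
have itv_lty : (@lebesgue_measure R `[0%R, 1%R[%classic < +oo)%E.
  by rewrite lebesgue_measure_itv/= lte_fin ltr01 -EFinB ltry.
have [|g_ [cg _ fg]] := @approximation_continuous_integrable R `[0%R, 1%R[
    f (measurable_itv _) itv_lty.
  apply: measurable_bounded_integrable => //; first exact: measurable_funTS.
  have [M fM] := bf.2; exists M; split; first exact: num_real.
  by move=> x Mx t _; apply: le_trans (fM t) (ltW Mx).
have /fine_cvgP[fg_fin /cvgrPdist_le/(_ _ e0) fg_le] := fg.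
near \oo => n; exists (g_ n) => //.
have mg : measurable_fun setT (g_ n) by exact: continuous_measurable_fun.
rewrite ge0_integral_mrestr//; last first.
  by apply/measurable_EFinP; apply: measurableT_comp => //; exact: measurable_funB.
rewrite -[leLHS]fineK; last by near: n.
rewrite lee_fin; have : `|0 - fine (\int[lebesgue_measure]_(x in `[0%R, 1%R[)
  `|(f x - g_ n x)%:E|)%E| <= e by near: n.
by rewrite sub0r normrN; exact/le_trans/ler_norm.
Unshelve. all: by end_near.
Qed.

(* [|h|^2 <= 2 M |h|] turns approximation in mean into approximation in [L^2]. *)
Lemma bounded_continuous_dense f (M e : R) : measurable_fun setT f ->
  (forall x, `|f x| <= M) -> 0 < e -> exists g, [/\ continuous g,
    forall x, `|g x| <= M & norm2 mu (f - g) <= e].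
Proof.
move=> mf fM e0; have M0 : 0 <= M by exact: le_trans (fM 0).
have bf : bounded_measurable f by split => //; exists M.
have d0 : 0 < e ^+ 2 / (2 * M + 1).
  by rewrite divr_gt0 ?exprn_gt0// ltr_wpDl// mulr_ge0.
have [g cg fg] := circle_L1_continuous_dense bf d0.
have mg : measurable_fun setT g by exact: continuous_measurable_fun.
pose h x := clamp M (g x).
have bh : bounded_measurable h by exact: bounded_measurable_clamp.
exists h; split; [exact: continuous_clamp|by move=> x; exact: ler_norm_clamp|].
have bfh := bounded_measurableB bf bh.
have fhL := bounded_measurable_circleL2 bfh.
rewrite -(ler_pXn2r (n := 2))// ?nnegrE ?norm2_ge0 ?(ltW e0)//.
rewrite -lee_fin -integral_sqr_norm2//.
apply: (@le_trans _ _ (\int[mu]_x ((2 * M)%:E * `|f x - g x|%:E))%E).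
  apply: ge0_le_integral => //.
  - by move=> x _; rewrite lee_fin sqr_ge0.
  - by apply/measurable_EFinP; apply: measurable_funX; exact: bfh.1.
  - apply: emeasurable_funM => //; apply/measurable_EFinP.
    by apply: measurableT_comp => //; exact: measurable_funB.
  - move=> x _; rewrite -EFinM lee_fin -(real_normK (num_real _)) expr2.
    have fh : `|f x - h x| <= `|f x - g x|.
      by rewrite -{1}(clamp_id (fM x)) ler_dist_clamp.
    apply: ler_pM => //; apply: le_trans (ler_normB _ _) _.
    by rewrite mulr_natl mulr2n lerD// ler_norm_clamp.
rewrite ge0_integralZl_EFin//.
- apply: le_trans (lee_wpmul2l _ fg) _; first by rewrite lee_fin mulr_ge0.
  rewrite -EFinM lee_fin mulrCA ler_piMr ?sqr_ge0//.
  by rewrite ler_pdivrMr ?mul1r ?lerDl// ltr_wpDl// mulr_ge0.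
- apply/measurable_EFinP; apply: measurableT_comp => //; exact: measurable_funB.
- by rewrite mulr_ge0.
Qed.

Lemma circleL2_continuous_dense f (e : R) : f \in circleL2 -> 0 < e ->
  exists g, [/\ continuous g, bounded_measurable g & norm2 mu (f - g) <= e].
Proof.
move=> fL e0; have e20 : 0 < e / 2 by rewrite divr_gt0.
have mf := circleL2_measurable fL.
have /cvgrPdist_le/(_ _ e20)[n _ /(_ n (leqnn n))] := cvg_norm2_clamp fL.
rewrite /= sub0r normrN ger0_norm ?norm2_ge0//.
set h := fun x => clamp n%:R (f x) => fh.
have bh : bounded_measurable h by exact: bounded_measurable_clamp.
have [||g [cg gn hg]] := @bounded_continuous_dense h n%:R _ _ _ e20.
- exact: bh.1.
- by move=> x; exact: ler_norm_clamp.
have bg : bounded_measurable g.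
  by split; [exact: continuous_measurable_fun|exists n%:R].
exists g; split => //; rewrite [e]splitr.
have hL := bounded_measurable_circleL2 bh; have gL := bounded_measurable_circleL2 bg.
rewrite -(subrKA h f); apply: le_trans (ler_norm2D _ _) (lerD _ _) => //.
  exact: (rpredB (S := circleL2)).
exact: (rpredB (S := circleL2)).
Qed.

End continuous_density.

Section cell_projection_density.
Context {R : realType}.
Local Notation mu := (circle_measure R).
Implicit Types f g : R -> R.

Lemma cvg_truncn_div (t : R) : 0 <= t ->
  (Num.truncn (t * n.+1%:R))%:R / n.+1%:R @[n --> \oo] --> t.
Proof.
move=> t0; apply/subr_cvg0; apply: squeeze0_cvgr (@cvg_harmonic R) => n.
have N0 : (0 : R) < n.+1%:R by rewrite ltr0n.
have /andP[] := truncn_itv (mulr_ge0 t0 (ltW N0)).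
rewrite -ler_pdivrMr// -ltr_pdivlMr// -[(Num.truncn _).+1%:R]natr1 mulrDl mul1r => tt tt'.
by rewrite distrC ger0_norm ?subr_ge0// lerBlDl ltW.
Qed.

Lemma cvg_proj_error_continuous g : continuous g -> bounded_measurable g ->
  proj_error n g @[n --> \oo] --> (0 : R).
Proof.
move=> cg [mg [M gM]]; have M0 : 0 <= M by apply: le_trans (gM 0).
have gL : g \in circleL2.
  by apply: bounded_measurable_circleL2; split => //; exists M.
pose sample n (m : 'I_n.+1) := g (m%:R / n.+1%:R).
apply: (squeeze0_cvgr (v := fun n => norm2 mu (g - stepf (@sample n)))) => [n|].
  by rewrite ger0_norm ?norm2_ge0// proj_error_best.
apply: (bounded_cvg_norm2 circle_measure_lty (M := M + M)) => [n|n x|].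
- have : g - stepf (@sample n) \in circleL2 by rewrite rpredB// stepf_circleL2.
  exact: circleL2_measurable.
- apply: le_trans (ler_normB _ _) (lerD _ _) => //.
  by apply: ler_norm_stepf => // m; exact: gM.
apply: circle_ae => t /ltW t0 t1.
have -> : (fun n => (g - stepf (@sample n)) t) =
    (fun n => g t - g ((Num.truncn (t * n.+1%:R))%:R / n.+1%:R)).
  apply/funext => n; have [m tm] := ex_cell n t0 t1.
  rewrite !fctE (stepf_cell _ tm) /sample.
  by have -> : m = Num.truncn (t * n.+1%:R) :> nat by exact/cell_truncn.
rewrite -(subrr (g t)); apply: cvgB; first exact: cvg_cst.
exact: (@cvg_comp _ _ _ _ g _ (nbhs t)) (cvg_truncn_div t0) (cg t).
Qed.

Lemma cvg_proj_error f : f \in circleL2 ->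
  proj_error n f @[n --> \oo] --> (0 : R).
Proof.
move=> fL; apply/cvgrPdist_le => e e0; have e20 : 0 < e / 2 by rewrite divr_gt0.
have [g [cg bg fg]] := circleL2_continuous_dense fL e20.
have gL := bounded_measurable_circleL2 bg.
have /cvgrPdist_le/(_ _ e20) := cvg_proj_error_continuous cg bg; apply: filterS => n.
rewrite !sub0r !normrN !ger0_norm ?norm2_ge0// => gn.
by rewrite [e]splitr (le_trans (ler_proj_errorD n fL gL))// lerD.
Qed.

Lemma cvg_inner_cell_proj f g : f \in circleL2 -> g \in circleL2 ->
  inner mu f (cell_proj n g) @[n --> \oo] --> inner mu f g.
Proof.
move=> fL gL; apply/subr_cvg0.
apply: (squeeze0_cvgr (v := fun n => norm2 mu f * proj_error n g)) => [n|]; last first.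
  by rewrite -(mulr0 (norm2 mu f)); apply: cvgMl_tmp; exact: cvg_proj_error.
have pL := cell_proj_circleL2 n g; have gpL : g - cell_proj n g \in circleL2.
  by rewrite rpredB.
rewrite !(innerC mu f) distrC -innerNl// -innerDl ?rpredN// mulrC.
exact: ler_norm_inner.
Qed.

End cell_projection_density.

(** * Trigonometric polynomials *)

Section trigonometric_polynomials.
Context {R : realType}.
Implicit Types (k : nat) (a b t : R) (s : seq (R * nat * R)).

Definition freq k : R := k%:R * (pi *+ 2).

Definition tmode k b : R -> R := fun t => cos (freq k * t + b).

(* [s] lists the amplitude, frequency and phase of each summand. *)
Definition trigp s : R -> R := \sum_(x <- s) x.1.1 *: tmode x.1.2 x.2.

Definition trigp_deriv s :=
  [seq (x.1.1 * freq x.1.2, x.1.2, x.2 + pi / 2) | x <- s].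

Definition is_trigp (f : R -> R) := exists s, f = trigp s.

Lemma trigp_nil : trigp [::] = 0. Proof. exact: big_nil. Qed.

Lemma trigp_cons x s : trigp (x :: s) = x.1.1 *: tmode x.1.2 x.2 + trigp s.
Proof. exact: big_cons. Qed.

Lemma is_derive_tmode k b t :
  is_derive t (1 : R) (tmode k b) (freq k * tmode k (b + pi / 2) t).
Proof.
rewrite /tmode addrA cosDpihalf mulrN -mulNr mulrC mulrN -mulNr.
apply: (@is_derive1_comp _ cos (fun t => freq k * t + b)).
exact: is_derive_affine.
Qed.

Lemma is_derive_trigp s t : is_derive t (1 : R) (trigp s) (trigp (trigp_deriv s) t).
Proof.
elim: s => [|x s IH]; first by rewrite /= !trigp_nil; exact: is_derive_cst.
rewrite /= !trigp_cons /= fctE; apply: is_deriveD => //.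
by rewrite -scalerA; exact: is_deriveZ (is_derive_tmode _ _ _).
Qed.

Lemma is_derive_continuous (F f : R -> R) :
  (forall x, is_derive x (1 : R) F (f x)) -> continuous F.
Proof.
move=> dF x; apply: differentiable_continuous.
by apply/derivable1_diffP; have [] := dF x.
Qed.

Lemma continuous_tmode k b : continuous (tmode k b).
Proof. exact: is_derive_continuous (is_derive_tmode k b). Qed.

Lemma continuous_trigp s : continuous (trigp s).
Proof. exact: is_derive_continuous (is_derive_trigp s). Qed.

Lemma tmode_circleL2 k b : tmode k b \in circleL2.
Proof.
apply: bounded_measurable_circleL2; split; last by exists 1 => t; exact: cos_max.
by apply: continuous_measurable_fun; exact: continuous_tmode.
Qed.

Lemma trigp_circleL2 s : trigp s \in circleL2.
Proof. by apply: rpred_sum => x _; rewrite rpredZ ?tmode_circleL2. Qed.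

Lemma cos_period k x : cos (x + freq k) = cos x.
Proof.
elim: k x => [|k IH] x; first by rewrite /freq mul0r addr0.
by rewrite /freq -natr1 mulrDl mul1r addrA cosD2pi IH.
Qed.

Lemma tmodeD1n k b t n : tmode k b (t + n%:R) = tmode k b t.
Proof.
rewrite /tmode mulrDr addrAC.
have -> : freq k * n%:R = freq (k * n) by rewrite /freq natrM; ring.
exact: cos_period.
Qed.

Lemma trigpD1 s t : trigp s (t + 1) = trigp s t.
Proof.
rewrite /trigp !fct_sumE; apply: eq_bigr => x _.
by rewrite !scalrfctE (tmodeD1n _ _ _ 1).
Qed.

Lemma derive1_trigp s : (trigp s)^`()%classic = trigp (trigp_deriv s).
Proof.
by apply/funext => t; rewrite derive1E; have [] := is_derive_trigp s t.
Qed.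

Lemma derive1n_trigp n s : derive1n n (trigp s) = trigp (iter n trigp_deriv s).
Proof. by elim: n => //= n ->; exact: derive1_trigp. Qed.

Lemma periodic_smooth_trigp s : periodic_smooth (trigp s).
Proof.
split; last exact: trigpD1.
move=> n x; rewrite derive1n_trigp.
by have [] := is_derive_trigp (iter n trigp_deriv s) x.
Qed.

Lemma is_trigp_cst c : is_trigp (cst c).
Proof.
exists [:: (c, 0%N, 0)]; apply/funext => t.
by rewrite trigp_cons trigp_nil addr0 /= fctE /tmode /freq !mul0r add0r cos0 [RHS]mulr1.
Qed.

Lemma is_trigpD f g : is_trigp f -> is_trigp g -> is_trigp (f + g).
Proof. by move=> [s ->] [s' ->]; exists (s ++ s'); rewrite /trigp big_cat. Qed.

Lemma is_trigpZ a f : is_trigp f -> is_trigp (a *: f).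
Proof.
move=> [s ->]; exists [seq (a * x.1.1, x.1.2, x.2) | x <- s].
by rewrite /trigp big_map scaler_sumr; apply: eq_bigr => x _; rewrite scalerA.
Qed.

Lemma is_trigp_sum (I : Type) (r : seq I) (f : I -> R -> R) :
  (forall i, is_trigp (f i)) -> is_trigp (\sum_(i <- r) f i).
Proof.
move=> tf; elim: r => [|i r IH]; first by rewrite big_nil; exact: is_trigp_cst.
by rewrite big_cons; exact: is_trigpD.
Qed.

Lemma is_trigp_tmode k b : is_trigp (tmode k b).
Proof. by exists [:: (1, k, b)]; rewrite trigp_cons trigp_nil addr0 scale1r. Qed.

Lemma is_trigp_tmodeM k b k' b' : is_trigp (tmode k b * tmode k' b').
Proof.
wlog kk' : k b k' b' / (k' <= k)%N => [le_case|].
  by have [/le_case//|/ltnW/le_case] := leqP k' k; rewrite mulrC.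
have -> : tmode k b * tmode k' b' =
    2^-1 *: tmode (k + k') (b + b') + 2^-1 *: tmode (k - k') (b - b').
  apply/funext => t; rewrite !fctE /tmode /freq natrD natrB//.
  have -> : (k%:R + k'%:R) * (pi *+ 2) * t + (b + b') =
    (k%:R * (pi *+ 2) * t + b) + (k'%:R * (pi *+ 2) * t + b') by ring.
  have -> : (k%:R - k'%:R) * (pi *+ 2) * t + (b - b') =
    (k%:R * (pi *+ 2) * t + b) - (k'%:R * (pi *+ 2) * t + b') by ring.
  move: (k%:R * _ * t + b) (k'%:R * _ * t + b') => x y.
  by rewrite (cosD x y) (cosB x y) /GRing.scale/=; field.
by apply: is_trigpD; apply: is_trigpZ; exact: is_trigp_tmode.
Qed.

Lemma is_trigpM f g : is_trigp f -> is_trigp g -> is_trigp (f * g).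
Proof.
move=> [s ->] [s' ->]; rewrite /trigp mulr_suml; apply: is_trigp_sum => x.
rewrite mulr_sumr; apply: is_trigp_sum => y.
rewrite (_ : _ * _ = (x.1.1 * y.1.1) *: (tmode x.1.2 x.2 * tmode y.1.2 y.2)).
  by apply: is_trigpZ; exact: is_trigp_tmodeM.
by apply/funext => t; rewrite !fctE /GRing.scale/= mulrACA.
Qed.

Lemma is_trigp_bernstein m (F : nat -> R) p y : is_trigp p ->
  is_trigp (fun t => bernstein m F (p t) y).
Proof.
move=> tp; elim: m y => [|m IH] y /=; first exact: is_trigp_cst.
have tq : is_trigp (cst 1 + -1 *: p).
  by apply: is_trigpD; [exact: is_trigp_cst|exact: is_trigpZ].
have := is_trigpD (is_trigpM tp (IH y.+1)) (is_trigpM tq (IH y)).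
congr is_trigp; apply/funext => t; rewrite !fctE /=.
by rewrite [_ *: _]mulN1r.
Qed.

End trigonometric_polynomials.

Section trigonometric_density.
Context {R : realType}.
Local Notation mu := (circle_measure R).
Implicit Types (a b t p : R).

(* A trigonometric polynomial that, on [0, 1], is above 1/2 exactly on ]a, b[. *)
Definition interval_sign a b t : R :=
  (1 + sin (pi * (t - a)) * sin (pi * (b - t))) / 2.

Lemma is_trigp_interval_sign a b : is_trigp (interval_sign a b).
Proof.
have -> : interval_sign a b = cst ((1 - cos (pi * (b - a)) / 2) / 2) +
    4^-1 *: tmode 1 (- (pi * (a + b))).
  apply/funext => t; rewrite !fctE /interval_sign /tmode /freq mul1r mulr2n.
  have -> : (pi + pi) * t - pi * (a + b) = pi * (t - a) - pi * (b - t) by ring.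
  have -> : pi * (b - a) = pi * (t - a) + pi * (b - t) by ring.
  move: (pi * (t - a)) (pi * (b - t)) => x y.
  by rewrite (cosD x y) (cosB x y) /GRing.scale/=; field.
by apply: is_trigpD; [exact: is_trigp_cst|exact/is_trigpZ/is_trigp_tmode].
Qed.

Lemma interval_sign_itv a b t : 0 <= interval_sign a b t <= 1.
Proof.
have : `|sin (pi * (t - a)) * sin (pi * (b - t))| <= 1.
  by rewrite normrM -[leRHS]mulr1 ler_pM// sin_max.
by rewrite ler_norml /interval_sign => /andP[? ?]; apply/andP; split; lra.
Qed.

Lemma sin_pi_gt0 t : 0 < t -> t < 1 -> 0 < sin (pi * t).
Proof.
move=> t0 t1; apply: sin_gt0_pi; rewrite mulr_gt0 ?pi_gt0//=.
by rewrite gtr_pMr// pi_gt0.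
Qed.

Lemma interval_sign_gt a b t : 0 <= a -> b <= 1 -> a < t -> t < b ->
  2^-1 < interval_sign a b t.
Proof.
move=> a0 b1 ta tb.
have sa : 0 < sin (pi * (t - a)) by apply: sin_pi_gt0; lra.
have sb : 0 < sin (pi * (b - t)) by apply: sin_pi_gt0; lra.
by have := mulr_gt0 sa sb; rewrite /interval_sign; lra.
Qed.

Lemma interval_sign_lt a b t : 0 <= a -> b <= 1 -> a < b -> 0 < t -> t < 1 ->
  t < a \/ b < t -> interval_sign a b t < 2^-1.
Proof.
move=> a0 b1 ab t0 t1 [ta|bt]; rewrite /interval_sign.
- have sa : 0 < sin (pi * (a - t)) by apply: sin_pi_gt0; lra.
  have sb : 0 < sin (pi * (b - t)) by apply: sin_pi_gt0; lra.
  by have := mulr_gt0 sa sb; rewrite -(opprB a t) mulrN sinN; lra.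
- have sa : 0 < sin (pi * (t - a)) by apply: sin_pi_gt0; lra.
  have sb : 0 < sin (pi * (t - b)) by apply: sin_pi_gt0; lra.
  by have := mulr_gt0 sa sb; rewrite -(opprB t b) mulrN sinN; lra.
Qed.

Lemma indic_interval_sign a b t : 0 <= a -> b <= 1 -> a < b -> 0 < t -> t < 1 ->
  t != a -> t != b ->
  interval_sign a b t != 2^-1 /\
  \1_`[a, b[%classic t = (2^-1 < interval_sign a b t)%R%:R :> R.
Proof.
move=> a0 b1 ab t0 t1; rewrite (neq_lt t a) (neq_lt t b) indicE => /orP ta /orP tb.
have out : t < a \/ b < t -> interval_sign a b t < 2^-1 by exact: interval_sign_lt.
have [tab|tab] := boolP (a < t < b).
  have /andP[at_ tb_] := tab; have hin := interval_sign_gt a0 b1 at_ tb_.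
  by split; [rewrite gt_eqF|rewrite hin mem_set// /= in_itv/= (ltW at_) tb_].
have lt : interval_sign a b t < 2^-1.
  apply: out; case: ta => [|at_]; first by left.
  by case: tb => [tb_|]; [move: tab; rewrite at_ tb_|right].
split; first by rewrite lt_eqF.
rewrite memNset/=; first by rewrite ltNge ltW.
rewrite in_itv/= => /andP[at_ tb_]; move: tab; rewrite tb_ andbT.
by case: ta => [|->//]; rewrite ltNge at_.
Qed.

Definition bernstein_step m p : R :=
  bernstein m.+1 (fun j => (2^-1 < j%:R / m.+1%:R :> R)%R%:R) p 0.

Lemma bernstein_step_dist m p : 0 <= p <= 1 -> p != 2^-1 ->
  `|(2^-1 < p)%R%:R - bernstein_step m p| <= ((p - 2^-1) ^+ 2)^-1 * m.+1%:R^-1.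
Proof.
move=> p01 p2; have d0 : 0 < (p - 2^-1) ^+ 2.
  by rewrite exprn_even_gt0//= subr_eq0.
apply: le_trans (ler_norm_bernsteinB _ _ _ _ p01) _.
apply: (@le_trans _ _ (bernstein m.+1 (fun j => ((p - 2^-1) ^+ 2)^-1 *
    (j%:R / m.+1%:R - p) ^+ 2) p 0)); last first.
  rewrite bernsteinZ ler_wpM2l ?invr_ge0 ?(ltW d0)//.
  exact: bernstein_variance.
apply: le_bernstein => // j; rewrite [leRHS]mulrC ler_pdivlMr//.
move: (j%:R / m.+1%:R) => x.
case: (ltP 2^-1 x) => x2; case: (ltP 2^-1 p) => p2' /=.
- by rewrite subrr normr0 mul0r sqr_ge0.
- by rewrite sub0r normrN normr1 mul1r; nra.
- by rewrite subr0 normr1 mul1r; nra.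
- by rewrite subrr normr0 mul0r sqr_ge0.
Qed.

Lemma ler_norm_bernstein_step m p : 0 <= p <= 1 -> `|bernstein_step m p| <= 1.
Proof.
move=> p01; apply: le_trans (ler_norm_bernstein _ _ _ p01) _.
rewrite -[leRHS](bernstein_cst m.+1 1 p 0); apply: le_bernstein => // j.
by case: (_ < _); rewrite ?normr1 ?normr0.
Qed.

Lemma trigp_dense_indic a b (e : R) : 0 <= a -> b <= 1 -> a < b -> 0 < e ->
  exists s, norm2 mu (\1_`[a, b[%classic - trigp s) <= e.
Proof.
move=> a0 b1 ab e0; set f : R -> R := \1_`[a, b[%classic.
pose g k t := bernstein_step k (interval_sign a b t).
have tg k : is_trigp (g k) by exact/is_trigp_bernstein/is_trigp_interval_sign.
have mf : measurable_fun setT f.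
  by have [] := bounded_measurable_indic R (measurable_itv `[a, b[).
have : norm2 mu (f - g k) @[k --> \oo] --> (0 : R).
  apply: (bounded_cvg_norm2 circle_measure_lty (M := 1 + 1)) => [k|k t|].
  - apply: measurable_funB => //; have [s ->] := tg k.
    exact: circleL2_measurable (trigp_circleL2 s).
  - apply: le_trans (ler_normB _ _) (lerD _ _); first exact: ler_norm_indic.
    exact/ler_norm_bernstein_step/interval_sign_itv.
  apply: (filterS3 _ _ (circle_ae_neq a) (circle_ae_neq b)
    (circle_ae (p := fun t => 0 < t < 1) _)) => [t ta tb /andP[t0 t1]|t -> ->//].
  have [p2 ft] := indic_interval_sign a0 b1 ab t0 t1 ta tb.
  apply: squeeze0_cvgr (cvg0_natV_mul ((interval_sign a b t - 2^-1) ^+ 2)^-1) => k.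
  by rewrite !fctE /f ft bernstein_step_dist// interval_sign_itv.
move=> /cvgrPdist_le/(_ _ e0)[k _ /(_ k (leqnn k))].
rewrite /= sub0r normrN ger0_norm ?norm2_ge0// => fg.
by have [s gs] := tg k; exists s; rewrite -gs.
Qed.

Lemma trigp_dense_stepf n (c : 'I_n.+1 -> R) (e : R) : 0 < e ->
  exists s, norm2 mu (stepf c - trigp s) <= e.
Proof.
move=> e0; pose C : R := \sum_(m < n.+1) `|c m| + 1.
have C0 : 0 < C by rewrite ltr_wpDl// sumr_ge0.
have N0 : (0 : R) < n.+1%:R by rewrite ltr0n.
have /choice[s_ s_cell] (m : 'I_n.+1) :
    exists s, norm2 mu (cellf n m - trigp s) <= e / C.
  apply: trigp_dense_indic; rewrite ?divr_gt0//.
  - by rewrite ler_pdivrMr// mul1r ler_nat.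
  - by rewrite ltr_pM2r ?invr_gt0// ltr_nat.
have [s sE] : is_trigp (\sum_(m < n.+1) c m *: trigp (s_ m)).
  by apply: is_trigp_sum => m; apply: is_trigpZ; exists (s_ m).
exists s; rewrite -sE /stepf -sumrB; under eq_bigr do rewrite -scalerBr.
have dL (m : 'I_n.+1) : cellf n m - trigp (s_ m) \in circleL2.
  by rewrite rpredB ?cellf_circleL2 ?trigp_circleL2.
apply: le_trans (ler_norm2_sum _ _) _ => [m|]; first by rewrite rpredZ.
apply: (@le_trans _ _ (\sum_(m < n.+1) `|c m| * (e / C))).
  by apply: ler_sum => m _; rewrite norm2Z// ler_wpM2l.
by rewrite -mulr_suml mulrCA ler_piMr ?(ltW e0)// ler_pdivrMr// mul1r lerDl.
Qed.

Lemma trigp_dense f (e : R) : f \in circleL2 -> 0 < e ->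
  exists s, norm2 mu (f - trigp s) <= e.
Proof.
move=> fL e0; have e20 : 0 < e / 2 by rewrite divr_gt0.
have /cvgrPdist_le/(_ _ e20)[n _ /(_ n (leqnn n))] := cvg_proj_error fL.
rewrite /= sub0r normrN ger0_norm ?norm2_ge0// => fn.
have [s ns] := trigp_dense_stepf (@cell_avg R n f) e20; exists s.
rewrite [e]splitr -(subrKA (cell_proj n f) f).
have pL := cell_proj_circleL2 n f; apply: (le_trans _ (lerD fn ns)).
by apply: ler_norm2D; rewrite rpredB// trigp_circleL2.
Qed.

End trigonometric_density.

(** * The covariance operators on trigonometric polynomials *)

Section circle_calculus.
Context {R : realType}.
Local Notation mu := (circle_measure R).
Local Notation leb := (@lebesgue_measure R).
Implicit Types (f g F G : R -> R) (a b : R).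

Lemma continuous_integrable_itv f a b : continuous f ->
  leb.-integrable `[a, b[ (EFin \o f).
Proof.
move=> cf; have abi : leb.-integrable `[a, b] (EFin \o f).
  apply: continuous_compact_integrable; first exact: segment_compact.
  exact: continuous_subspaceT.
by apply: integrableS abi => //; apply: subset_itvl; rewrite bnd_simp.
Qed.

Lemma Rintegral_circle f : continuous f ->
  \int[mu]_x f x = \int[leb]_(x in `[0%R, 1%R]) f x.
Proof.
move=> cf; rewrite Rintegral_mrestr; last exact: continuous_measurable_fun.
by rewrite Rintegral_itv_bndo_bndc//; exact: continuous_integrable_itv.
Qed.

Lemma is_derive_LRcontinuous F f a b :
  (forall x, is_derive x (1 : R) F (f x)) -> derivable_oo_LRcontinuous F a b.
Proof.
move=> dF; have cF := is_derive_continuous dF; split.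
- by move=> x _; have [] := dF x.
- by apply: cvg_at_right_filter; exact: cF.
- by apply: cvg_at_left_filter; exact: cF.
Qed.

Lemma is_derive1E F f : (forall x, is_derive x (1 : R) F (f x)) ->
  F^`()%classic = f.
Proof. by move=> dF; apply/funext => x; rewrite derive1E; have [] := dF x. Qed.

Lemma circle_by_parts F f G g : continuous f -> continuous g ->
  (forall x, is_derive x (1 : R) F (f x)) ->
  (forall x, is_derive x (1 : R) G (g x)) -> F 1 = F 0 -> G 1 = G 0 ->
  \int[mu]_x (F x * g x) = - \int[mu]_x (f x * G x).
Proof.
move=> cf cg dF dG F1 G1.
have cF := is_derive_continuous dF; have cG := is_derive_continuous dG.
rewrite !Rintegral_circle; first last.
- by move=> x; apply: cvgM; [exact: cF|exact: cg].
- by move=> x; apply: cvgM; [exact: cf|exact: cG].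
rewrite (@Rintegration_by_parts _ F G f g)//.
- by rewrite F1 G1 subrr sub0r.
- exact: continuous_subspaceT.
- exact: is_derive_LRcontinuous dF.
- by move=> x _; rewrite (is_derive1E dF).
- exact: continuous_subspaceT.
- exact: is_derive_LRcontinuous dG.
- by move=> x _; rewrite (is_derive1E dG).
Qed.

Lemma inner_cellf_FTC n (m : 'I_n.+1) F f : continuous f ->
  (forall x, is_derive x (1 : R) F (f x)) ->
  inner mu f (cellf n m) = F (m.+1%:R / n.+1%:R) - F (m%:R / n.+1%:R).
Proof.
move=> cf dF; have mf : measurable_fun setT f by exact: continuous_measurable_fun.
have mc := circleL2_measurable (@cellf_circleL2 R n m).
rewrite /inner Rintegral_mrestr; last exact: measurable_funM.
have -> : \int[leb]_(x in `[0%R, 1%R[) (f x * cellf n m x) =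
    \int[leb]_(x in cell n m) f x.
  rewrite -(setIidr (@sub_cell R n m)) Rintegral_mkcondr.
  by apply: eq_Rintegral => x _; rewrite patchE /cellf indicE;
    case: (_ \in _); rewrite ?mulr1 ?mulr0.
rewrite /cell Rintegral_itv_bndo_bndc; last exact: continuous_integrable_itv.
rewrite /Rintegral (@continuous_FTC2 _ f F)//.
- by rewrite ltr_pM2r ?invr_gt0// ltr_nat.
- exact: continuous_subspaceT.
- exact: is_derive_LRcontinuous dF.
- by move=> x _; rewrite (is_derive1E dF).
Qed.

End circle_calculus.

Section continuum_covariance.
Context {R : realType} (kappa : R).
Local Notation mu := (circle_measure R).
Local Notation kL := (scale_graph kappa (@scrL_graph R)).
Hypothesis kappa_gt0 : 0 < kappa.
Implicit Types s : seq (R * nat * R).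

Lemma weak_derivative_trigp s :
  weak_derivative (mkL2 (trigp s)) (mkL2 (trigp (trigp_deriv s))).
Proof.
move=> phi [dphi phi1].
have dphi0 (x : R) : is_derive x (1 : R) phi (phi^`()%classic x).
  by rewrite derive1E; exact/derivableP/(dphi 0%N x).
have dphi1 (x : R) : is_derive x (1 : R) (phi^`()%classic) ((phi^`()^`())%classic x).
  by rewrite [X in is_derive _ _ _ X]derive1E; exact/derivableP/(dphi 1%N x).
have int_mkL2 s' (g : R -> R) : continuous g ->
    \int[mu]_x (mkL2 (trigp s') x * g x) = \int[mu]_x (trigp s' x * g x).
  move=> cg; have mg : measurable_fun setT g by exact: continuous_measurable_fun.
  have ms := circleL2_measurable (trigp_circleL2 s').
  have mL := circleL2_measurable (L2fun_circleL2 (mkL2 (trigp s'))).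
  congr fine; apply: ae_eq_integral => //.
  - by apply/measurable_EFinP; exact: measurable_funM.
  - by apply/measurable_EFinP; exact: measurable_funM.
  - by apply: filterS (mkL2E (trigp_circleL2 s')) => x /= -> _.
have per0 f : (forall x, f (x + 1) = f x) -> f 1 = f 0 :> R.
  by move=> /(_ 0); rewrite add0r.
have cphi' := is_derive_continuous dphi1.
rewrite !int_mkL2//; last exact: is_derive_continuous dphi0.
apply: circle_by_parts => //.
- exact: continuous_trigp.
- exact: is_derive_trigp.
- by apply: per0; exact: trigpD1.
- exact: per0.
Qed.

(* [(kappa (- d^2/dt^2 + Id))^-1], mode by mode. *)
Definition trigp_resolvent s :=
  [seq (x.1.1 / (kappa * (1 + freq x.1.2 ^+ 2)), x.1.2, x.2) | x <- s].

Lemma trigp_resolventE s : trigp s = kappa *: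
  (trigp (trigp_resolvent s) - trigp (trigp_deriv (trigp_deriv (trigp_resolvent s)))).
Proof.
rewrite /trigp !big_map -sumrB scaler_sumr; apply: eq_bigr => x _ /=.
apply/funext => t; rewrite !fctE /tmode -addrA -splitr addrA cosDpi.
have eig0 : 1 + freq x.1.2 ^+ 2 != 0 :> R by rewrite gt_eqF// ltr_wpDr// sqr_ge0.
by rewrite /GRing.scale/=; field; rewrite eig0 gt_eqF.
Qed.

Lemma scale_graph_trigp s :
  kL (mkL2 (trigp (trigp_resolvent s))) (mkL2 (trigp s)).
Proof.
set r := trigp_resolvent s; have trigL := @trigp_circleL2 R.
have sL : kappa^-1 *: trigp s \in circleL2 by rewrite rpredZ.
exists (mkL2 (kappa^-1 *: trigp s)); last first.
  apply: filterS2 (mkL2E sL) (mkL2E (trigL s)) => t -> ->.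
  by rewrite scalrfctE [kappa * _]mulrA divff ?gt_eqF// mul1r.
exists (mkL2 (trigp (trigp_deriv r))), (mkL2 (trigp (trigp_deriv (trigp_deriv r)))).
split; [exact: weak_derivative_trigp|exact: weak_derivative_trigp|].
apply: filterS3 (mkL2E sL) (mkL2E (trigL (trigp_deriv (trigp_deriv r))))
  (mkL2E (trigL r)) => t -> -> ->.
by rewrite trigp_resolventE scalerA mulVf ?gt_eqF// scale1r addrC.
Qed.

Lemma inner_scale_graph_trigp (u g : L2circle R) s : kL u g ->
  inner mu u (trigp s) = inner mu g (trigp (trigp_resolvent s)).
Proof.
move=> [h [v [w [uv vw hE]]] gE]; set r := trigp_resolvent s.
have trigL := @trigp_circleL2 R; have L2L := @L2fun_circleL2 R.
have uv_r := uv _ (periodic_smooth_trigp (trigp_deriv r)).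
have vw_r := vw _ (periodic_smooth_trigp r).
rewrite derive1_trigp -!/(inner _ _ _) in uv_r.
rewrite derive1_trigp -!/(inner _ _ _) in vw_r.
have uw_r : inner mu u (trigp (trigp_deriv (trigp_deriv r))) = inner mu w (trigp r).
  by rewrite uv_r vw_r opprK.
have uwL : (u : R -> R) - (w : R -> R) \in circleL2 by rewrite rpredB.
rewrite trigp_resolventE innerC innerZl// ?rpredB// innerDl ?rpredN// innerNl//.
rewrite !(innerC mu _ u) uw_r -innerNl// -innerDl ?rpredN// -innerZl//.
apply: eq_inner_ae; rewrite ?rpredZ//.
by apply: filterS2 gE hE => t /= -> ->; rewrite !fctE addrC.
Qed.

Lemma inverse_operator_trigp s :
  L2dot (mkL2 (trigp s)) (inverse_operator kL (mkL2 (trigp s))) =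
  inner mu (trigp s) (trigp (trigp_resolvent s)).
Proof.
have trigL := @trigp_circleL2 R; set g := mkL2 (trigp s).
have u_g : kL (inverse_operator kL g) g.
  exact: getI (scale_graph_trigp s : [set u | kL u g] _).
have := inner_scale_graph_trigp s u_g; rewrite inner_mkL2l// => uE.
by rewrite -[LHS]/(inner _ _ _) inner_mkL2l ?L2fun_circleL2// innerC.
Qed.

End continuum_covariance.

Lemma sqr_sum_mul_le {R : rcfType} (I : Type) (r : seq I) (P : pred I)
    (x y : I -> R) :
  (\sum_(i <- r | P i) x i * y i) ^+ 2 <=
  (\sum_(i <- r | P i) x i ^+ 2) * (\sum_(i <- r | P i) y i ^+ 2).
Proof.
set a := \sum_(i <- r | P i) x i ^+ 2; set c := \sum_(i <- r | P i) y i ^+ 2.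
set b := \sum_(i <- r | P i) x i * y i; pose p := Poly [:: c; 2 * b; a].
suff : p`_1 ^+ 2 - 4 * p`_2 * p`_0 <= 0 by rewrite !coefE/=; nra.
rewrite deg_le2_poly_ge0 ?size_Poly// => t; rewrite horner_Poly/= mul0r add0r.
rewrite (_ : _ + c = \sum_(i <- r | P i) (t * x i + y i) ^+ 2).
  by apply: sumr_ge0 => i _; exact: sqr_ge0.
rewrite /a /b /c mulr_suml mulr_sumr -big_split/= mulr_suml -big_split/=.
by apply: eq_bigr => i _; ring.
Qed.

Section discrete_covariance.
Context {R : realType} (n : nat) (kappa : R).
Local Notation N := n.+1.
Local Notation L := (@discreteL R n).
Hypothesis kappa_gt0 : 0 < kappa.
Implicit Types a f w : 'cV[R]_N.

Let N_gt0 : 0 < N%:R :> R. Proof. by rewrite ltr0n. Qed.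

Lemma vec_dotC f w : vec_dot f w = vec_dot w f.
Proof. by apply: eq_bigr => i _; rewrite mulrC. Qed.

Lemma vec_dotDr f w w' : vec_dot f (w + w') = vec_dot f w + vec_dot f w'.
Proof. by rewrite -big_split; apply: eq_bigr => i _; rewrite mxE mulrDr. Qed.

Lemma vec_dotZr (c : R) f w : vec_dot f (c *: w) = c * vec_dot f w.
Proof. by rewrite /vec_dot mulr_sumr; apply: eq_bigr => i _; rewrite mxE mulrCA. Qed.

Lemma vec_dot_delta (i : 'I_N) f : vec_dot (delta_mx i 0) f = f i 0.
Proof.
rewrite /vec_dot (bigD1 i)//= mxE !eqxx mul1r big1 ?addr0// => j /negbTE ij.
by rewrite mxE ij mul0r.
Qed.

Lemma vec_dot_ge0 f : 0 <= vec_dot f f.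
Proof. by apply: sumr_ge0 => i _; rewrite -expr2 sqr_ge0. Qed.

Lemma vec_dot_cauchy f w : vec_dot f w ^+ 2 <= vec_dot f f * vec_dot w w.
Proof. exact: sqr_sum_mul_le. Qed.

Lemma discreteL_form_ge f : N%:R^-1 * vec_dot f f <= vec_dot f (L *m f).
Proof.
rewrite discreteL_form ler_wpM2l ?invr_ge0 ?(ltW N_gt0)//.
by apply: ler_sum => i _; rewrite -expr2 lerDl mulr_ge0// sqr_ge0.
Qed.

Lemma discreteL_form_gradient_ge f :
  N%:R * \sum_(i < N) (f (ordS i) 0 - f i 0) ^+ 2 <= vec_dot f (L *m f).
Proof.
rewrite discreteL_form big_split/= -mulr_sumr mulrDr mulrA.
have -> : N%:R^-1 * N%:R ^+ 2 = N%:R :> R.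
  by rewrite expr2 mulrA mulVf ?mul1r// gt_eqF.
rewrite lerDr mulr_ge0 ?invr_ge0 ?(ltW N_gt0)//.
by apply: sumr_ge0 => i _; exact: sqr_ge0.
Qed.

Lemma discreteL_unit : kappa *: L \in unitmx.
Proof.
rewrite unitmxE unitfE -det_tr; apply/negP => /det0P[v v0].
rewrite -[v]trmxK -trmx_mul => /(congr1 trmx); rewrite trmxK trmx0 -scalemxAl.
move=> /eqP; rewrite scaler_eq0 gt_eqF//= => /eqP Lv.
have := discreteL_form_ge v^T; rewrite Lv -(scale0r 0) vec_dotZr mul0r.
rewrite pmulr_rle0 ?invr_gt0// => vv0.
move/eqP: v0; apply; apply/rowP => i; rewrite mxE.
have /eqP : vec_dot v^T v^T = 0 by apply/eqP; rewrite eq_le vv0 vec_dot_ge0.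
rewrite psumr_eq0; last by move=> j _; rewrite -expr2 sqr_ge0.
by move=> /allP/(_ i (mem_index_enum _)); rewrite /= mxE mulf_eq0 orbb => /eqP.
Qed.

Definition discrete_inv a : 'cV[R]_N := invmx (kappa *: L) *m a.

Lemma discrete_inv_energy a : vec_dot a (discrete_inv a) =
  kappa * vec_dot (discrete_inv a) (L *m discrete_inv a).
Proof.
by rewrite -vec_dotZr vec_dotC scalemxAl /discrete_inv mulKVmx// discreteL_unit.
Qed.

Lemma discrete_inv_eigen a (c : R) : c != 0 -> L *m a = c *: a ->
  discrete_inv a = (kappa * c)^-1 *: a.
Proof.
move=> c0 La; apply: (can_inj (mulKmx discreteL_unit)).
rewrite /discrete_inv mulKVmx ?discreteL_unit// -scalemxAr -scalemxAl La !scalerA.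
by rewrite -mulrA mulVf ?scale1r// mulf_neq0// gt_eqF.
Qed.

(* The variance [<a, (kappa L)^-1 a>] as the best constant in an energy bound. *)
Lemma discrete_variance_le_energy a (c : R) : 0 <= c ->
  (forall w, vec_dot a w ^+ 2 <= c * (kappa * vec_dot w (L *m w))) ->
  vec_dot a (discrete_inv a) <= c.
Proof.
move=> c0 /(_ (discrete_inv a)); rewrite -discrete_inv_energy.
set v := vec_dot _ _ => vc; have [v0|v0] := leP v 0; first exact: le_trans c0.
by rewrite -(ler_pM2r v0) -expr2.
Qed.

Lemma discrete_variance_le_sqr a :
  vec_dot a (discrete_inv a) <= N%:R / kappa * vec_dot a a.
Proof.
apply: discrete_variance_le_energy => [|w].
  by rewrite mulr_ge0 ?vec_dot_ge0// divr_ge0// ltW.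
apply: le_trans (vec_dot_cauchy a w) _.
have -> : N%:R / kappa * vec_dot a a * (kappa * vec_dot w (L *m w)) =
    vec_dot a a * (N%:R * vec_dot w (L *m w)).
  by field; rewrite gt_eqF.
rewrite ler_wpM2l ?vec_dot_ge0// -ler_pdivrMl//; exact: discreteL_form_ge.
Qed.

Lemma sqr_increment_le_gradient (i j : 'I_N) w : (i <= j)%N ->
  (w j 0 - w i 0) ^+ 2 <=
  (j - i)%:R * \sum_(l < N) (w (ordS l) 0 - w l 0) ^+ 2.
Proof.
move=> ij; pose u (l : nat) : R := w (inord l) 0.
have uE (l : 'I_N) : u l = w l 0 by rewrite /u inord_val.
rewrite -!uE -(telescope_sumr u ij).
under eq_bigr do rewrite -[_ - _]mul1r.
apply: le_trans (sqr_sum_mul_le _ _ _ _) _.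
rewrite sumr_const_nat expr1n ler_wpM2l//.
rewrite [leRHS](_ : _ = \sum_(0 <= l < N) (w (ordS (inord l)) 0 - u l) ^+ 2).
  2: by rewrite big_mkord; apply: eq_bigr => l _; rewrite /u inord_val.
rewrite (@big_cat_nat _ _ _ i 0 N)//=; last by rewrite ltnW.
rewrite (@big_cat_nat _ _ _ j i N)//=; last by rewrite ltnW.
rewrite addrCA -[leLHS]addr0; apply: lerD; last first.
  by rewrite addr_ge0// sumr_ge0// => l _; exact: sqr_ge0.
rewrite le_eqVlt; apply/orP; left; apply/eqP; apply: eq_big_nat => l /andP[il lj].
congr ((w _ 0 - _) ^+ 2); apply: val_inj.
have lN : (l.+1 < N)%N by apply: leq_ltn_trans lj _.
by rewrite /= !inordK// ?modn_small// ltnW.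
Qed.

Lemma discrete_variance_increment (i j : 'I_N) : (i <= j)%N ->
  vec_dot (delta_mx j 0 - delta_mx i 0) (discrete_inv (delta_mx j 0 - delta_mx i 0))
    <= (j - i)%:R / (kappa * N%:R).
Proof.
move=> ij; apply: discrete_variance_le_energy => [|w].
  by rewrite divr_ge0// mulr_ge0 ?ltW.
rewrite vec_dotC vec_dotDr -scaleN1r vec_dotZr mulN1r.
rewrite !(vec_dotC w (delta_mx _ _)) !vec_dot_delta.
apply: le_trans (sqr_increment_le_gradient w ij) _.
have -> : (j - i)%:R / (kappa * N%:R) * (kappa * vec_dot w (L *m w)) =
    (j - i)%:R * (N%:R^-1 * vec_dot w (L *m w)).
  by field; rewrite !gt_eqF.
by rewrite ler_wpM2l// ler_pdivlMl// discreteL_form_gradient_ge.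
Qed.

End discrete_covariance.

Section cell_integrals.
Context {R : realType} (n : nat).
Local Notation mu := (circle_measure R).
Local Notation N := n.+1.
Implicit Types (f g : R -> R) (k : nat) (b : R).

Definition cell_ints f : 'cV[R]_N := \col_i inner mu f (cellf n i).

Definition cell_mid (m : nat) : R := (m%:R + 2^-1) / N%:R.

Definition discrete_eigenvalue k : R := N%:R^-1 *
  (1 + N%:R ^+ 2 * (2 - 2 * cos (freq k / N%:R))).

Lemma discrete_eigenvalue_gt0 k : 0 < discrete_eigenvalue k.
Proof.
by rewrite mulr_gt0 ?invr_gt0 ?ltr0n// ltr_wpDr// mulr_ge0 ?sqr_ge0// subr_ge0
  ler_piMr ?cos_le1.
Qed.

Lemma cell_ints_tmode k b : exists c : R,
  cell_ints (tmode k b) = \col_i (c * tmode k b (cell_mid i)).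
Proof.
have cont := @continuous_tmode R k b; have [->|k0] := posnP k.
  exists N%:R^-1; apply/matrixP => i j; rewrite !mxE.
  have dF (x : R) : is_derive x (1 : R) (fun x => cos b * x + 0) (tmode 0 b x).
    by rewrite /tmode /freq !mul0r add0r; exact: is_derive_affine.
  rewrite (inner_cellf_FTC i (@continuous_tmode R 0 b) dF) !addr0.
  by rewrite -mulrBr -mulrBl -natrB// subSnn mul1r mulrC /tmode /freq !mul0r add0r.
have w0 : freq k != 0 :> R.
  by rewrite gt_eqF// mulr_gt0 ?ltr0n// mulrn_wgt0// pi_gt0.
set w : R := freq k; pose F x := w^-1 * sin (w * x + b).
have dF (x : R) : is_derive x (1 : R) F (tmode k b x).
  have -> : tmode k b x = w^-1 * (cos (w * x + b) * w).
    by rewrite mulrCA mulVf// mulr1.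
  apply: is_deriveZ; apply: (@is_derive1_comp _ sin (fun x => w * x + b)).
  exact: is_derive_affine.
exists (w^-1 * (2 * sin (w / (2 * N%:R)))); apply/matrixP => i j; rewrite !mxE.
rewrite (inner_cellf_FTC i cont dF) /F -mulrBr -[RHS]mulrA; congr (_ * _).
rewrite /tmode -/w; set y := w * cell_mid i + b; set d := w / (2 * N%:R).
have -> : w * (i.+1%:R / N%:R) + b = y + d.
  by rewrite /y /d /cell_mid -[i.+1%:R]natr1; field.
have -> : w * (i%:R / N%:R) + b = y - d.
  by rewrite /y /d /cell_mid; field.
by rewrite (sinD y d) (sinB y d); ring.
Qed.

Lemma tmode_cell_mid_mod k b m : tmode k b (cell_mid (m %% N)) = tmode k b (cell_mid m).
Proof.
rewrite -(tmodeD1n k b _ (m %/ N)); congr tmode.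
by rewrite /cell_mid [in RHS](divn_eq m N) natrD natrM; field.
Qed.

Lemma tmode_second_difference k b t h :
  tmode k b (t + h) + tmode k b (t - h) = 2 * cos (freq k * h) * tmode k b t.
Proof.
rewrite /tmode mulrDr mulrBr addrAC [in X in _ + X]addrAC.
by rewrite (cosD (_ * t + b)) (cosB (_ * t + b)); ring.
Qed.

Lemma discreteL_cell_ints_tmode k b : @discreteL R n *m cell_ints (tmode k b) =
  discrete_eigenvalue k *: cell_ints (tmode k b).
Proof.
have [c ->] := cell_ints_tmode k b; apply/matrixP => i j.
rewrite ord1 discreteLE !mxE /= !tmode_cell_mid_mod.
have -> : cell_mid i.+1 = cell_mid i + N%:R^-1.
  by rewrite /cell_mid -natr1; field.
have -> : tmode k b (cell_mid (i + N).-1) = tmode k b (cell_mid i - N%:R^-1).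
  rewrite addnS/= -(tmodeD1n k b (_ - _) 1); congr tmode.
  by rewrite /cell_mid natrD -(natr1 n); field; rewrite natr1.
have := tmode_second_difference k b (cell_mid i) N%:R^-1.
move=> /eqP; rewrite -subr_eq0 => /eqP diff.
rewrite /discrete_eigenvalue; apply/eqP; rewrite -subr_eq0; apply/eqP.
move: diff; move: (tmode k b (_ + _)) (tmode k b (_ - _)) => A B diff.
rewrite (_ : A = 2 * cos (freq k * N%:R^-1) * tmode k b (cell_mid i) - B); first by field.
by apply/eqP; rewrite -subr_eq0 opprB addrA diff.
Qed.

Lemma vec_dot_cell_ints f g : f \in circleL2 ->
  vec_dot (cell_ints f) (cell_ints g) = N%:R^-1 * inner mu f (cell_proj n g).
Proof.
move=> fL; rewrite innerC inner_stepfl// mulr_sumr; apply: eq_bigr => i _.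
by rewrite !mxE /cell_avg (innerC mu f) !mulrA mulVf// mul1r mulrC.
Qed.

End cell_integrals.

Section discrete_variance.
Context {R : realType} (kappa : R).
Local Notation mu := (circle_measure R).
Hypothesis kappa_gt0 : 0 < kappa.
Implicit Types (f : R -> R) (s : seq (R * nat * R)).

Definition discrete_variance n f : R :=
  vec_dot (cell_ints n f) (discrete_inv kappa (cell_ints n f)).

Lemma discrete_variance_le n f : f \in circleL2 ->
  discrete_variance n f <= norm2 mu f ^+ 2 / kappa.
Proof.
move=> fL; apply: le_trans (discrete_variance_le_sqr kappa_gt0 _) _.
rewrite vec_dot_cell_ints// mulrACA divff ?pnatr_eq0// mul1r mulrC.
by rewrite ler_wpM2r ?invr_ge0 ?(ltW kappa_gt0)// inner_cell_proj_le.
Qed.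

Lemma vec_dot_discrete_inv_trigp n f s : f \in circleL2 ->
  vec_dot (cell_ints n f) (discrete_inv kappa (cell_ints n (trigp s))) =
  \sum_(x <- s) x.1.1 / (kappa * (n.+1%:R * discrete_eigenvalue n x.1.2)) *
    inner mu f (cell_proj n (tmode x.1.2 x.2)).
Proof.
move=> fL; have tL := @tmode_circleL2 R; elim: s => [|x s IH].
  rewrite big_nil trigp_nil (_ : cell_ints n 0 = 0); last first.
    by apply/colP => i; rewrite !mxE inner0l.
  by rewrite /discrete_inv mulmx0 -(scale0r 0) vec_dotZr mul0r.
rewrite big_cons -IH trigp_cons.
have -> : cell_ints n (x.1.1 *: tmode x.1.2 x.2 + trigp s) =
    x.1.1 *: cell_ints n (tmode x.1.2 x.2) + cell_ints n (trigp s).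
  apply/colP => i; rewrite !mxE innerDl ?innerZl ?rpredZ ?cellf_circleL2//.
  exact: trigp_circleL2.
rewrite /discrete_inv mulmxDr -scalemxAr vec_dotDr vec_dotZr; congr (_ + _).
have la0 := discrete_eigenvalue_gt0 (R := R) n x.1.2.
rewrite -/(discrete_inv _ _) (discrete_inv_eigen kappa_gt0 _
  (discreteL_cell_ints_tmode n _ _)) ?gt_eqF//.
rewrite vec_dotZr vec_dot_cell_ints//; field.
by rewrite !gt_eqF// ltr_wpDl.
Qed.

Lemma cvg_scaled_eigenvalue k :
  n.+1%:R * discrete_eigenvalue n k @[n --> \oo] --> 1 + (freq k : R) ^+ 2.
Proof.
set w : R := freq k; pose r (n : nat) : R := 2 * n.+1%:R * sin (w / 2 / n.+1%:R).
have -> : (fun n => n.+1%:R * discrete_eigenvalue n k) = (fun n => 1 + r n ^+ 2).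
  apply/funext => n; rewrite /discrete_eigenvalue mulrA divff ?pnatr_eq0// mul1r.
  rewrite -/w /r; congr (1 + _).
  have -> : w / n.+1%:R = (w / 2 / n.+1%:R) *+ 2.
    by rewrite -mulr_natr; field; rewrite addrC natr1 pnatr_eq0.
  by rewrite cos_mulr2n cos2sin2; ring.
apply: cvgD; first exact: cvg_cst.
suff rw : r n @[n --> \oo] --> w by rewrite expr2; exact: cvgM.
apply/subr_cvg0; apply: squeeze0_cvgr (cvg0_natV_mul (w ^+ 2 / 2)) => n.
have N0 : (0 : R) < n.+1%:R by rewrite ltr0n.
have -> : r n - w = 2 * n.+1%:R * (sin (w / 2 / n.+1%:R) - w / 2 / n.+1%:R).
  by rewrite /r; field; rewrite addrC natr1 gt_eqF.
rewrite normrM ger0_norm ?mulr_ge0 ?(ltW N0)//.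
rewrite (_ : w ^+ 2 / 2 * n.+1%:R^-1 = 2 * n.+1%:R * (w / 2 / n.+1%:R) ^+ 2).
  by rewrite ler_wpM2l ?ler_norm_sin_sub// mulr_ge0// ltW.
by field; rewrite addrC natr1 gt_eqF.
Qed.

Lemma cvg_discrete_variance_trigp s :
  discrete_variance n (trigp s) @[n --> \oo] -->
  inner mu (trigp s) (trigp (trigp_resolvent kappa s)).
Proof.
have tL := @tmode_circleL2 R; have sL := trigp_circleL2 s.
rewrite innerC /trigp_resolvent /trigp inner_suml//; last first.
  by move=> x; rewrite rpredZ.
rewrite big_map -/(trigp s); under eq_fun do rewrite /discrete_variance
  vec_dot_discrete_inv_trigp//.
apply: (@cvg_big _ _ +%R) => [|x _]; first exact: add_continuous.
rewrite innerZl// innerC; apply: cvgM; last exact: cvg_inner_cell_proj.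
apply: cvgM; first exact: cvg_cst.
apply: cvgV; first by rewrite mulf_neq0// gt_eqF// ltr_wpDr// sqr_ge0.
by apply: cvgMl_tmp; exact: cvg_scaled_eigenvalue.
Qed.

End discrete_variance.

(** * Weak convergence *)

Section lipschitz_functions.
Context {R : realType} (T : metricType R).
Implicit Types (x y z : T) (k : nat).

Lemma lipschitz_continuous (g : T -> R) (C : R) :
  (forall x y, `|g x - g y| <= C * mdist x y) -> continuous g.
Proof.
move=> g_lip x; apply/cvgrPdist_lt => e e0.
have C0 : 0 < `|C| + 1 by rewrite ltr_wpDl.
apply/nbhs_ballP; exists (e / (`|C| + 1)) => /=; first by rewrite divr_gt0.
move=> y; rewrite ballEmdist/= => xy; apply: le_lt_trans (g_lip x y) _.
apply: (@le_lt_trans _ _ ((`|C| + 1) * mdist x y)).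
  by rewrite ler_wpM2r ?mdist_ge0//; have := ler_norm C; lra.
by rewrite mulrC -ltr_pdivlMr.
Qed.

Variables (phi : T -> R) (B : R).
Hypothesis phi_bound : forall x, `|phi x| <= B.

Definition inf_conv k x : R := inf [set phi y + k%:R * mdist x y | y in [set: T]].

Lemma inf_conv_le k x y : inf_conv k x <= phi y + k%:R * mdist x y.
Proof.
apply: ge_inf; last by exists y.
exists (- B) => _ [z _ <-]; have := phi_bound z; rewrite ler_norml => /andP[? _].
by apply: ler_wpDr => //; rewrite mulr_ge0// mdist_ge0.
Qed.

Lemma le_inf_conv k x c : (forall y, c <= phi y + k%:R * mdist x y) ->
  c <= inf_conv k x.
Proof.
move=> h; apply: lb_le_inf; first by exists (phi x + k%:R * mdist x x), x.
by move=> _ [y _ <-].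
Qed.

Lemma inf_conv_le_id k x : inf_conv k x <= phi x.
Proof. by have := inf_conv_le k x x; rewrite mdistxx mulr0 addr0. Qed.

Lemma ler_norm_inf_conv k x : `|inf_conv k x| <= B.
Proof.
have lB y : - B <= phi y by have := phi_bound y; rewrite ler_norml => /andP[].
rewrite ler_norml le_inf_conv => [|y]; last by rewrite ler_wpDr ?mulr_ge0 ?mdist_ge0.
apply: le_trans (inf_conv_le_id k x) _; exact: le_trans (ler_norm _) (phi_bound x).
Qed.

Lemma inf_conv_lipschitz k x y : `|inf_conv k x - inf_conv k y| <= k%:R * mdist x y.
Proof.
have inf_conv_shift u v : inf_conv k u - k%:R * mdist u v <= inf_conv k v.
  apply: le_inf_conv => z; rewrite lerBlDr -addrA -mulrDr.
  apply: le_trans (inf_conv_le k u z) _; rewrite lerD2l ler_wpM2l//.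
  by rewrite addrC; exact: metric_triangle.
have := inf_conv_shift x y; have := inf_conv_shift y x.
rewrite (metric_sym y x) ler_norml => ? ?.
by apply/andP; split; lra.
Qed.

Lemma cvg_inf_conv x : continuous phi -> inf_conv k x @[k --> \oo] --> phi x.
Proof.
move=> cphi; apply/cvgrPdist_le => e e0.
have /cvgrPdist_lt/(_ _ e0)/nbhs_ballP[d /= d0 dphi] := cphi x; near=> k.
rewrite ger0_norm ?subr_ge0 ?inf_conv_le_id// lerBlDl -lerBlDr.
apply: le_inf_conv => y; have [xyd|xyd] := ltP (mdist x y) d.
  have := dphi y; rewrite ballEmdist /= => /(_ xyd)/ltW.
  have := mulr_ge0 (ler0n R k) (mdist_ge0 x y).
  by have := ler_norm (phi x - phi y); lra.
have kd : 2 * B <= k%:R * mdist x y.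
  apply: (@le_trans _ _ (k%:R * d)); last by rewrite ler_wpM2l.
  by rewrite -ler_pdivrMr//; near: k; exact: nbhs_infty_ger.
have := phi_bound y; have := phi_bound x; rewrite !ler_norml.
by move=> /andP[? ?] /andP[? ?]; lra.
Unshelve. all: by end_near.
Qed.

End lipschitz_functions.

Lemma continuous_measurable_borel {R : realType} {T : ptopologicalType}
  (f : T -> R) : continuous f -> measurable_fun [set: borel T] f.
Proof.
move=> /continuousP cf; apply: (measurability _ (RGenOpens.measurableE R)).
move=> _ [_ [a [b ->] <-]]; rewrite setTI.
by apply: sub_sigma_algebra; exact/cf/interval_open.
Qed.

Lemma continuous_bounded_measurable_borel {R : realType} {T : ptopologicalType}
    (f : T -> R) (B : R) : continuous f -> (forall x, `|f x| <= B) ->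
  bounded_measurable (f : borel T -> R).
Proof. by move=> cf fB; split; [exact: continuous_measurable_borel|exists B]. Qed.

Section lipschitz_test_functions.
Context {R : realType}.
Local Notation L2 := (L2circle R).
Variables (P_ : nat -> probability (borel L2) R) (P : probability (borel L2) R).
Hypothesis lipschitz_cvg : forall (phi : L2 -> R) (C B : R), 0 <= C ->
  (forall x y, `|phi x - phi y| <= C * L2dist x y) -> (forall x, `|phi x| <= B) ->
  \int[P_ n]_x phi x @[n --> \oo] --> \int[P]_x phi x.

Lemma near_ge_Rintegral (phi : L2 -> R) (B e : R) : continuous phi ->
  (forall x, `|phi x| <= B) -> 0 < e ->
  \forall n \near \oo, \int[P]_x phi x - e <= \int[P_ n]_x phi x.
Proof.
move=> cphi phiB e0; have e20 : 0 < e / 2 by rewrite divr_gt0.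
have bphi := continuous_bounded_measurable_borel cphi phiB.
have breg k : bounded_measurable (inf_conv phi k : borel L2 -> R).
  apply: continuous_bounded_measurable_borel (ler_norm_inf_conv phiB k).
  exact: lipschitz_continuous (inf_conv_lipschitz phiB k).
have : \int[P]_x inf_conv phi k x @[k --> \oo] --> \int[P]_x phi x.
  apply: (bounded_cvg_Rintegral (probability_lty P) (M := B)).
  - by move=> k; exact: (breg k).1.
  - exact: bphi.1.
  - by move=> k x; exact: ler_norm_inf_conv.
  - by apply: aeW => x; exact: cvg_inf_conv phiB _ cphi.
move=> /cvgrPdist_le/(_ _ e20)[k _ /(_ k (leqnn k))] phi_k.
have := lipschitz_cvg (ler0n _ k) (inf_conv_lipschitz phiB k) (ler_norm_inf_conv phiB k).
move=> /cvgrPdist_le/(_ _ e20); apply: filterS => n reg_n.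
have : \int[P_ n]_x inf_conv phi k x <= \int[P_ n]_x phi x.
  apply: le_Rintegral => //.
  1,2: exact: (bounded_measurable_integrable (probability_lty _)).
  by move=> x _; exact: inf_conv_le_id.
move: phi_k reg_n; rewrite /= !ler_norml => /andP[? ?] /andP[? ?] ?; lra.
Qed.

Lemma weakly_converges_lipschitz : weakly_converges P_ P.
Proof.
move=> phi cphi [M0 [_ phiM0]]; pose B := `|M0| + 1.
have phiB x : `|phi x| <= B.
  by apply: (phiM0 B) => //; rewrite /B; have := ler_norm M0; lra.
have cN : continuous (\- phi) by move=> x; exact: cvgN (cphi x).
have NB x : `|- phi x| <= B by rewrite normrN.
have bphi := continuous_bounded_measurable_borel cphi phiB.
have intN (p : probability (borel L2) R) : \int[p]_x (- phi x) = - \int[p]_x phi x.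
  under eq_Rintegral do rewrite -mulN1r.
  rewrite RintegralZl ?mulN1r//.
  exact: (bounded_measurable_integrable (probability_lty _)).
apply/cvgrPdist_le => e e0.
have ge_phi := near_ge_Rintegral cphi phiB e0.
have ge_Nphi := near_ge_Rintegral cN NB e0.
near=> n; have : \int[P]_x phi x - e <= \int[P_ n]_x phi x by near: n.
have : \int[P]_x (- phi x) - e <= \int[P_ n]_x (- phi x) by near: n.
by rewrite !intN ler_norml => ? ?; apply/andP; split; lra.
Unshelve. all: by end_near.
Qed.

End lipschitz_test_functions.

Section cosine_test_functions.
Context {R : realType} d (T : measurableType d).
Variables (P_ : nat -> probability T R) (P : probability T R).
Variable V : set (T -> R).
Hypothesis V0 : V 0.
Hypothesis VD : forall X Y, V X -> V Y -> V (X + Y).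
Hypothesis VZ : forall c X, V X -> V (c *: X).
Hypothesis measurable_V : forall X, V X -> measurable_fun setT X.
Hypothesis moment2_V : forall X, V X -> exists v : R,
  (forall n, (\int[P_ n]_t (X t ^+ 2)%:E <= v%:E)%E) /\
  (\int[P]_t (X t ^+ 2)%:E <= v%:E)%E.
Hypothesis cvg_cos_V : forall X b, V X ->
  \int[P_ n]_t cos (X t + b) @[n --> \oo] --> \int[P]_t cos (X t + b).
Implicit Types (f g X : T -> R) (b : R).

Let bounded_integrable (p : probability T R) f : bounded_measurable f ->
  p.-integrable setT (EFin \o f).
Proof. exact: (bounded_measurable_integrable (probability_lty p)). Qed.

Let bounded_cos X b : V X -> bounded_measurable (fun t => cos (X t + b)).
Proof. by move=> VX; exact/bounded_measurable_cos/measurable_V. Qed.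

(* Testing against all cosines makes this class stable under products with
   cosines, which convergence of the expectations of [g] alone is not. *)
Definition cos_stable g :=
  bounded_measurable g /\ forall X b, V X ->
    \int[P_ n]_t (g t * cos (X t + b)) @[n --> \oo] -->
    \int[P]_t (g t * cos (X t + b)).

Lemma cvg_cos_stable g : cos_stable g ->
  \int[P_ n]_t g t @[n --> \oo] --> \int[P]_t g t.
Proof.
move=> [_ /(_ 0 0 V0)].
have E (p : probability T R) :
    \int[p]_t (g t * cos ((0 : T -> R) t + 0)) = \int[p]_t g t.
  by apply: eq_Rintegral => t _; rewrite addr0 cos0 mulr1.
by under eq_fun do rewrite E; rewrite E.
Qed.

Lemma cos_stable_cst (c : R) : cos_stable (cst c).
Proof.
split=> [|X b VX]; first exact: bounded_measurable_cst.
have E (p : probability T R) :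
    \int[p]_t (c * cos (X t + b)) = c * \int[p]_t cos (X t + b).
  by rewrite RintegralZl//; exact: bounded_integrable (bounded_cos _ VX).
by under eq_fun do rewrite E; rewrite E; apply: cvgMl_tmp; exact: cvg_cos_V.
Qed.

Lemma cos_stableD f g : cos_stable f -> cos_stable g -> cos_stable (f + g).
Proof.
move=> [bf cf] [bg cg]; split=> [|X b VX]; first exact: bounded_measurableD.
have bcos := bounded_cos b VX.
have E (p : probability T R) : \int[p]_t ((f + g) t * cos (X t + b)) =
    \int[p]_t (f t * cos (X t + b)) + \int[p]_t (g t * cos (X t + b)).
  rewrite -RintegralD//; [|exact: bounded_integrable (bounded_measurableM _ _)..].
  by apply: eq_Rintegral => t _; rewrite mulrDl.
by under eq_fun do rewrite E; rewrite E; apply: cvgD; [exact: cf|exact: cg].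
Qed.

Lemma cos_stableZ c f : cos_stable f -> cos_stable (c *: f).
Proof.
move=> [bf cf]; split=> [|X b VX]; first exact: bounded_measurableZ.
have bcos := bounded_cos b VX.
have E (p : probability T R) : \int[p]_t ((c *: f) t * cos (X t + b)) =
    c * \int[p]_t (f t * cos (X t + b)).
  rewrite -RintegralZl//; last exact: bounded_integrable (bounded_measurableM _ _).
  by apply: eq_Rintegral => t _; rewrite [RHS]mulrA.
by under eq_fun do rewrite E; rewrite E; apply: cvgMl_tmp; exact: cf.
Qed.

Lemma cos_stable_cosM f X b : V X -> cos_stable f ->
  cos_stable (fun t => f t * cos (X t + b)).
Proof.
move=> VX [bf cf]; split=> [|Y b' VY].
  exact: bounded_measurableM bf (bounded_cos b VX).
have VXY : V (X + Y) by exact: VD.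
have VXNY : V (X + -1 *: Y) by apply: VD => //; exact: VZ.
have E (p : probability T R) :
    \int[p]_t (f t * cos (X t + b) * cos (Y t + b')) =
    2^-1 * \int[p]_t (f t * cos ((X + Y) t + (b + b'))) +
    2^-1 * \int[p]_t (f t * cos ((X + -1 *: Y) t + (b - b'))).
  have bp := bounded_measurableM bf (bounded_cos (b + b') VXY).
  have bm := bounded_measurableM bf (bounded_cos (b - b') VXNY).
  rewrite -!RintegralZl//; [|exact: bounded_integrable..].
  rewrite -RintegralD//; [|exact: bounded_integrable (bounded_measurableZ 2^-1 _)..].
  apply: eq_Rintegral => t _; rewrite !fctE [_ *: _]mulN1r.
  rewrite (_ : X t + Y t + (b + b') = (X t + b) + (Y t + b')); last by ring.
  rewrite (_ : X t - Y t + (b - b') = (X t + b) - (Y t + b')); last by ring.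
  by rewrite (cosD (X t + b)) (cosB (X t + b)); field.
under eq_fun do rewrite E; rewrite E.
by apply: cvgD; apply: cvgMl_tmp; exact: cf.
Qed.

Lemma cos_stable_bernstein m (F : nat -> T -> R) X b y : V X ->
  (forall j, cos_stable (F j)) ->
  cos_stable (fun t => bernstein m (F^~ t) ((1 + cos (X t + b)) / 2) y).
Proof.
move=> VX cF; elim: m y => [|m IH] y /=; first exact: cF.
set G := fun y t => bernstein m (F^~ t) ((1 + cos (X t + b)) / 2) y.
have Gcos y' : cos_stable (fun t => G y' t * cos (X t + b)).
  by apply: cos_stable_cosM => //; exact: IH.
rewrite [X in cos_stable X](_ : _ =
    (2^-1 *: G y.+1 + 2^-1 *: (fun t => G y.+1 t * cos (X t + b))) +
    (2^-1 *: G y + - 2^-1 *: (fun t => G y t * cos (X t + b)))).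
  by apply: cos_stableD; apply: cos_stableD; apply: cos_stableZ; try exact: Gcos;
    exact: IH.
by apply/funext => t; rewrite !fctE /GRing.scale/= -!/(G _ _); field.
Qed.

Lemma cos_stable_closed (g_ : nat -> T -> R) g (a : nat -> R) :
  bounded_measurable g -> (forall k, cos_stable (g_ k)) ->
  a k @[k --> \oo] --> (0 : R) ->
  (forall k n, (\int[P_ n]_t `|g t - g_ k t|%:E <= (a k)%:E)%E) ->
  (forall k, (\int[P]_t `|g t - g_ k t|%:E <= (a k)%:E)%E) ->
  cos_stable g.
Proof.
move=> bg cg_ a0 a_ aP; split=> // X b VX; have bcos := bounded_cos b VX.
have dist (p : probability T R) k :
    (\int[p]_t `|g t - g_ k t|%:E <= (a k)%:E)%E ->
    `|\int[p]_t (g t * cos (X t + b)) - \int[p]_t (g_ k t * cos (X t + b))| <= a k.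
  have bgk := (cg_ k).1.
  move=> pa; apply: le_dist_Rintegral; [|exact: bounded_measurableM..|].
    exact: probability_lty.
  apply: le_trans pa; apply: ge0_le_integral => //.
  - apply/measurable_EFinP; apply: measurableT_comp => //.
    exact: (bounded_measurableB (bounded_measurableM bg bcos)
      (bounded_measurableM bgk bcos)).1.
  - apply/measurable_EFinP; apply: measurableT_comp => //.
    exact: (bounded_measurableB bg bgk).1.
  - by move=> t _; rewrite lee_fin -mulrBl normrM ler_piMr// cos_max.
apply: (cvg_of_approx (fun k => (cg_ k).2 X b VX) _ a0 (cvg_cst 0)) => [|k n].
  by apply/subr_cvg0; apply: squeeze0_cvgr a0 => k; rewrite distrC dist.
by rewrite addr0 dist.
Qed.

Section one_coordinate.
Variables (G : R -> T -> R) (X : T -> R) (C B : R).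
Hypothesis VX : V X.
Hypothesis C_ge0 : 0 <= C.
Hypothesis G_stable : forall y, cos_stable (G y).
Hypothesis G_lip : forall y z t, `|G y t - G z t| <= C * `|y - z|.
Hypothesis G_bound : forall y t, `|G y t| <= B.

(* The approximants are Bernstein polynomials in the sine of a large fraction of
   [X], and [sin x = cos (x - pi / 2)]. *)
Let sin_bernstein_approx : exists2 g_ : nat -> T -> R,
  forall k, cos_stable (g_ k) &
  forall k t, `|G (X t) t - g_ k t| <= C * (X t ^+ 2 + 2) * k.+1%:R^-1.
Proof.
exists (fun k t =>
  sin_bernstein (G^~ t) k.+1 (cos ((k.+1%:R^-1 *: X) t + - (pi / 2)))) => [k|k t].
  rewrite /sin_bernstein; move: ((_ ^ 2) ^ 2)%N => m.
  by apply: cos_stable_bernstein => //; exact: VZ.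
rewrite cosBpihalf (_ : (_ *: X) t = X t / k.+1%:R); last exact: mulrC.
by apply: sin_bernstein_dist.
Qed.

Lemma bounded_measurable_diagonal : bounded_measurable (fun t => G (X t) t).
Proof.
have [g_ g_stable g_dist] := sin_bernstein_approx.
split; last by exists B => t; exact: G_bound.
apply: (measurable_fun_cvg (h := g_)) => [k|t _]; first exact: (g_stable k).1.1.
apply/subr_cvg0; apply: squeeze0_cvgr (cvg0_natV_mul (C * (X t ^+ 2 + 2))) => k.
by rewrite distrC g_dist.
Qed.

Lemma cos_stable_diagonal : cos_stable (fun t => G (X t) t).
Proof.
have [g_ g_stable g_dist] := sin_bernstein_approx.
have [v [v_ vP]] := moment2_V VX.
have mX := measurable_V VX; have bG := bounded_measurable_diagonal.
have dist (p : probability T R) k : (\int[p]_t (X t ^+ 2)%:E <= v%:E)%E ->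
    (\int[p]_t `|G (X t) t - g_ k t|%:E <= (C * (v + 2) * k.+1%:R^-1)%:E)%E.
  move=> pv; have Ck : 0 <= C * k.+1%:R^-1 by rewrite mulr_ge0.
  have -> : C * (v + 2) * k.+1%:R^-1 = C * k.+1%:R^-1 * v + C * k.+1%:R^-1 * 2.
    by ring.
  apply: (integral_norm_le_affine (g := fun t => X t ^+ 2)) => //.
  - exact: (bounded_measurableB bG (g_stable k).1).1.
  - exact: measurable_funX.
  - by move=> t; exact: sqr_ge0.
  - by rewrite mulr_ge0.
  - by move=> t; apply: le_trans (g_dist k t) _; rewrite -mulrDr mulrAC.
apply: (cos_stable_closed bG g_stable (cvg0_natV_mul (C * (v + 2)))).
- by move=> k n; exact: dist.
- by move=> k; exact: dist.
Qed.

End one_coordinate.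

(* One coordinate at a time: the first [j] arguments of [Phi] are random. *)
Lemma cos_stable_lipschitz (K : nat) (Phi : ('I_K -> R) -> R) (X : 'I_K -> T -> R)
    (C B : R) : (forall i, V (X i)) -> 0 <= C ->
  (forall c c', `|Phi c - Phi c'| <= C * \sum_(i < K) `|c i - c' i|) ->
  (forall c, `|Phi c| <= B) ->
  cos_stable (fun t => Phi (X^~ t)).
Proof.
move=> VX C0 Phi_lip Phi_bound.
pose mix j (c : 'I_K -> R) t (i : 'I_K) := if (i < j)%N then X i t else c i.
suff mix_stable j : (j <= K)%N -> forall c, cos_stable (fun t => Phi (mix j c t)).
  have := mix_stable K (leqnn K) (fun=> 0); congr cos_stable.
  by apply/funext => t; congr Phi; apply/funext => i; rewrite /mix ltn_ord.
elim: j => [|j IH] jK c; first exact: (cos_stable_cst (Phi c)).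
pose upd y (i : 'I_K) := if i == Ordinal jK then y else c i.
rewrite (_ : (fun t => Phi _) = fun t => Phi (mix j (upd (X (Ordinal jK) t)) t)).
  pose G y t := Phi (mix j (upd y) t).
  apply: (@cos_stable_diagonal G _ C B) => // [y|y z t|y t]; last exact: Phi_bound.
    exact/IH/ltnW.
  apply: le_trans (Phi_lip _ _) _; rewrite ler_wpM2l// (bigD1 (Ordinal jK))//= big1.
    by rewrite addr0 /mix /upd /= ltnn eqxx.
  by move=> i /negbTE ij; rewrite /mix /upd ij subrr normr0.
apply/funext => t; congr Phi; apply/funext => i.
rewrite /mix /upd -val_eqE/= ltnS.
have [ij|ij] := eqVneq (val i) j; last by rewrite leq_eqVlt (negbTE ij).
by rewrite ij leqnn ltnn; congr X; exact: val_inj.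
Qed.

End cosine_test_functions.

Section L2_functionals.
Context {R : realType}.
Local Notation mu := (circle_measure R).
Local Notation L2 := (L2circle R).
Implicit Types (h : R -> R) (x y : L2).

Lemma ler_dist_inner_L2 h x y : h \in circleL2 ->
  `|inner mu h x - inner mu h y| <= norm2 mu h * L2dist x y.
Proof.
move=> hL; have L2L := @L2fun_circleL2 R.
rewrite !(innerC mu h) -innerNl// -innerDl ?rpredN// mulrC L2distE_norm2.
by apply: ler_norm_inner => //; rewrite rpredB.
Qed.

Lemma continuous_inner_L2 h : h \in circleL2 ->
  continuous (fun x : L2 => inner mu h x).
Proof.
by move=> hL; apply: (@lipschitz_continuous _ _ _ (norm2 mu h)) => x y;
  exact: ler_dist_inner_L2.
Qed.

Lemma measurable_inner_L2 h : h \in circleL2 ->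
  measurable_fun [set: borel L2] (fun x : L2 => inner mu h x).
Proof. by move=> hL; apply: continuous_measurable_borel; exact: continuous_inner_L2. Qed.

Lemma ler_dist_proj_error n x y :
  `|proj_error n x - proj_error n y| <= 1 * L2dist x y.
Proof.
have L2L := @L2fun_circleL2 R.
have := ler_proj_errorD n (L2L x) (L2L y); have := ler_proj_errorD n (L2L y) (L2L x).
rewrite -!L2distE_norm2 (L2dist_sym y x) mul1r ler_norml => ? ?.
by apply/andP; split; lra.
Qed.

Lemma measurable_proj_error n :
  measurable_fun [set: borel L2] (fun x : L2 => proj_error n x).
Proof.
apply: continuous_measurable_borel.
exact: (@lipschitz_continuous _ _ _ 1) (ler_dist_proj_error n).
Qed.

End L2_functionals.

Section weak_convergence_criterion.
Context {R : realType}.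
Local Notation mu := (circle_measure R).
Local Notation L2 := (L2circle R).
Variables (P_ : nat -> probability (borel L2) R) (P : probability (borel L2) R).
Variable c0 : R.
Hypothesis c0_ge0 : 0 <= c0.
Hypothesis moment2_ : forall n h, h \in circleL2 ->
  (\int[P_ n]_x (inner mu h x ^+ 2)%:E <= (c0 * norm2 mu h ^+ 2)%:E)%E.
Hypothesis moment2 : forall h, h \in circleL2 -> exists v : R,
  (\int[P]_x (inner mu h x ^+ 2)%:E <= v%:E)%E.
Hypothesis cvg_cos_trigp : forall s b,
  \int[P_ n]_x cos (inner mu (trigp s) x + b) @[n --> \oo] -->
  \int[P]_x cos (inner mu (trigp s) x + b).
Hypothesis moment2_proj_error : forall k n,
  (\int[P_ n]_x (proj_error k x ^+ 2)%:E <=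
   (c0 * (k.+1%:R^-1 + n.+1%:R^-1))%:E)%E.

Let bounded_cos h b : h \in circleL2 ->
  bounded_measurable (fun x : borel L2 => cos (inner mu h x + b)).
Proof. by move=> hL; apply: bounded_measurable_cos; exact: measurable_inner_L2. Qed.

Lemma ler_dist_integral_cos n h h' b : h \in circleL2 -> h' \in circleL2 ->
  `|\int[P_ n]_x cos (inner mu h x + b) - \int[P_ n]_x cos (inner mu h' x + b)|
    <= Num.sqrt c0 * norm2 mu (h - h').
Proof.
move=> hL h'L; have L2L := @L2fun_circleL2 R.
have hhL : h - h' \in circleL2 by rewrite rpredB.
have bh := bounded_cos b hL; have bh' := bounded_cos b h'L.
apply: (le_dist_Rintegral (probability_lty _)) => //.
apply: (@le_trans _ _ (\int[P_ n]_x `|inner mu (h - h') x|%:E)%E).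
  apply: ge0_le_integral => //.
  - apply/measurable_EFinP; apply: measurableT_comp => //.
    exact: (bounded_measurableB bh bh').1.
  - apply/measurable_EFinP; apply: measurableT_comp => //.
    exact: measurable_inner_L2.
  - move=> x _; rewrite lee_fin; apply: le_trans (ler_norm_cosB _ _) _.
    by rewrite innerDl ?rpredN ?L2L// innerNl ?L2L// opprD addrACA subrr addr0.
apply: le_trans (integral_norm_le_sqrt (measurable_inner_L2 hhL) (moment2_ n hhL)) _.
by rewrite lee_fin sqrtrM// sqrtr_sqr ger0_norm ?norm2_ge0.
Qed.

Lemma cvg_cos_inner h b : h \in circleL2 ->
  \int[P_ n]_x cos (inner mu h x + b) @[n --> \oo] -->
  \int[P]_x cos (inner mu h x + b).
Proof.
move=> hL; have tL := @trigp_circleL2 R; have L2L := @L2fun_circleL2 R.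
have /choice[s_ s_h] (j : nat) :
    exists s, norm2 mu (h - trigp s) <= j.+1%:R^-1.
  by apply: trigp_dense; rewrite ?invr_gt0 ?ltr0n.
pose cos_ j (x : L2) : R := cos (inner mu (trigp (s_ j)) x + b).
apply: (cvg_of_approx (u_ := fun j n => \int[P_ n]_x cos_ j x)
  (l_ := fun j => \int[P]_x cos_ j x) _ _ (cvg0_natV_mul (Num.sqrt c0)) (cvg_cst 0)).
- by move=> j; exact: cvg_cos_trigp.
- apply: (bounded_cvg_Rintegral (probability_lty P) (M := 1)) => [j||j x|].
  + by have [] := bounded_cos b (tL (s_ j)).
  + by have [] := bounded_cos b hL.
  + exact: cos_max.
  apply: aeW => x; apply/subr_cvg0.
  apply: squeeze0_cvgr (cvg0_natV_mul (norm2 mu x)) => j.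
  apply: le_trans (ler_norm_cosB _ _) _; rewrite opprD addrACA subrr addr0 distrC.
  rewrite -innerNl ?L2L// -innerDl ?rpredN ?L2L//.
  apply: le_trans (ler_norm_inner _ _) _; rewrite ?rpredB ?L2L//.
  by rewrite mulrC ler_wpM2l ?norm2_ge0.
move=> j n; rewrite addr0; apply: le_trans (ler_dist_integral_cos _ _ hL (tL _)) _.
by rewrite ler_wpM2l ?sqrtr_ge0.
Qed.

Section lipschitz_function.
Variables (phi : L2 -> R) (C B : R).
Hypothesis C_ge0 : 0 <= C.
Hypothesis phi_lip : forall x y, `|phi x - phi y| <= C * L2dist x y.
Hypothesis phi_bound : forall x, `|phi x| <= B.

Let phi_proj k (x : L2) : R := phi (mkL2 (cell_proj k x)).

Let bounded_phi : bounded_measurable (phi : borel L2 -> R).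
Proof.
apply: continuous_bounded_measurable_borel phi_bound.
exact: (@lipschitz_continuous _ _ _ C).
Qed.

Let phi_proj_dist k x : `|phi x - phi_proj k x| <= C * proj_error k x.
Proof.
apply: le_trans (phi_lip _ _) _; rewrite -{1}(mkL2K x).
by rewrite L2dist_mkL2 ?L2fun_circleL2 ?cell_proj_circleL2.
Qed.

Lemma cos_stable_phi_proj k : cos_stable P_ P
  [set X | exists2 h, h \in circleL2 & X = (fun x : L2 => inner mu h x)] (phi_proj k).
Proof.
have L2L := @L2fun_circleL2 R.
pose Phi (c : 'I_k.+1 -> R) := phi (mkL2 (stepf c)).
pose X (m : 'I_k.+1) (x : L2) := inner mu (k.+1%:R *: cellf k m) x.
have -> : phi_proj k = fun x => Phi (X^~ x).
  apply/funext => x; congr (phi (mkL2 (stepf _))); apply/funext => m.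
  by rewrite /cell_avg /X innerZl ?cellf_circleL2// innerC.
apply: (@cos_stable_lipschitz R _ _ P_ P _ _ _ _ _ _ k.+1 Phi X C B) => //=.
- move=> _ _ [h hL ->] [h' h'L ->]; exists (h + h'); first by rewrite rpredD.
  by apply/funext => x; rewrite innerDl.
- move=> c _ [h hL ->]; exists (c *: h); first by rewrite rpredZ.
  by apply/funext => x; rewrite innerZl.
- by move=> _ [h hL ->]; exact: measurable_inner_L2.
- move=> _ [h hL ->]; have [v hv] := moment2 hL.
  exists (Num.max v (c0 * norm2 mu h ^+ 2)); split=> [n|].
    by apply: le_trans (moment2_ n hL) _; rewrite lee_fin le_max lexx orbT.
  by apply: le_trans hv _; rewrite lee_fin le_max lexx.
- by move=> _ b [h hL ->]; exact: cvg_cos_inner.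
- by move=> m; exists (k.+1%:R *: cellf k m) => //; rewrite rpredZ ?cellf_circleL2.
- move=> c c'; apply: le_trans (phi_lip _ _) _; rewrite ler_wpM2l//.
  by rewrite L2dist_mkL2 ?stepf_circleL2// -stepfB ler_norm2_stepf.
- by move=> c; exact: phi_bound.
Qed.

Lemma cvg_Rintegral_phi_proj k :
  \int[P_ n]_x phi_proj k x @[n --> \oo] --> \int[P]_x phi_proj k x.
Proof.
apply: cvg_cos_stable (cos_stable_phi_proj k).
by exists 0; [exact: rpred0|apply/funext => x; rewrite inner0l].
Qed.

Lemma Rintegral_phi_proj_dist k n :
  `|\int[P_ n]_x phi x - \int[P_ n]_x phi_proj k x| <=
  C * Num.sqrt (c0 * k.+1%:R^-1) + C * Num.sqrt (c0 * n.+1%:R^-1).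
Proof.
have bproj := (cos_stable_phi_proj k).1; have mpe := @measurable_proj_error R k.
rewrite -mulrDr.
apply: (@le_trans _ _ (C * Num.sqrt (c0 * (k.+1%:R^-1 + n.+1%:R^-1)))); last first.
  by rewrite ler_wpM2l// mulrDr ler_sqrtD ?mulr_ge0.
apply: (le_dist_Rintegral (probability_lty _)) => //.
apply: (@le_trans _ _ (\int[P_ n]_x (C%:E * `|proj_error k x|%:E))%E).
  apply: ge0_le_integral => //.
  - apply/measurable_EFinP; apply: measurableT_comp => //.
    exact: (bounded_measurableB bounded_phi bproj).1.
  - by apply: emeasurable_funM => //; apply/measurable_EFinP; exact: measurableT_comp.
  - move=> x _; rewrite -EFinM lee_fin (le_trans (phi_proj_dist k x))//.
    by rewrite ler_wpM2l// ler_norm.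
rewrite ge0_integralZl_EFin//; last first.
  by apply/measurable_EFinP; exact: measurableT_comp.
rewrite EFinM lee_wpmul2l ?lee_fin//.
exact: integral_norm_le_sqrt mpe (moment2_proj_error k n).
Qed.

Lemma lipschitz_cvg : \int[P_ n]_x phi x @[n --> \oo] --> \int[P]_x phi x.
Proof.
have cvg0 : C * Num.sqrt (c0 * n.+1%:R^-1) @[n --> \oo] --> (0 : R).
  rewrite -(mulr0 C) -(@sqrtr0 R); apply: cvgMl_tmp.
  apply: (@cvg_comp _ _ _ _ Num.sqrt _ (nbhs (0 : R))); last exact: sqrt_continuous.
  exact: cvg0_natV_mul.
apply: (cvg_of_approx cvg_Rintegral_phi_proj _ cvg0 cvg0 Rintegral_phi_proj_dist).
apply: (bounded_cvg_Rintegral (probability_lty P) (M := B)) => [k||k x|] //.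
- exact: (cos_stable_phi_proj k).1.1.
- exact: bounded_phi.1.
- exact: phi_bound.
apply: aeW => x; apply/subr_cvg0.
apply: (squeeze0_cvgr (v := fun k => C * proj_error k x)) => [k|].
  by rewrite distrC phi_proj_dist.
by rewrite -(mulr0 C); apply: cvgMl_tmp; exact/cvg_proj_error/L2fun_circleL2.
Qed.

End lipschitz_function.

Lemma weakly_converges_criterion : weakly_converges P_ P.
Proof. exact/weakly_converges_lipschitz/lipschitz_cvg. Qed.

End weak_convergence_criterion.

(** * The reconstructed measures *)

Section centered_gaussian_moments.
Context {R : realType} {T : ptopologicalType} (dot : T -> T -> R).
Variables (C : T -> T) (P : probability (borel T) R).
Hypothesis P_gaussian : centered_gaussian dot C P.
Implicit Types (h : T) (b : R).

Lemma centered_gaussian_moment1 h : (\int[P]_x (dot h x)%:E = 0)%E.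
Proof. by have [_ /(_ h)] := P_gaussian; rewrite unlock. Qed.

Lemma centered_gaussian_moment2 h :
  (\int[P]_x (dot h x ^+ 2)%:E = (dot h (C h))%:E)%E.
Proof.
have [_ c /(_ h h)] := P_gaussian; rewrite unlock c unlock/= => <-.
by apply: eq_integral => x _; rewrite -[dot h x]subr0 expr2.
Qed.

Lemma centered_gaussian_moment_cos h b : continuous (dot h) ->
  \int[P]_x cos (dot h x + b) =
  gaussian_cos b (Num.sqrt (dot h (C h) / standard_normal_sqr)).
Proof.
move=> ch; have [/(_ h)[m [s dot_law]] _ _] := P_gaussian.
apply: (centered_gaussian_cos (continuous_measurable_borel ch) dot_law).
  exact: centered_gaussian_moment1.
exact: centered_gaussian_moment2.
Qed.

End centered_gaussian_moments.

Section limit_measure.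
Context {R : realType}.
Local Notation mu := (circle_measure R).
Local Notation L2 := (L2circle R).
Variables (C : L2 -> L2) (nu : probability (borel L2) R).
Hypothesis nu_gaussian : centered_gaussian (@L2dot R) C nu.
Implicit Types (h : R -> R) (b : R).

Let L2dot_mkL2 h : h \in circleL2 ->
  L2dot (mkL2 h) = (fun x : L2 => inner mu h x).
Proof.
by move=> hL; apply/funext => x; exact: inner_mkL2l hL (L2fun_circleL2 x).
Qed.

Lemma L2_gaussian_moment2 h : h \in circleL2 ->
  (\int[nu]_x (inner mu h x ^+ 2)%:E = (L2dot (mkL2 h) (C (mkL2 h)))%:E)%E.
Proof.
by move=> hL; rewrite -(centered_gaussian_moment2 nu_gaussian) L2dot_mkL2.
Qed.

Lemma L2_gaussian_moment_cos h b : h \in circleL2 ->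
  \int[nu]_x cos (inner mu h x + b) =
  gaussian_cos b (Num.sqrt (L2dot (mkL2 h) (C (mkL2 h)) / standard_normal_sqr)).
Proof.
move=> hL; rewrite -(centered_gaussian_moment_cos nu_gaussian) L2dot_mkL2//.
exact: continuous_inner_L2.
Qed.

End limit_measure.

Section reconstructed_measure.
Context {R : realType} (n : nat) (kappa : R).
Local Notation mu := (circle_measure R).
Variable nu : probability (borel 'cV[R]_n.+1) R.
Hypothesis nu_gaussian : centered_gaussian (@vec_dot R n)
  (mulmx (invmx (kappa *: discreteL n))) nu.
Local Notation Q := (distribution nu (@reconstruction_mfun R n)).
Implicit Types (f : 'cV[R]_n.+1) (h : R -> R) (b : R).

Lemma reconstruction_ae f :
  {ae mu, forall t, reconstruction f t = stepf (fun m => f m 0) t}.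
Proof.
have : {ae mu, forall t, reconstruction f t = step_fun f t} by exact: L2_ofE.
by apply: filterS => t ->; rewrite /stepf fct_sumE.
Qed.

Lemma inner_reconstruction h f : h \in circleL2 ->
  inner mu h (reconstruction f) = vec_dot (cell_ints n h) f.
Proof.
move=> hL; rewrite innerC; have rL := L2fun_circleL2 (reconstruction f).
rewrite (eq_inner_ae rL (stepf_circleL2 _) hL (reconstruction_ae f)) inner_stepfl//.
by apply: eq_bigr => m _; rewrite mxE (innerC mu h) mulrC.
Qed.

Lemma continuous_vec_dot f : continuous (vec_dot f).
Proof.
apply: continuous_big => [|m _ g]; first exact: add_continuous.
apply: cvgMl_tmp; [exact: nbhs_filter|exact: coord_continuous].
Qed.

Lemma reconstructed_moment2 h : h \in circleL2 ->
  (\int[Q]_x (inner mu h x ^+ 2)%:E = (discrete_variance kappa n h)%:E)%E.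
Proof.
move=> hL; rewrite ge0_integral_distribution; last 2 first.
- apply/measurable_EFinP; apply: measurable_funX; exact: measurable_inner_L2.
- by move=> x; rewrite lee_fin sqr_ge0.
rewrite -(centered_gaussian_moment2 nu_gaussian); apply: eq_integral => f _ /=.
by rewrite inner_reconstruction.
Qed.

Lemma reconstructed_moment_cos h b : h \in circleL2 ->
  \int[Q]_x cos (inner mu h x + b) =
  gaussian_cos b (Num.sqrt (discrete_variance kappa n h / standard_normal_sqr)).
Proof.
move=> hL; have mh := measurable_inner_L2 hL.
have mhr : measurable_fun [set: borel 'cV[R]_n.+1]
    (fun f : 'cV[R]_n.+1 => inner mu h (reconstruction f)).
  exact: measurableT_comp mh (@measurable_reconstruction R n).
rewrite -(centered_gaussian_moment_cos nu_gaussian _ (@continuous_vec_dot _)).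
rewrite /Rintegral integral_distribution.
- by congr fine; apply: eq_integral => f _ /=; rewrite inner_reconstruction.
- by apply/measurable_EFinP; exact: (bounded_measurable_cos b mh).1.
- have := bounded_measurable_cos b mhr.
  by move=> /(bounded_measurable_integrable (probability_lty nu)); exact.
Qed.

End reconstructed_measure.

Section overlaps.
Context {R : realType}.
Local Notation mu := (circle_measure R).
Implicit Types (n k : nat) (t : R).

Definition overlap n k (m l : nat) : R := inner mu (cellf n m) (cellf k l).

Lemma overlap_ge0 n k (m l : nat) : 0 <= overlap n k m l.
Proof. by rewrite /overlap inner_indic ?fine_ge0//; exact: measurable_cell. Qed.

Lemma overlap_neq0 n k (m l : nat) : overlap n k m l != 0 ->
  exists t : R, cell n m t /\ cell k l t.
Proof.
rewrite /overlap inner_indic; [|exact: measurable_cell..].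
apply: contra_neqP => /forallNP ml; rewrite (_ : cell n m `&` cell k l = set0).
  by rewrite measure0.
by apply/seteqP; split=> // t; exact: ml.
Qed.

Lemma inner_stepf_overlap n k (c : 'I_n.+1 -> R) (e : 'I_k.+1 -> R) :
  inner mu (stepf c) (stepf e) =
  \sum_(p : 'I_n.+1 * 'I_k.+1) c p.1 * e p.2 * overlap n k p.1 p.2.
Proof.
rewrite inner_stepfl ?stepf_circleL2//.
rewrite -(pair_bigA _ (fun m l => c m * e l * overlap n k m l)).
apply: eq_bigr => m _.
rewrite innerC inner_stepfl ?cellf_circleL2// mulr_sumr; apply: eq_bigr => l _.
by rewrite mulrA /overlap innerC.
Qed.

(* Both [stepf (fun=> 1)] are the constant 1 on the circle. *)
Lemma sqr_norm2_stepf n k (c : 'I_n.+1 -> R) : norm2 mu (stepf c) ^+ 2 =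
  inner mu (stepf (fun m => c m ^+ 2)) (stepf (fun _ : 'I_k.+1 => 1)).
Proof.
have one j : {ae mu, forall t, stepf (fun _ : 'I_j.+1 => 1) t = (cst 1 : R -> R) t}.
  apply: circle_ae => t /ltW t0 t1; have [m tm] := ex_cell j t0 t1.
  by rewrite (stepf_cell _ tm).
have L1 : (cst 1 : R -> R) \in circleL2.
  by apply: bounded_measurable_circleL2; exact: bounded_measurable_cst.
rewrite [RHS]innerC (eq_inner_ae _ L1 _ (one k)) ?stepf_circleL2//.
rewrite -(eq_inner_ae _ L1 _ (one n)) ?stepf_circleL2// sqr_norm2 ?stepf_circleL2//.
by rewrite !inner_stepf; congr (_ * _); apply: eq_bigr => m _; rewrite mul1r expr2.
Qed.

Lemma sum_overlap n k :
  \sum_(p : 'I_n.+1 * 'I_k.+1) overlap n k p.1 p.2 = 1.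
Proof.
have := @sqr_norm2_stepf n k (fun=> 1); rewrite inner_stepf_overlap.
rewrite sqr_norm2 ?stepf_circleL2// inner_stepf.
under eq_bigr do rewrite mulr1; rewrite sumr_const card_ord mulVf// => ->.
by apply: eq_bigr => p _; rewrite expr1n !mul1r.
Qed.

Lemma sqr_norm2_stepfB n k (c : 'I_n.+1 -> R) (e : 'I_k.+1 -> R) :
  norm2 mu (stepf c - stepf e) ^+ 2 =
  \sum_(p : 'I_n.+1 * 'I_k.+1) (c p.1 - e p.2) ^+ 2 * overlap n k p.1 p.2.
Proof.
have [cL eL] : stepf c \in circleL2 /\ stepf e \in circleL2.
  by split; exact: stepf_circleL2.
rewrite sqr_norm2D ?rpredN// norm2N// innerC innerNl// innerC.
rewrite (sqr_norm2_stepf k c) (sqr_norm2_stepf n e).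
rewrite (innerC mu (stepf (fun l => e l ^+ 2))) !inner_stepf_overlap.
rewrite mulrN mulr_sumr -sumrB -big_split; apply: eq_bigr => p _ /=; ring.
Qed.

Lemma cell_meet_ltn n k (m l : nat) t : cell n m t -> cell k l t ->
  (l * n.+1 < m.+1 * k.+1)%N.
Proof.
rewrite /cell/= !in_itv/= => /andP[_ m2] /andP[l1 _].
rewrite -(ltr_nat R) !natrM -ltr_pdivrMr// mulrAC -ltr_pdivlMr//.
exact: le_lt_trans l1 m2.
Qed.

End overlaps.

Section coarse_index.
Implicit Types (n k : nat).

Definition coarse_index n k (l : 'I_k.+1) : 'I_n.+1 := inord ((l * n.+1) %/ k.+1).

Lemma coarse_index_le n k (m : 'I_n.+1) (l : 'I_k.+1) :
  (l * n.+1 < m.+1 * k.+1)%N -> (m * k.+1 < l.+1 * n.+1)%N ->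
  (coarse_index n l <= m)%N /\ ((m - coarse_index n l) * k.+1 <= k.+1 + n.+1)%N.
Proof.
move=> lm ml; have qm : ((l * n.+1) %/ k.+1 < m.+1)%N by rewrite ltn_divLR.
have -> : coarse_index n l = ((l * n.+1) %/ k.+1)%N :> nat.
  by rewrite /coarse_index inordK//; exact: leq_trans qm (ltn_ord m).
split; first by rewrite -ltnS.
have lq : (l * n.+1 < ((l * n.+1) %/ k.+1).+1 * k.+1)%N by rewrite ltn_ceil.
rewrite mulnBl leq_subLR; apply: ltnW; apply: leq_trans ml _.
by rewrite mulSn addnA addnC leq_add2r addnC -mulSn ltnW.
Qed.

End coarse_index.

Section reconstructed_projection.
Context {R : realType} (n k : nat) (kappa : R).
Local Notation mu := (circle_measure R).
Hypothesis kappa_gt0 : 0 < kappa.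
Variable nu : probability (borel 'cV[R]_n.+1) R.
Hypothesis nu_gaussian : centered_gaussian (@vec_dot R n)
  (mulmx (invmx (kappa *: discreteL n))) nu.
Local Notation Q := (distribution nu (@reconstruction_mfun R n)).
Implicit Types (p : 'I_n.+1 * 'I_k.+1) (f : 'cV[R]_n.+1).

Let w p : R := overlap n k p.1 p.2.

Let increment p : 'cV[R]_n.+1 := delta_mx p.1 0 - delta_mx (coarse_index n p.2) 0.

Let increment_dot p f :
  vec_dot (increment p) f = f p.1 0 - f (coarse_index n p.2) 0.
Proof.
by rewrite vec_dotC vec_dotDr -scaleN1r vec_dotZr !(vec_dotC f) !vec_dot_delta mulN1r.
Qed.

Lemma proj_error_reconstruction f : proj_error k (reconstruction f) ^+ 2 <=
  \sum_p w p * vec_dot (increment p) f ^+ 2.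
Proof.
have rL := L2fun_circleL2 (reconstruction f).
pose c (m : 'I_n.+1) := f m 0; pose e (l : 'I_k.+1) := f (coarse_index n l) 0.
have rE : norm2 mu ((reconstruction f : R -> R) - stepf e) =
    norm2 mu (stepf c - stepf e).
  apply: eq_norm2_ae; rewrite ?rpredB ?stepf_circleL2//.
  by have := reconstruction_ae f; apply: filterS => t /= rt; rewrite !fctE rt.
apply: (@le_trans _ _ (norm2 mu (stepf c - stepf e) ^+ 2)).
  by rewrite lerXn2r ?nnegrE ?norm2_ge0// -rE; exact: proj_error_best.
rewrite sqr_norm2_stepfB; apply: ler_sum => p _.
by rewrite increment_dot mulrC.
Qed.

Lemma overlap_increment_variance p :
  w p * vec_dot (increment p) (discrete_inv kappa (increment p)) <=
  kappa^-1 * (k.+1%:R^-1 + n.+1%:R^-1) * w p.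
Proof.
rewrite mulrC; have [->|wp] := eqVneq (w p) 0; first by rewrite !mulr0.
have [t [mt lt]] := overlap_neq0 wp.
have [cm cn] := coarse_index_le (cell_meet_ltn mt lt) (cell_meet_ltn lt mt).
rewrite ler_wpM2r ?overlap_ge0//.
apply: le_trans (discrete_variance_increment kappa_gt0 cm) _.
rewrite invfM mulrCA ler_wpM2l ?invr_ge0 ?(ltW kappa_gt0)//.
have -> : k.+1%:R^-1 + n.+1%:R^-1 = (k.+1 + n.+1)%:R / k.+1%:R / n.+1%:R :> R.
  by rewrite natrD !mulrDl divff ?pnatr_eq0// mul1r mulrAC divff ?pnatr_eq0// mul1r addrC.
by rewrite ler_wpM2r ?invr_ge0// ler_pdivlMr// -natrM ler_nat.
Qed.

Lemma reconstructed_proj_error : (\int[Q]_x (proj_error k x ^+ 2)%:E <=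
  (kappa^-1 * (k.+1%:R^-1 + n.+1%:R^-1))%:E)%E.
Proof.
have mpe := @measurable_proj_error R k.
have mdot p : measurable_fun [set: borel 'cV[R]_n.+1]
    (fun f : 'cV[R]_n.+1 => (vec_dot (increment p) f ^+ 2)%:E).
  apply/measurable_EFinP; apply: measurable_funX.
  by apply: continuous_measurable_borel; exact: continuous_vec_dot.
rewrite ge0_integral_distribution; last 2 first.
- by apply/measurable_EFinP; exact: measurable_funX.
- by move=> x; rewrite lee_fin sqr_ge0.
apply: (@le_trans _ _
    (\int[nu]_f \sum_p ((w p)%:E * (vec_dot (increment p) f ^+ 2)%:E))%E).
  apply: ge0_le_integral => //.
  - by move=> f _; rewrite lee_fin sqr_ge0.
  - apply/measurable_EFinP; apply: measurable_funX.
    exact: (measurableT_comp mpe (@measurable_reconstruction R n)).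
  - by apply: emeasurable_sum => p; exact: emeasurable_funM.
  - move=> f _ /=; under eq_bigr do rewrite -EFinM.
    by rewrite sumEFin lee_fin proj_error_reconstruction.
rewrite ge0_integral_sum//; last 2 first.
- by move=> p; exact: emeasurable_funM.
- by move=> p f _; rewrite -EFinM lee_fin mulr_ge0 ?overlap_ge0 ?sqr_ge0.
rewrite -[X in (_ <= X%:E)%E]mulr1 -[X in _ * X](sum_overlap n k) mulr_sumr -sumEFin.
apply: lee_sum => p _; rewrite ge0_integralZl_EFin ?overlap_ge0//; last first.
  by move=> f _; rewrite lee_fin sqr_ge0.
rewrite (centered_gaussian_moment2 nu_gaussian) -EFinM lee_fin.
exact: overlap_increment_variance.
Qed.

End reconstructed_projection.

Theorem lemma4p2 (R : realType) (kappa : R) (kappa_gt0 : 0 < kappa)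
    (nu_ : forall n : nat, probability (borel 'cV[R]_n.+1) R)
    (nu_gaussian : forall n : nat,
      centered_gaussian (@vec_dot R n)
        (mulmx (invmx (kappa *: discreteL n))) (nu_ n))
    (nu : probability (borel (L2circle R)) R)
    (nu_gaussian_L2 :
      centered_gaussian (@L2dot R)
        (inverse_operator (scale_graph kappa (@scrL_graph R))) nu) :
  weakly_converges
    (fun n => distribution (nu_ n) (@reconstruction_mfun R n)) nu.
Proof.
apply: (weakly_converges_criterion (c0 := kappa^-1)).
- by rewrite invr_ge0 ltW.
- move=> n h hL; rewrite (reconstructed_moment2 (nu_gaussian n) hL) lee_fin mulrC.
  exact: discrete_variance_le.
- move=> h hL; rewrite (L2_gaussian_moment2 nu_gaussian_L2 hL).
  by eexists; exact: lexx.
- move=> s b; have sL := trigp_circleL2 s.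
  under eq_fun do rewrite (reconstructed_moment_cos (nu_gaussian _) b sL).
  rewrite (L2_gaussian_moment_cos nu_gaussian_L2 b sL) inverse_operator_trigp//.
  apply: cvg_gaussian_cos; apply: continuous_cvg; first exact: sqrt_continuous.
  by apply: cvgMr_tmp; exact: cvg_discrete_variance_trigp.
- by move=> k n; exact: reconstructed_proj_error.
Qed.
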